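(* For every fixed integer $L_0\ge0$, the best Tailored Base-Surge policy is asymptotically optimal as the regular lead time grows: $$\lim_{L\to\infty}\frac{C(\pi_{r^*,S^*})}{\mathrm{OPT}(L)}=1 .$$
   Context: **Model.** $D$ is a nonnegative random variable with finite mean and strictly positive (possibly infinite) variance. $\{D_t\}_{t\in\mathbb Z}$ and $\{D'_t\}_{t\in\mathbb Z}$ are mutually independent sequences of i.i.d. copies of $D$, and $\hat G$ is an independent random variable with $\mathbb P(\hat G=k)=2^{-k}$, $k\ge 1$. The express source has integer lead time $L_0\ge 0$, the regular source integer lead time $L>L_0+1$. Unit holding and backorder costs are $h,b>0$; the unit purchase cost of the regular source is $c_R=0$ and that of the express source is $c>0$. $x^+=\max(x,0)$, $x^-=\max(-x,0)$, $G(y)=hy^+ + by^-$. Empty sums are $0$. In each period $t\ge1$ nonnegative orders $q_t^R,q_t^E$ are placed at the regular and express source ($q_k^R=q_k^E=0$ for $k\le 0$). The on-hand inventory satisfies $I_1=-\sum_{i=1}^{\hat G}D'_{-i}$ and $I_{t+1}=I_t+q_{t-L}^R+q_{t-L_0}^E-D_t$. The expedited inventory position is $\hat I_t=I_t+\sum_{k=t-L_0}^{t-1}q_k^E+\sum_{k=t-L}^{t-L+L_0}q_k^R$ and the truncated regular pipeline is $\mathcal R^t=(q^R_{t-L+L_0+1},\dots,q^R_{t-1})\in\mathbb R^{L-L_0-1}$. An admissible policy $\pi\in\hat\Pi$ is a sequence of measurable maps $\hat f_t^\pi:\mathbb R^{L-L_0}\to[0,\infty)^2$, with $(q_t^R,q_t^E)=\hat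 f_t^\pi(\mathcal R^t,\hat I_t)$. (It is known that restricting to $\hat\Pi$, instead of policies depending on the full state, does not change the optimal value.) For $t\ge L_0+1$ the cost is $$C_t^\pi=c\,q_{t-L_0}^E+G(I_t+q_{t-L}^R+q_{t-L_0}^E-D_t)=c\,q_{t-L_0}^E+G\Big(\hat I_{t-L_0}+q_{t-L_0}^E-\sum_{i=t-L_0}^tD_i\Big).$$ $C(\pi)=\limsup_{T\to\infty}\frac1T\sum_{t=L_0+1}^T\mathbb E[C_t^\pi]$ and $\mathrm{OPT}(L)=\inf_{\pi\in\hat\Pi}C(\pi)$. **Tailored Base-Surge (TBS) policies.** The policy $\pi_{r,S}$ sets $q_t^R=r$ and $q_t^E=\max(0,S-\hat I_t)$ for all $t\ge1$. It is known that, with $I_\infty^r=\sup_{j\ge0}(jr-\sum_{i=1}^jD_i)$, $$C(\pi_{r,S})=c(\mathbb E[D]-r)+\mathbb E\Big[G\Big(I_\infty^r+S-\sum_{i=1}^{L_0+1}D_i'\Big)\Big],$$ which does not depend on $L$. Let $F^\infty(r)=\inf_{S\in\mathbb R}C(\pi_{r,S})$. The pair $(r^*,S^* )$ is any pair with $r^*\in\operatorname{arg\,min}_{0\le r\le\mathbb E[D]}F^\infty(r)$ and $S^*\in\operatorname{arg\,min}_{S\in\mathbb R}C(\pi_{r^*,S})$ (such a pair exists). *)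

(* Defs.v *)
From HB Require Import structures.
From mathcomp Require Import all_boot all_order all_algebra.
From mathcomp Require Import all_classical all_reals all_analysis.
From mathcomp Require Import zify.
Import Order.TTheory GRing.Theory Num.Theory.
Import numFieldNormedType.Exports.

Set Implicit Arguments.
Unset Strict Implicit.
Unset Printing Implicit Defensive.

Local Open Scope classical_set_scope.
Local Open Scope ring_scope.

Definition mutually_independent {d} {Om : measurableType d} {R : realType}
    (P : probability Om R) (I : choiceType) (F : I -> set (set Om)) : Prop :=
  forall (J : seq I) (A : I -> set Om), uniq J ->
    (forall j, j \in J -> F j (A j)) ->
    P (\bigcap_(j in [set` J]) A j) = (\prod_(j <- J) P (A j))%E.

Definition sigma_of {d d'} {Om : measurableType d} {T : measurableType d'}
    (X : Om -> T) : set (set Om) :=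
  preimage_set_system setT X measurable.

(* The sigma-algebras generated by all the D_t, all the D'_t and Ghat, indexed
   by a disjoint union since the codomains differ. *)
Definition source_sigma {d} {Om : measurableType d} {R : realType}
    (dem dem' : int -> Om -> R) (Ghat : Om -> nat)
    (i : int + int + unit) : set (set Om) :=
  match i with
  | inl (inl t) => sigma_of (dem t)
  | inl (inr t) => sigma_of (dem' t)
  | inr tt => sigma_of Ghat
  end.

(* regular k and express k are the orders placed in period k; they are 0 for
   k = 0 and for the periods that are still to come. *)
Record state (R : Type) := State {
  inventory_level : R; regular : nat -> R; express : nat -> R }.

Section Dynamics.
Context {R : realType} (L L0 : nat).

(* f t (pipeline, expedited position) = (regular order, express order) *)
Definition policy := nat -> (L - L0.+1).-tuple R * R -> R * R.

Definition admissible (f : policy) : Prop :=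
  forall t, (0 < t)%N ->
    measurable_fun setT (f t) /\ forall x, 0 <= (f t x).1 /\ 0 <= (f t x).2.

Definition tbs (r S : R) : policy := fun _ x => (r, Num.max 0 (S - x.2)).

(* In all indices below the truncated subtraction sends the periods k <= 0 to
   k = 0, or drops them from the range of a sum; no order is placed then. *)
Definition expedited_position (J : R) (qR qE : nat -> R) (t : nat) : R :=
  J + \sum_(t - L0 <= k < t) qE k + \sum_(t - L <= k < (t + L0).+1 - L) qR k.

Definition pipeline (qR : nat -> R) (t : nat) : (L - L0.+1).-tuple R :=
  [tuple qR (t + L0 + 1 + i - L)%N | i < L - L0.+1].

Definition set_order (q : nat -> R) (t : nat) (x : R) : nat -> R :=
  fun k => if k == t then x else q k.

(* The state at the start of period n.+1, before its orders are placed, when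
   the initial inventory is x and the demand in period t is dm t. *)
Fixpoint state_after (f : policy) (x : R) (dm : nat -> R) (n : nat) : state R :=
  if n is m.+1 then
    let: State J qR qE := state_after f x dm m in
    let t := m.+1 in
    let o := f t (pipeline qR t, expedited_position J qR qE t) in
    let qR' := set_order qR t o.1 in
    let qE' := set_order qE t o.2 in
    State (J + qR' (t - L)%N + qE' (t - L0)%N - dm t) qR' qE'
  else State x (fun=> 0) (fun=> 0).

Definition inventory f x dm (t : nat) : R :=
  inventory_level (state_after f x dm t.-1).
Definition regular_order f x dm (t : nat) : R :=
  regular (state_after f x dm t) t.
Definition express_order f x dm (t : nat) : R :=
  express (state_after f x dm t) t.

Lemma state_after_orders f x dm n k :
  regular (state_after f x dm n) k =
    (if (k <= n)%N then regular_order f x dm k else 0) /\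
  express (state_after f x dm n) k =
    (if (k <= n)%N then express_order f x dm k else 0).
Proof.
elim: n => [|n [IHR IHE]]; first by case: k.
rewrite leq_eqVlt ltnS; case: (eqVneq k n.+1) => [->//|kn] /=.
by rewrite -IHR -IHE; case: state_after => J qR qE /=; rewrite /set_order (negPf kn).
Qed.

Lemma inventory1 f x dm : inventory f x dm 1 = x.
Proof. by []. Qed.

Lemma orders0 f x dm : regular_order f x dm 0 = 0 /\ express_order f x dm 0 = 0.
Proof. by []. Qed.

Lemma inventoryS f x dm t : (0 < t)%N ->
  inventory f x dm t.+1 = inventory f x dm t + regular_order f x dm (t - L)%N
    + express_order f x dm (t - L0)%N - dm t.
Proof.
case: t => // t _.
have [+ _] := state_after_orders f x dm t.+1 (t.+1 - L).
have [_ +] := state_after_orders f x dm t.+1 (t.+1 - L0).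
rewrite !leq_subr => <- <-.
by rewrite /inventory /=; case: state_after.
Qed.

Lemma ordersE f x dm t : (L0.+1 < L)%N -> (0 < t)%N ->
  (regular_order f x dm t, express_order f x dm t) =
  f t (pipeline (regular_order f x dm) t,
       expedited_position (inventory f x dm t) (regular_order f x dm)
         (express_order f x dm) t).
Proof.
case: t => // t L0L _.
have pipeE : pipeline (regular_order f x dm) t.+1 =
             pipeline (regular (state_after f x dm t)) t.+1.
  apply: eq_mktuple => i; have iL := ltn_ord i.
  by have [-> _] := state_after_orders f x dm t (t.+1 + L0 + 1 + i - L); rewrite ifT//; lia.
have posE : expedited_position (inventory f x dm t.+1) (regular_order f x dm)
              (express_order f x dm) t.+1 =
    expedited_position (inventory f x dm t.+1) (regular (state_after f x dm t))
              (express (state_after f x dm t)) t.+1.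
  rewrite /expedited_position; congr (_ + _ + _); apply: eq_big_nat => k kt.
    by have [_ ->] := state_after_orders f x dm t k; rewrite ifT//; lia.
  by have [-> _] := state_after_orders f x dm t k; rewrite ifT//; lia.
rewrite pipeE posE /regular_order /express_order /inventory /=.
by case: state_after => J qR qE /=; rewrite /set_order eqxx -surjective_pairing.
Qed.

Definition holding_backorder (h b y : R) : R :=
  h * Num.max y 0 + b * Num.max (- y) 0.

Definition period_cost (h b c : R) f x dm (t : nat) : R :=
  c * express_order f x dm (t - L0)%N +
  holding_backorder h b (inventory f x dm t + regular_order f x dm (t - L)%N
    + express_order f x dm (t - L0)%N - dm t).

End Dynamics.

Section LongRun.
Context {d : measure_display} {Om : measurableType d} {R : realType}.
Context (P : probability Om R) (dem dem' : int -> Om -> R) (Ghat : Om -> nat).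
Context (h b c : R) (L0 L : nat).

Definition initial_inventory (w : Om) : R :=
  - \sum_(1 <= i < (Ghat w).+1) dem' (- i%:Z) w.

Definition expected_cost (f : policy L L0) (t : nat) : \bar R :=
  'E_P[fun w => period_cost h b c f (initial_inventory w)
                  (fun s => dem s%:Z w) t].

Definition long_run_cost (f : policy L L0) : \bar R :=
  limn_esup (fun T : nat =>
    (T%:R^-1)%:E * \sum_(L0.+1 <= t < T.+1) expected_cost f t)%E.

Definition opt_cost : \bar R :=
  ereal_inf [set long_run_cost f | f in @admissible R L L0].

Definition tbs_cost (r S : R) : \bar R := long_run_cost (tbs r S).

Definition tbs_value (r : R) : \bar R := ereal_inf [set tbs_cost r S | S in setT].

(* r minimises F^oo over [0, E[D]] and S minimises the cost of (r, S).  The cost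
   is the long-run cost in the system with regular lead time L; its actual
   independence of L is not built in. *)
Definition best_tbs (D : Om -> R) (r S : R) : Prop :=
  [/\ 0 <= r, (r%:E <= 'E_P[D])%E,
      forall r', 0 <= r' -> (r'%:E <= 'E_P[D])%E ->
        (tbs_value r <= tbs_value r')%E
    & forall S', (tbs_cost r S <= tbs_cost r S')%E].

End LongRun.

(* Main.v *)
(* Compare an arbitrary policy with a base-stock policy for a constant regular
   order r, over a window of M + 1 periods.  A regular order enters the expedited
   position only L - L0 - 1 periods after it is placed, so for L large the ones
   that enter during the window are fixed before it starts.  The finite-horizon
   problem is convex; the multipliers of its constraints solve a backward
   recursion and vanish when the reference path places an express order, and
   their expectations, the prices of the regular orders, depend neither on the
   starting period of the window nor on the policy.  Hence the cost of the policy
   over the window is at least that of the reference path plus a combination,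
   with nonnegative weights, of the differences between the mean regular orders
   and r.  Averaged over all starting periods, the latter is nonnegative as soon
   as r is at most the long-run mean regular order, and r can be taken within a
   small error of that mean in a finite grid of [0, E[D]).  The express
   orders make up for E[D] minus the mean regular order.

   The reference path lies between Lindley chains X' = max(0, X + r - D) shifted
   by base-stock levels, so its average cost is at least that of the best TBS
   policy with regular order r, up to an error vanishing with M.  As E[D] > 0 and
   D is not constant, r = E[D] gives an infinite TBS cost; hence the optimal TBS
   cost is positive, and OPT(L) lies between it minus epsilon and itself for L
   large. *)
From HB Require Import structures.
Require Import Defs.
From mathcomp Require Import all_boot all_order all_algebra.
From mathcomp Require Import all_classical all_reals all_analysis.
From mathcomp Require Import measurable_realfun zify ring lra.
Import Order.TTheory GRing.Theory Num.Theory.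
Import numFieldNormedType.Exports.

Set Implicit Arguments.
Unset Strict Implicit.
Unset Printing Implicit Defensive.

Local Open Scope classical_set_scope.
Local Open Scope ring_scope.

(** * Lipschitz functions and expectations *)

(** Three obstacles shape the proof. First, [D] has only a first moment: expectations along paths
    are written as iterates of transition operators acting on Lipschitz functions, and the
    stationary cost is the limit of such iterates from 0, so no stationary law is constructed.
    Second, the cost has a kink, where its subgradient jumps; a clamped slope, only an
    eps-subgradient, keeps the multipliers continuous, so that base-stock levels can be exact zeros
    of them. Third, the window length must be fixed before the lead time and the policy. Express
    orders are therefore free inside the window problem, their cost being recovered from the balance
    of the position over the whole horizon; and the position of the policy at the start of the
    window does not matter, as the reference path starts at a zero of its first multiplier. A
    regular order entering the window is known when the window starts, while the reference path is
    driven by later demands only, so prices factor out of expectations; averaging over starting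
    periods lets one rate stand for orders that vary with time. *)

Definition lip {R : realType} (k : R) (f : R -> R) : Prop :=
  forall x y, `|f x - f y| <= k * `|x - y|.

Definition ndecr {R : realType} (f : R -> R) : Prop :=
  forall x y, x <= y -> f x <= f y.

Section Lipschitz.
Context {R : realType}.
Implicit Types (f g : R -> R) (k l x y : R).

Lemma lip_ge0 k f : lip k f -> 0 <= k.
Proof.
move=> /(_ 1 0); rewrite subr0 normr1 mulr1.
by apply: le_trans; exact: normr_ge0.
Qed.

Lemma lip_continuous k f : lip k f -> continuous f.
Proof.
move=> kf x; apply/cvgrPdist_lt => e e0.
have k0 := lip_ge0 kf.
have d0 : 0 < e / (k + 1) by rewrite divr_gt0// ltr_wpDl.
near=> y.
have xy : `|x - y| < e / (k + 1) by near: y; exact: cvgr_dist_lt.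
apply: le_lt_trans (kf _ _) _.
apply: (@le_lt_trans _ _ ((k + 1) * `|x - y|)).
  by apply: ler_wpM2r => //; rewrite lerDl.
by rewrite mulrC -ltr_pdivlMr// ltr_wpDl.
Unshelve. all: by end_near. Qed.

Lemma lip_measurable k f : lip k f -> measurable_fun [set: R] f.
Proof. by move=> /lip_continuous/continuous_measurable_fun. Qed.

Lemma lip_cst k a : 0 <= k -> lip k (fun=> a).
Proof. by move=> k0 x y; rewrite subrr normr0 mulr_ge0. Qed.

Lemma lip_id : lip 1 (fun x : R => x).
Proof. by move=> x y; rewrite mul1r. Qed.

Lemma lipD k l f g : lip k f -> lip l g -> lip (k + l) (fun x => f x + g x).
Proof.
move=> kf lg x y; rewrite mulrDl opprD addrACA.
by apply: le_trans (ler_normD _ _) _; exact: lerD.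
Qed.

Lemma lipZ a k f : lip k f -> lip (`|a| * k) (fun x => a * f x).
Proof. by move=> kf x y; rewrite -mulrBr normrM -mulrA ler_wpM2l. Qed.

Lemma lip_comp k l f g : lip k f -> lip l g -> lip (k * l) (fun x => f (g x)).
Proof.
move=> kf lg x y; apply: le_trans (kf _ _) _; rewrite -mulrA.
by apply: ler_wpM2l => //; exact: lip_ge0 kf.
Qed.

Lemma lip_max a : lip 1 (fun x => Num.max a x).
Proof.
move=> x y; rewrite mul1r.
have h1 : x - y <= `|x - y| by exact: ler_norm.
have h2 : y - x <= `|x - y| by rewrite distrC ler_norm.
have h0 := normr_ge0 (x - y).
by case: (leP a x) => ?; case: (leP a y) => ?; rewrite ler_norml; apply/andP; split; lra.
Qed.

Lemma lip_shift k f a : lip k f -> lip k (fun x => f (x + a)).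
Proof. by move=> kf x y; have := kf (x + a) (y + a); rewrite opprD addrACA subrr addr0. Qed.

Lemma lip_max_comp k f a : lip k f -> lip k (fun x => f (Num.max a x)).
Proof. by move=> kf; rewrite -[k]mulr1; exact: lip_comp kf (lip_max a). Qed.

Lemma lip_maxl k f a : lip k f -> lip k (fun x => Num.max a (f x)).
Proof. by move=> kf; rewrite -[k]mul1r; exact: lip_comp (lip_max a) kf. Qed.

Lemma lip_bound k f x : lip k f -> `|f x| <= `|f 0| + k * `|x|.
Proof.
move=> kf; have := kf x 0; rewrite subr0 => kx.
rewrite -[f x](subrK (f 0)); apply: le_trans (ler_normD _ _) _.
by rewrite addrC lerD2l.
Qed.

(** With [lip_ndecrN], this carries comparisons of nondecreasing functions over to Lipschitz ones,
    by adding a multiple of the identity. *)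
Lemma lip_ndecrP k f : lip k f -> ndecr (fun x => f x + k * x).
Proof.
move=> kf x y xy; have := kf y x; rewrite (ger0_norm (_ : 0 <= y - x)) ?subr_ge0//.
rewrite ler_norml => /andP[+ _]; lra.
Qed.

Lemma lip_ndecrN k f : lip k f -> ndecr (fun x => k * x - f x).
Proof.
move=> kf x y xy; have := kf y x; rewrite (ger0_norm (_ : 0 <= y - x)) ?subr_ge0//.
rewrite ler_norml => /andP[_ +]; lra.
Qed.

End Lipschitz.

Section Expectation.
Context {d} {Om : measurableType d} {R : realType} (P : probability Om R).
Implicit Types (X Y : Om -> R).
Local Notation L1 X := (P.-integrable [set: Om] (EFin \o X)).
Local Notation Ex X := (Rintegral P [set: Om] X).

Lemma L1_measurable X : L1 X -> measurable_fun [set: Om] X.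
Proof. by move/measurable_int/measurable_EFinP. Qed.

Lemma L1_cst a : L1 (fun=> a).
Proof. exact: finite_measure_integrable_cst. Qed.

Lemma L1D X Y : L1 X -> L1 Y -> L1 (fun w => X w + Y w).
Proof. by move=> iX iY; exact: (integrableD measurableT iX iY). Qed.

Lemma L1Z a X : L1 X -> L1 (fun w => a * X w).
Proof. by move=> iX; exact: (integrableZl measurableT a iX). Qed.

Lemma L1N X : L1 X -> L1 (fun w => - X w).
Proof. by move=> iX; exact: (integrableN iX). Qed.

Lemma L1B X Y : L1 X -> L1 Y -> L1 (fun w => X w - Y w).
Proof. by move=> iX iY; apply: L1D => //; exact: L1N. Qed.

Lemma L1_norm X : L1 X -> L1 (fun w => `|X w|).
Proof. by move=> iX; exact: integrable_norm. Qed.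

Lemma L1_le X Y : measurable_fun [set: Om] X -> L1 Y ->
  (forall w, `|X w| <= Y w) -> L1 X.
Proof.
move=> mX iY XY; apply: (le_integrable measurableT _ _ iY).
  exact/measurable_EFinP.
by move=> w _ /=; rewrite lee_fin; apply: le_trans (XY w) (ler_norm _).
Qed.

Lemma L1_sum (I : Type) (s : seq I) (F : I -> Om -> R) :
  (forall i, L1 (F i)) -> L1 (fun w => \sum_(i <- s) F i w).
Proof.
move=> iF; elim: s => [|i s IH].
  rewrite (_ : EFin \o _ = EFin \o fun=> 0); first exact: L1_cst.
  by apply/funext => w /=; rewrite big_nil.
rewrite (_ : EFin \o _ = EFin \o (fun w => F i w + \sum_(j <- s) F j w)).
  exact: L1D.
by apply/funext => w /=; rewrite big_cons.
Qed.

Lemma Ex_EFin X : L1 X -> (\int[P]_w (X w)%:E)%E = (Ex X)%:E.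
Proof.
move=> iX; rewrite /Rintegral fineK//.
exact: (integrable_fin_num measurableT iX).
Qed.

Lemma ExD X Y : L1 X -> L1 Y -> Ex (fun w => X w + Y w) = Ex X + Ex Y.
Proof. by move=> iX iY; rewrite RintegralD. Qed.

Lemma ExB X Y : L1 X -> L1 Y -> Ex (fun w => X w - Y w) = Ex X - Ex Y.
Proof. by move=> iX iY; rewrite RintegralB. Qed.

Lemma ExZ a X : L1 X -> Ex (fun w => a * X w) = a * Ex X.
Proof. by move=> iX; rewrite RintegralZl. Qed.

Lemma Ex_cst a : Ex (fun=> a) = a.
Proof.
rewrite Rintegral_cst//; transitivity (a * fine (1%E : \bar R)); last exact: mulr1.
congr (_ * fine _).
exact: (@probability_setT _ _ _ P).
Qed.

Lemma Ex_le X Y : L1 X -> L1 Y -> (forall w, X w <= Y w) -> Ex X <= Ex Y.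
Proof. by move=> iX iY XY; apply: le_Rintegral. Qed.

Lemma Ex_ge0 X : (forall w, 0 <= X w) -> 0 <= Ex X.
Proof. by move=> X0; apply: Rintegral_ge0. Qed.

Lemma eq_Ex X Y : X =1 Y -> Ex X = Ex Y.
Proof. by move=> /funext ->. Qed.

Lemma Ex_norm X : L1 X -> `|Ex X| <= Ex (fun w => `|X w|).
Proof. exact: le_normr_Rintegral. Qed.

Lemma L1_lip k f X : lip k f -> L1 X -> L1 (fun w => f (X w)).
Proof.
move=> kf iX.
apply: (@L1_le _ (fun w => `|f 0| + k * `|X w|)).
- exact: measurableT_comp (lip_measurable kf) (L1_measurable iX).
- by apply: L1D; [exact: L1_cst|apply/L1Z/L1_norm].
- by move=> w; exact: lip_bound.
Qed.

End Expectation.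

Definition avg {d} {Om : measurableType d} {R : realType} (P : probability Om R)
  (D : Om -> R) (f : R -> R) (z : R) : R := \int[P]_w f (z - D w).

Section Averaging.
Context {d} {Om : measurableType d} {R : realType} (P : probability Om R).
Context (D : Om -> R).
Hypothesis D_ge0 : forall w, 0 <= D w.
Local Notation L1 X := (P.-integrable [set: Om] (EFin \o X)).
Local Notation Ex X := (Rintegral P [set: Om] X).
Hypothesis iD : L1 D.
Implicit Types (f g : R -> R) (k l x y z : R).
Local Notation A := (avg P D).

Lemma L1_shiftB z : L1 (fun w => z - D w).
Proof. by apply: L1B => //; exact: L1_cst. Qed.

Lemma L1_avg k f z : lip k f -> L1 (fun w => f (z - D w)).
Proof. by move=> kf; apply: L1_lip kf _; exact: L1_shiftB. Qed.

Lemma avg_lip k f : lip k f -> lip k (A f).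
Proof.
move=> kf x y; rewrite /avg -ExB; [|exact: L1_avg kf..].
apply: le_trans (Ex_norm _) _; first by apply: L1B; exact: L1_avg kf.
rewrite -[leRHS](Ex_cst P); apply: Ex_le.
- by apply/L1_norm/L1B; exact: L1_avg kf.
- exact: L1_cst.
- move=> w; apply: le_trans (kf _ _) _.
  by rewrite opprB addrA subrK.
Qed.

(** A demand only moves the argument down, so what [f] and [g] do above [a] is never seen. *)
Lemma avg_le_local k l f g a : lip k f -> lip l g ->
  (forall y, y <= a -> f y <= g y) -> forall z, z <= a -> A f z <= A g z.
Proof.
move=> kf lg fg z za; apply: Ex_le; [exact: L1_avg kf|exact: L1_avg lg|].
by move=> w; apply: fg; apply: le_trans za; rewrite gerBl.
Qed.

Lemma avg_le k l f g : lip k f -> lip l g ->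
  (forall y, f y <= g y) -> forall z, A f z <= A g z.
Proof. by move=> kf lg fg z; apply: (avg_le_local kf lg (a := z)). Qed.

Lemma avg_ndecr k f : lip k f -> ndecr f -> ndecr (A f).
Proof.
move=> kf f_ndecr x y xy; apply: Ex_le; [exact: L1_avg kf..|].
by move=> w; apply: f_ndecr; rewrite lerD2r.
Qed.

Lemma avgD k l f g z : lip k f -> lip l g ->
  A (fun y => f y + g y) z = A f z + A g z.
Proof. by move=> kf lg; rewrite /avg ExD//; [exact: L1_avg kf|exact: L1_avg lg]. Qed.

Lemma avgZ k f a z : lip k f -> A (fun y => a * f y) z = a * A f z.
Proof. by move=> kf; rewrite /avg ExZ//; exact: L1_avg kf. Qed.

Lemma avg_cst a z : A (fun=> a) z = a.
Proof. by rewrite /avg Ex_cst. Qed.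

Lemma avg_id z : A (fun y => y) z = z - Ex D.
Proof. by rewrite /avg ExB ?Ex_cst//; exact: L1_cst. Qed.

Lemma avg_bound k f a z : lip k f -> (forall y, `|f y| <= a) -> `|A f z| <= a.
Proof.
move=> kf fa; apply: le_trans (Ex_norm _) _; first exact: L1_avg kf.
rewrite -[leRHS](Ex_cst P); apply: Ex_le.
- by apply/L1_norm; exact: L1_avg kf.
- exact: L1_cst.
- by move=> w.
Qed.

Definition cvxf f := forall (t x y : R), 0 <= t <= 1 ->
  f (t * x + (1 - t) * y) <= t * f x + (1 - t) * f y.

Lemma avg_cvx k f : lip k f -> cvxf f -> cvxf (A f).
Proof.
move=> kf cf t x y t01.
rewrite /avg -(ExZ t (L1_avg x kf)) -(ExZ (1 - t) (L1_avg y kf)).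
rewrite -ExD; [|exact/L1Z/(L1_avg _ kf)..].
apply: Ex_le; first exact: L1_avg kf.
  by apply: L1D; exact/L1Z/(L1_avg _ kf).
move=> w; apply: le_trans (cf t _ _ t01).
by rewrite le_eqVlt; apply/orP; left; apply/eqP; congr f; ring.
Qed.

End Averaging.

(** * The Lindley chain *)

(* Transition operator of the chain X' = max(0, X + r - D), whose law started
   at 0 increases to that of I_oo^r. *)
Definition lindley {d} {Om : measurableType d} {R : realType}
  (P : probability Om R) (D : Om -> R) (r : R) (f : R -> R) (x : R) : R :=
  avg P D (fun y => f (Num.max 0 y)) (x + r).

Section Lindley.
Context {d} {Om : measurableType d} {R : realType} (P : probability Om R).
Context (D : Om -> R) (r : R).
Hypothesis D_ge0 : forall w, 0 <= D w.
Local Notation L1 X := (P.-integrable [set: Om] (EFin \o X)).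
Local Notation Ex X := (Rintegral P [set: Om] X).
Hypothesis iD : L1 D.
Hypothesis r_ge0 : 0 <= r.
Implicit Types (f g : R -> R) (k l x y z : R).
Local Notation T := (lindley P D r).
Local Notation Tn j := (iter j T).

Lemma lindley_lip k f : lip k f -> lip k (T f).
Proof. by move=> kf; apply/lip_shift/avg_lip/lip_max_comp. Qed.

Lemma iter_lindley_lip k f j : lip k f -> lip k (Tn j f).
Proof. by move=> kf; elim: j => //= j; exact: lindley_lip. Qed.

Lemma lindley_ndecr k f : lip k f -> ndecr f -> ndecr (T f).
Proof.
move=> kf f_ndecr x y xy; apply: (avg_ndecr iD (lip_max_comp 0 kf)).
  by move=> x' y' ?; apply: f_ndecr; rewrite le_max2//.
by rewrite lerD2r.
Qed.

Lemma iter_lindley_ndecr k f j : lip k f -> ndecr f -> ndecr (Tn j f).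
Proof.
by move=> kf nf; elim: j => //= j; apply: lindley_ndecr (iter_lindley_lip j kf).
Qed.

Lemma lindley_le_local k l f g a : lip k f -> lip l g -> 0 <= a ->
  (forall y, 0 <= y <= a + r -> f y <= g y) ->
  forall x, x <= a -> T f x <= T g x.
Proof.
move=> kf lg a0 fg x xa.
apply: (avg_le_local D_ge0 iD (lip_max_comp 0 kf) (lip_max_comp 0 lg) (a := a + r)).
  by move=> y ya; apply: fg; rewrite le_max lexx/= ge_max ya addr_ge0.
by rewrite lerD2r.
Qed.

(** In [j] steps the chain climbs by at most [j] times [r]. This is what later removes the
    truncation in [Num.min y c]. *)
Lemma iter_lindley_le_local k l f g a j : lip k f -> lip l g -> 0 <= a ->
  (forall y, 0 <= y <= a + j%:R * r -> f y <= g y) ->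
  forall x, 0 <= x <= a -> Tn j f x <= Tn j g x.
Proof.
move=> kf lg; elim: j a => [|j IH] a a0 fg x /andP[x0 xa].
  by apply: fg; rewrite mul0r addr0 x0.
apply: (lindley_le_local (iter_lindley_lip j kf) (iter_lindley_lip j lg) a0) => //.
apply: IH; first exact: addr_ge0.
by move=> y; rewrite -addrA -{1}[r]mul1r -mulrDl nat1r; exact: fg.
Qed.

Lemma lindley_le k l f g : lip k f -> lip l g ->
  (forall y, 0 <= y -> f y <= g y) -> forall x, T f x <= T g x.
Proof.
move=> kf lg fg x; apply: (avg_le D_ge0 iD (lip_max_comp 0 kf) (lip_max_comp 0 lg)).
by move=> y; apply: fg; rewrite le_max lexx.
Qed.

Lemma iter_lindley_le k l f g j : lip k f -> lip l g ->
  (forall y, 0 <= y -> f y <= g y) -> forall x, 0 <= x -> Tn j f x <= Tn j g x.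
Proof.
move=> kf lg fg; elim: j => //= j IH x x0.
exact: lindley_le (iter_lindley_lip j kf) (iter_lindley_lip j lg) IH x.
Qed.

Lemma lindleyD k l f g x : lip k f -> lip l g ->
  T (fun y => f y + g y) x = T f x + T g x.
Proof. by move=> kf lg; rewrite /lindley (avgD iD _ (lip_max_comp 0 kf) (lip_max_comp 0 lg)). Qed.

Lemma lindleyZ k f a x : lip k f -> T (fun y => a * f y) x = a * T f x.
Proof. by move=> kf; rewrite /lindley (avgZ iD _ _ (lip_max_comp 0 kf)). Qed.

Lemma iter_lindleyD k l f g j : lip k f -> lip l g ->
  Tn j (fun y => f y + g y) = fun x => Tn j f x + Tn j g x.
Proof.
move=> kf lg; elim: j => //= j ->; apply/funext => x.
exact: lindleyD (iter_lindley_lip j kf) (iter_lindley_lip j lg).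
Qed.

Lemma iter_lindleyZ k f a j : lip k f ->
  Tn j (fun y => a * f y) = fun x => a * Tn j f x.
Proof.
move=> kf; elim: j => //= j ->; apply/funext => x.
exact: lindleyZ (iter_lindley_lip j kf).
Qed.

Lemma iter_lindley_cst a j : Tn j (fun=> a) = fun=> a.
Proof. by elim: j => //= j ->; apply/funext => x; exact: avg_cst. Qed.

(* The chain started at 0 lies below its own one-step shift. *)
Lemma iter_lindley0_ndecr k f : lip k f -> ndecr f ->
  {homo (fun j => Tn j f 0) : i j / (i <= j)%N >-> i <= j}.
Proof.
move=> kf nf; apply: homo_leq => //; first exact: le_trans.
move=> j; rewrite -[leLHS](Ex_cst P) /= [leRHS]/lindley /avg.
apply: Ex_le; first exact: L1_cst.
  exact: (L1_avg iD _ (lip_max_comp 0 (iter_lindley_lip j kf))).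
move=> w; apply: (iter_lindley_ndecr j kf nf).
by rewrite le_max lexx.
Qed.

(** The reflection [max 0] is convex, and a nondecreasing convex function of a convex function is
    convex. *)
Lemma lindley_cvx k f : lip k f -> ndecr f -> cvxf f -> cvxf (T f).
Proof.
move=> kf nf cf t x y t01; rewrite /lindley.
have -> : t * x + (1 - t) * y + r = t * (x + r) + (1 - t) * (y + r) by ring.
apply: (avg_cvx iD (lip_max_comp 0 kf)) => // t' x' y' /[dup] t01' /andP[t0 t1].
apply: le_trans (cf _ _ _ t01'); apply: nf.
rewrite ge_max; apply/andP; split.
  by apply: addr_ge0; apply: mulr_ge0; rewrite ?subr_ge0// le_max lexx.
by apply: lerD; apply: ler_wpM2l; rewrite ?subr_ge0// le_max lexx orbT.
Qed.

Local Notation u j := (Tn j (fun y => y)).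

Lemma u_lip j : lip 1 (u j).
Proof. exact: iter_lindley_lip lip_id. Qed.

Lemma u_ndecr j : ndecr (u j).
Proof. exact: (iter_lindley_ndecr j lip_id). Qed.

Lemma u_cvx j : cvxf (u j).
Proof.
elim: j => [t x y _ //|j IH] /=.
exact: lindley_cvx (u_lip j) (u_ndecr j) IH.
Qed.

Lemma u_ge0 j x : 0 <= x -> 0 <= u j x.
Proof.
move=> x0; rewrite -[leLHS]/((fun=> 0) x) -(iter_lindley_cst 0 j).
by apply: (iter_lindley_le j (k := 0) (l := 1)) => //; [exact: lip_cst|exact: lip_id].
Qed.

Lemma u_le_id j x : 0 <= x -> u j x <= u j 0 + x.
Proof.
move=> x0; have := u_lip j x 0; rewrite mul1r subr0 (ger0_norm x0).
by move=> /(le_trans (ler_norm _)); lra.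
Qed.

(** Chains from [x] and from 0 driven by the same demands stay ordered, and [u j x - u j 0] is the
    mean of their gap. No coupled pair is built: monotonicity is applied to [k y + f y] and to
    [k y - f y]. *)
Lemma iter_lindley_coupling k f j x : lip k f -> 0 <= x ->
  `|Tn j f x - Tn j f 0| <= k * (u j x - u j 0).
Proof.
move=> kf x0.
have kid := lipZ k (@lip_id R).
have h1 : Tn j (fun y => f y + k * y) 0 <= Tn j (fun y => f y + k * y) x.
  by apply: (iter_lindley_ndecr j (lipD kf kid)) => //; exact: lip_ndecrP.
have h2 : Tn j (fun y => k * y + -1 * f y) 0 <= Tn j (fun y => k * y + -1 * f y) x.
  apply: (iter_lindley_ndecr j (lipD kid (lipZ (-1) kf))) => //.
  by move=> y z yz; rewrite !mulN1r; exact: (lip_ndecrN kf).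
move: h1 h2; rewrite (iter_lindleyD j kf kid) (iter_lindleyD j kid (lipZ (-1) kf)).
rewrite (iter_lindleyZ k j (@lip_id R)) (iter_lindleyZ (-1) j kf).
by rewrite ler_norml => h1 h2; apply/andP; split; lra.
Qed.

End Lindley.

Lemma exists_natr {R : realType} (x : R) : exists n : nat, x <= n%:R.
Proof.
exists (Num.Def.archi_bound `|x|); apply: le_trans (ler_norm x) _.
by apply/ltW/archi_boundP.
Qed.

(** * Negative drift below the critical rate *)

Section HuberSquare.
Context {R : realType}.
Implicit Types c x y t : R.

(* A Lipschitz substitute for the square, as the second moment of D may be infinite. *)
Definition hsq c y : R :=
  if y <= 0 then 0 else if y <= c then y ^+ 2 else 2 * c * y - c ^+ 2.

Lemma hsq_ndecr c : 0 <= c -> ndecr (hsq c).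
Proof.
move=> c0 x y xy; rewrite /hsq.
by case: (leP x 0) => x0; case: (leP y 0) => y0; case: (leP x c) => xc;
  case: (leP y c) => yc; nra.
Qed.

Lemma hsq_lip c : 0 <= c -> lip (2 * c) (hsq c).
Proof.
move=> c0; have H x y : x <= y -> hsq c y - hsq c x <= 2 * c * (y - x).
  move=> xy; rewrite /hsq.
  by case: (leP x 0) => x0; case: (leP y 0) => y0; case: (leP x c) => xc;
    case: (leP y c) => yc; nra.
move=> x y; case: (leP x y) => xy.
  rewrite distrC (distrC x) !ger0_norm ?subr_ge0//; first exact: H.
  exact: hsq_ndecr.
have yx := ltW xy; rewrite !ger0_norm ?subr_ge0//; first exact: H.
exact: hsq_ndecr.
Qed.

(** A second-order expansion: [2 * Num.min x c] is the derivative at [x], and the derivative is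
    Lipschitz with constant 2. *)
Lemma hsq_step c x t : 0 <= c -> 0 <= x ->
  hsq c (x + t) <= hsq c x + 2 * Num.min x c * t + t ^+ 2.
Proof.
move=> c0 x0; rewrite /hsq.
case: (leP x c) => xc; case: (leP x 0) => x0'; case: (leP (x + t) 0) => z0;
  case: (leP (x + t) c) => zc; nra.
Qed.

Lemma hsq_le_sqr c x : 0 <= c -> hsq c x <= x ^+ 2.
Proof.
move=> c0; rewrite /hsq; case: (leP x 0) => x0; first exact: sqr_ge0.
case: (leP x c) => xc //; have := sqr_ge0 (x - c); nra.
Qed.

Lemma hsq_ge0 c x : 0 <= c -> 0 <= hsq c x.
Proof.
move=> c0; rewrite /hsq; case: (leP x 0) => x0 //.
case: (leP x c) => xc; [exact: sqr_ge0|nra].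
Qed.

End HuberSquare.

Section Drift.
Context {d} {Om : measurableType d} {R : realType} (P : probability Om R).
Context (D : Om -> R) (r : R).
Hypothesis D_ge0 : forall w, 0 <= D w.
Local Notation L1 X := (P.-integrable [set: Om] (EFin \o X)).
Local Notation Ex X := (Rintegral P [set: Om] X).
Hypothesis iD : L1 D.
Hypothesis r_ge0 : 0 <= r.
Implicit Types (f g : R -> R) (l x y z M e c B C : R).
Local Notation T := (lindley P D r).
Local Notation Tn j := (iter j T).
Local Notation u j := (Tn j (fun y => y)).

Lemma L1_minD M : 0 <= M -> L1 (fun w => Num.min (D w) M).
Proof.
move=> M0; apply: (L1_le _ iD).
  exact: (measurable_minr (L1_measurable iD) (measurable_cst M)).
by move=> w; rewrite ger0_norm ?ge_min ?lexx// le_min D_ge0.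
Qed.

Lemma truncated_mean : r < Ex D ->
  exists M e, [/\ 0 <= M, 0 < e & r + e <= Ex (fun w => Num.min (D w) M)].
Proof.
move=> rD.
have mD : measurable_fun [set: Om] (EFin \o D) by exact: measurable_int iD.
pose F n w := (Num.min (D w) n%:R)%:E.
have cF : {ae P, forall w, [set: Om] w -> F ^~ w @ \oo --> (EFin \o D) w}.
  apply: aeW => w _; apply: cvg_near_cst; near=> n.
  rewrite /F /= min_l//; near: n; exact: nbhs_infty_ger.
have bF : {ae P, forall w n, [set: Om] w -> (`|F n w| <= (EFin \o D) w)%E}.
  apply: aeW => w n _; rewrite /F /= lee_fin ger0_norm ?ge_min ?lexx//.
  by rewrite le_min D_ge0/=.
have [_ _] := dominated_convergence measurableT
  (fun n => measurable_int _ (L1_minD (ler0n R n))) mD cF iD bF.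
rewrite [X in _ --> X](_ : _ = (Ex D)%:E); last by rewrite -Ex_EFin.
rewrite (_ : [sequence _]_n = EFin \o (fun n => Ex (fun w => Num.min (D w) n%:R))); last first.
  by apply/funext => n /=; rewrite -Ex_EFin//; exact: L1_minD.
move=> /fine_cvgP[_] /cvgr_gt /(_ _ rD) [n _ /(_ n (leqnn n))/= rn].
exists n%:R, (Ex (fun w => Num.min (D w) n%:R) - r); split => //.
  by rewrite subr_gt0.
by rewrite addrC subrK.
Unshelve. all: by end_near. Qed.

Lemma lip_min c : lip 1 (fun x => Num.min x c).
Proof.
rewrite (_ : (fun _ => _) = fun x => -1 * Num.max (- c) (-1 * x)); last first.
  by apply/funext => x; rewrite !mulN1r oppr_max !opprK minC.
have := lipZ (-1) (lip_maxl (- c) (lipZ (-1) (@lip_id R))).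
by rewrite normrN1 !mul1r.
Qed.

(** A Foster-Lyapunov drift inequality. The reflection disappears because [hsq] vanishes on negative
    numbers, and replacing [D] by the smaller [min(D, M)] can only increase [hsq]. *)
Lemma lindley_hsq M e c x : 0 <= M -> 0 < e ->
  r + e <= Ex (fun w => Num.min (D w) M) -> 0 <= c -> 0 <= x ->
  T (hsq c) x + 2 * e * Num.min x c <= hsq c x + (r + M) ^+ 2.
Proof.
move=> M0 e0 re c0 x0; set K := (r + M) ^+ 2.
have mc0 : 0 <= Num.min x c by rewrite le_min x0.
have iM := L1_minD M0.
have ir : L1 (fun w => r - Num.min (D w) M) by apply: L1B => //; exact: L1_cst.
have : T (hsq c) x <=
    Ex (fun w => (hsq c x + K) + (2 * Num.min x c) * (r - Num.min (D w) M)).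
  rewrite /lindley /avg; apply: Ex_le.
  - exact: (L1_avg iD _ (lip_max_comp 0 (hsq_lip c0))).
  - by apply: L1D; [exact: L1_cst|exact: L1Z].
  move=> w; set t := r - _.
  have -> : hsq c (Num.max 0 (x + r - D w)) = hsq c (x + r - D w).
    case: (leP 0 (x + r - D w)) => // /ltW z0.
    by rewrite /hsq lexx z0.
  have h1 : hsq c (x + r - D w) <= hsq c (x + t).
    by apply: hsq_ndecr => //; rewrite /t -addrA lerD2l lerD2l lerN2 ge_min lexx.
  have h2 := hsq_step t c0 x0.
  have h3 : t ^+ 2 <= K.
    rewrite /K /t; have : Num.min (D w) M <= M by rewrite ge_min lexx orbT.
    have : 0 <= Num.min (D w) M by rewrite le_min D_ge0.
    by move: r_ge0; nra.
  by lra.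
rewrite ExD; [|exact: L1_cst|exact: L1Z].
rewrite Ex_cst ExZ// ExB//; last exact: L1_cst.
rewrite Ex_cst; nra.
Qed.

Lemma sum_iter_lindley_min M e c x (k : nat) : 0 <= M -> 0 < e ->
  r + e <= Ex (fun w => Num.min (D w) M) -> 0 <= c -> 0 <= x ->
  \sum_(j < k) 2 * e * Tn j (fun y => Num.min y c) x + Tn k (hsq c) x
    <= hsq c x + k%:R * (r + M) ^+ 2.
Proof.
move=> M0 e0 re c0 x0; elim: k => [|k IH].
  by rewrite big_ord0 mul0r add0r addr0.
rewrite big_ord_recr /= -/(iter k.+1 T (hsq c)) iterSr.
set K := (r + M) ^+ 2 in IH *.
have lT := lindley_lip r iD (hsq_lip c0).
have lm := lipZ (2 * e) (lip_min c).
have lK := lip_cst K (lexx 0).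
have hle y : 0 <= y -> T (hsq c) y + 2 * e * Num.min y c <= hsq c y + K.
  by move=> y0; exact: lindley_hsq.
have := iter_lindley_le r D_ge0 iD k (lipD lT lm) (lipD (hsq_lip c0) lK) hle x0.
rewrite (iter_lindleyD r iD k lT lm) (iter_lindleyD r iD k (hsq_lip c0) lK).
rewrite (iter_lindleyZ r iD _ k (lip_min c)) iter_lindley_cst -[k.+1%:R]natr1.
move=> h; lra.
Qed.

Lemma sum_u_le : r < Ex D -> exists B C, [/\ 0 <= B, 0 <= C &
  forall x k, 0 <= x -> \sum_(j < k) u j x <= C * x ^+ 2 + k%:R * B].
Proof.
move=> /truncated_mean[M [e [M0 e0 re]]].
have e2 : 0 < 2 * e by rewrite mulr_gt0.
exists ((r + M) ^+ 2 / (2 * e)), ((2 * e)^-1); split.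
- by rewrite divr_ge0 ?sqr_ge0// ltW.
- by rewrite invr_ge0 ltW.
(* The chain cannot pass [c] within [k] steps, so truncating at [c] loses nothing; the final bound
   is free of [c] because [hsq c x <= x ^+ 2]. *)
move=> x k x0; pose c := x + k%:R * r.
have c0 : 0 <= c by rewrite addr_ge0// mulr_ge0.
rewrite mulrA [leRHS](_ : _ = (x ^+ 2 + k%:R * (r + M) ^+ 2) / (2 * e)); last first.
  by field; rewrite gt_eqF.
rewrite ler_pdivlMr// mulrC mulr_sumr.
have h := sum_iter_lindley_min k M0 e0 re c0 x0.
have h1 := hsq_le_sqr x c0.
have h2 : 0 <= Tn k (hsq c) x.
  rewrite -[leLHS]/((fun=> 0) x) -(iter_lindley_cst P D r 0 k).
  apply: (iter_lindley_le r D_ge0 iD k (lip_cst 0 (lexx 0)) (hsq_lip c0)) => // y _.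
  exact: hsq_ge0.
have h3 : \sum_(j < k) 2 * e * u j x <=
          \sum_(j < k) 2 * e * Tn j (fun y => Num.min y c) x.
  apply: ler_sum => j _; rewrite ler_pM2l//.
  apply: (iter_lindley_le_local D_ge0 iD r_ge0 lip_id (lip_min c) x0); last first.
    by rewrite x0 lexx.
  move=> y /andP[y0 yx]; rewrite le_min lexx/=; apply: le_trans yx _.
  by rewrite lerD2l ler_wpM2r// ler_nat ltnW.
lra.
Qed.

(** From 0 the sequence [u j 0] is nondecreasing, so a single value above [B] would push its
    averages above [B]. *)
Lemma u0_le B C : (forall x k, 0 <= x -> \sum_(j < k) u j x <= C * x ^+ 2 + k%:R * B) ->
  forall j, u j 0 <= B.
Proof.
move=> uB j; rewrite leNgt; apply/negP => Bu.
have uB0 : 0 < u j 0 - B by rewrite subr_gt0.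
have [n jn] := exists_natr (j%:R * B / (u j 0 - B) + 1).
have := uB 0 (j + n)%N (lexx 0); rewrite expr0n/= mulr0 add0r big_split_ord/=.
have h1 : 0 <= \sum_(i < j) u i 0 by apply: sumr_ge0 => i _; exact: u_ge0.
have h2 : n%:R * u j 0 <= \sum_(i < n) u (j + i) 0.
  rewrite mulr_natl -[X in _ *+ X]card_ord -sumr_const; apply: ler_sum => i _.
  exact: (iter_lindley0_ndecr r iD lip_id _ (leq_addr _ _)).
have : j%:R * B < n%:R * (u j 0 - B).
  by rewrite -ltr_pdivrMr//; apply: lt_le_trans jn; rewrite ltrDl.
rewrite natrD; lra.
Qed.

(* Convexity of u j gives u j x - u j 0 <= (x / y) * u j y, and the average over
   j of the latter is O(1 / y). *)
Lemma u_merge x e : r < Ex D -> 0 <= x -> 0 < e ->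
  exists k0 : nat, forall k, (k0 <= k)%N ->
    \sum_(j < k) (u j x - u j 0) <= e * k%:R.
Proof.
move=> rD x0 e0; have [B [C [B0 C0 uB]]] := sum_u_le rD.
(* This [y] makes the linear part [x * B / y] of the average at most [e / 2]; [k0] then makes the
   constant part [x * C * y] at most half of [e * k]. *)
pose y := x + 1 + 2 * x * B / e.
have y1 : x + 1 <= y by rewrite lerDl divr_ge0 ?mulr_ge0// ltW.
have y0 : 0 < y by apply: lt_le_trans y1; rewrite ltr_wpDl.
have [k0 hk0] := exists_natr (2 * x * C * y / e).
exists k0 => k k0k.
have ux j : u j x - u j 0 <= x / y * u j y.
  have t01 : 0 <= x / y <= 1.
    rewrite divr_ge0 ?(ltW y0)//= ler_pdivrMr// mul1r.
    by apply: le_trans y1; rewrite lerDl.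
  have := u_cvx r iD j y 0 t01; rewrite mulr0 addr0 divfK ?gt_eqF//.
  have := u_ge0 r D_ge0 iD j (lexx 0).
  case/andP: t01 => t0 _ u0; have := mulr_ge0 t0 u0; lra.
apply: (@le_trans _ _ (x / y * \sum_(j < k) u j y)).
  by rewrite mulr_sumr; apply: ler_sum.
have := uB y k (ltW y0) => uy.
apply: (@le_trans _ _ (x / y * (C * y ^+ 2 + k%:R * B))).
  by apply: ler_wpM2l uy; rewrite divr_ge0// ltW.
rewrite mulrAC ler_pdivrMr//.
have h1 : 2 * x * B <= e * y.
  by rewrite [leRHS]mulrC -ler_pdivrMr// /y; move: x0; lra.
have h2 : 2 * x * C * y <= e * k%:R.
  rewrite [leRHS]mulrC -ler_pdivrMr//; apply: le_trans hk0 _.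
  by rewrite ler_nat.
have k1 : 0 <= k%:R :> R by [].
have h3 : k%:R * (2 * x * B) <= k%:R * (e * y) by apply: ler_wpM2l.
have h4 : y * (2 * x * C * y) <= y * (e * k%:R) by apply: ler_wpM2l => //; exact: ltW.
rewrite expr2; lra.
Qed.

(** The limit plays the role of the expectation of [f] at [I_oo^r]. Both [f y + k y] and [y] are
    nondecreasing with linear growth, so their sequences are monotone and bounded; [f] is a
    combination of the two. *)
Lemma iter_lindley0_cvg k f : r < Ex D -> lip k f ->
  cvgn (fun j => Tn j f 0).
Proof.
move=> rD kf; have [B [C [B0 C0 uB]]] := sum_u_le rD.
have u0B := u0_le uB.
have bnd l g : lip l g -> ndecr g -> cvgn (fun j => Tn j g 0).
  move=> lg ng; apply: nondecreasing_is_cvgn.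
    by move=> i j; exact: (iter_lindley0_ndecr r iD lg ng).
  exists (g 0 + l * B) => _ [j _ <-].
  have l0 := lip_ge0 lg.
  apply: (@le_trans _ _ (Tn j (fun y => g 0 + l * y) 0)).
    apply: (iter_lindley_le r D_ge0 iD j lg (lipD (lip_cst (g 0) (lexx 0)) (lipZ l lip_id))) => // y y0.
    have := lg y 0; rewrite subr0 (ger0_norm y0) => /(le_trans (ler_norm _)); lra.
  rewrite (iter_lindleyD r iD j (lip_cst (g 0) (lexx 0)) (lipZ l lip_id)).
  rewrite iter_lindley_cst (iter_lindleyZ r iD _ j lip_id) lerD2l.
  by apply: ler_wpM2l.
have kid := lipZ k (@lip_id R).
have c1 := bnd _ _ (lipD kf kid) (lip_ndecrP kf).
have c2 := bnd _ _ (@lip_id R) (fun x y xy => xy).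
rewrite (_ : (fun j => _) = (fun j => Tn j (fun y => f y + k * y) 0) \-
    (fun j => k * u j 0)).
  by apply: is_cvgB => //; apply: is_cvgM c2; exact: is_cvg_cst.
apply/funext => j /=; rewrite (iter_lindleyD r iD j kf kid).
by rewrite (iter_lindleyZ r iD _ j lip_id) addrK.
Qed.

End Drift.

Lemma cesaro_sum {R : realType} (v : nat -> R) (l : R) : v @ \oo --> l ->
  forall e, 0 < e -> exists n0 : nat, forall n, (n0 <= n)%N ->
    `|\sum_(j < n) v j - n%:R * l| <= e * n%:R.
Proof.
move=> vl e e0; have /cvgrPdist_le /(_ _ e0)[n0 _ H] := cesaro vl.
exists n0.+1 => -[//|n]; rewrite ltnS => /H /=.
rewrite /arithmetic_mean/= /series/= big_mkord => h.
rewrite distrC.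
rewrite (_ : _ - _ = n.+1%:R * (l - n.+1%:R^-1 * \sum_(j < n.+1) v j)); last first.
  by rewrite mulrBr mulrA divff ?mul1r// pnatr_eq0.
by rewrite normrM (ger0_norm (ler0n _ _)) mulrC ler_wpM2r.
Qed.

(** * Long-run averages, and divergence at the critical rate *)

Section Critical.
Context {d} {Om : measurableType d} {R : realType} (P : probability Om R).
Context (D : Om -> R) (r : R).
Hypothesis D_ge0 : forall w, 0 <= D w.
Local Notation L1 X := (P.-integrable [set: Om] (EFin \o X)).
Local Notation Ex X := (Rintegral P [set: Om] X).
Hypothesis iD : L1 D.
Hypothesis r_ge0 : 0 <= r.
Implicit Types (f g : R -> R) (x y z : R).
Local Notation T := (lindley P D r).
Local Notation Tn j := (iter j T).
Local Notation u j := (Tn j (fun y => y)).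

(** Meant for expectations [a] along a chain with another, possibly random start: by [u_merge] the
    coupling error is negligible on average. *)
Lemma cesaro_lindley k f (a : nat -> R) x : r < Ex D -> lip k f -> 0 <= x ->
  (forall j, `|a j - Tn j f 0| <= k * (u j x - u j 0)) ->
  forall e, 0 < e -> exists n0 : nat, forall n, (n0 <= n)%N ->
    `|\sum_(j < n) a j - n%:R * limn (fun j => Tn j f 0)| <= e * n%:R.
Proof.
move=> rD kf x0 ax e e0; have k0 := lip_ge0 kf.
have e2 : 0 < e / 2 by rewrite divr_gt0.
have e3 : 0 < e / 2 / (k + 1) by rewrite divr_gt0// ltr_wpDl.
have [n1 h1] := cesaro_sum (iter_lindley0_cvg D_ge0 iD r_ge0 rD kf) e2.
have [n2 h2] := u_merge D_ge0 iD r_ge0 rD x0 e3.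
exists (maxn n1 n2) => n; rewrite geq_max => /andP[/h1 {}h1 /h2 {}h2].
have h3 : `|\sum_(j < n) a j - \sum_(j < n) Tn j f 0| <=
    k * \sum_(j < n) (u j x - u j 0).
  rewrite -sumrB mulr_sumr; apply: le_trans (ler_norm_sum _ _ _) _.
  by apply: ler_sum.
have h4 : k * \sum_(j < n) (u j x - u j 0) <= e / 2 * n%:R.
  apply: le_trans (ler_wpM2l k0 h2) _.
  set q := e / 2 / (k + 1) in e3 *.
  have -> : e / 2 = q * (k + 1) by rewrite divfK// gt_eqF// ltr_wpDl.
  have : 0 <= q * n%:R by rewrite mulr_ge0// ltW.
  lra.
apply: le_trans (ler_distD (\sum_(j < n) Tn j f 0) _ _) _.
by apply: le_trans (lerD (le_trans h3 h4) h1) _; lra.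
Qed.

Local Notation free f := (fun y => avg P D f (y + r)).
(* The expected negative part of the free walk y, y + r - D, ... at step j. *)
Local Notation deficit j := (iter j (fun f => free f) (fun y => Num.max 0 (- y))).

Lemma deficit_lip j : lip 1 (deficit j).
Proof.
elim: j => [|j IH] /=; last exact/lip_shift/avg_lip.
rewrite (_ : (fun y => _) = fun y => Num.max 0 (-1 * y)); last first.
  by apply/funext => y; rewrite mulN1r.
by have := lip_maxl 0 (lipZ (-1) (@lip_id R)); rewrite normrN1 mul1r.
Qed.

Lemma deficit_nincr j x y : x <= y -> deficit j y <= deficit j x.
Proof.
elim: j x y => [|j IH] x y xy /=; first by rewrite le_max2// lerN2.
apply: Ex_le; [exact: (L1_avg iD _ (deficit_lip j))..|].
by move=> w; apply: IH; rewrite lerD2r lerD2r.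
Qed.

Lemma deficit_ge0 j y : 0 <= deficit j y.
Proof.
elim: j y => [|j IH] y /=; first by rewrite le_max lexx.
by apply: Ex_ge0.
Qed.

(** As [Ex D <= r], the free walk is a submartingale: its mean is at least [y], hence its positive
    part has mean at least [y + deficit j y]. The reflected chain dominates that positive part. *)
Lemma deficit_le_u j y : Ex D <= r -> y + deficit j y <= u j (Num.max 0 y).
Proof.
move=> Dr; elim: j y => [|j IH] y /=; first by case: (leP 0 y) => ?; case: (leP 0 (- y)) => ?; lra.
apply: (@le_trans _ _ (lindley P D r (u j) y)); last first.
  by apply: (lindley_ndecr r iD (u_lip r iD j) (u_ndecr r iD j)); rewrite le_max lexx orbT.
apply: (@le_trans _ _ (avg P D (fun z => z + deficit j z) (y + r))).
  rewrite (avgD iD _ lip_id (deficit_lip j)) avg_id//; lra.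
apply: (avg_le D_ge0 iD (lipD lip_id (deficit_lip j)) (lip_max_comp 0 (u_lip r iD j))).
exact: IH.
Qed.

(** With probability [P(E)] to the power [j] all [j] demands exceed [r] by [eta], and then the walk
    has dropped by [j * eta]. *)
Lemma deficit_ge E eta j y : measurable E -> (forall w, E w -> r + eta <= D w) ->
  fine (P E) ^+ j * (j%:R * eta - y) <= deficit j y.
Proof.
move=> mE HE; elim: j y => [|j IH] y /=.
  by rewrite expr0 mul1r mul0r sub0r le_max lexx orbT.
have iE : L1 (\1_E : Om -> R) by exact: integrable_indic.
have -> : fine (P E) ^+ j.+1 * (j.+1%:R * eta - y) =
  Ex (fun w => fine (P E) ^+ j * (j%:R * eta - (y - eta)) * \1_E w).
  rewrite ExZ// /Rintegral integral_indic// setIT -natr1 exprS; ring.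
apply: Ex_le; [exact: L1Z|exact: (L1_avg iD _ (deficit_lip j))|].
move=> w; rewrite indicE; case: (boolP (w \in E)) => [/set_mem wE|_]; last first.
  by rewrite mulr0 deficit_ge0.
rewrite mulr1; apply: le_trans (IH _) _; apply: deficit_nincr.
have := HE w wE; lra.
Qed.

(** Suppose [u j 0] stays below [B]. Reflection during [k] further steps adds at least
    [p * (k * eta - u j 0)], where [p] is the probability of [k] large demands in a row. With
    [k * eta >= B + 1] this is at least [p], so [u] grows linearly, a contradiction. *)
Lemma u_unbounded E eta : Ex D <= r -> measurable E -> 0 < fine (P E) -> 0 < eta ->
  (forall w, E w -> r + eta <= D w) ->
  forall B, exists j0 : nat, forall j, (j0 <= j)%N -> B <= u j 0.
Proof.
move=> Dr mE PE eta0 HE B.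
have u_homo := iter_lindley0_ndecr r iD lip_id (fun x y xy => xy).
suff [j Bj] : exists j, B <= u j 0.
  by exists j => i ji; apply: le_trans Bj _; exact: u_homo.
apply: contrapT => /forallNP nB.
have uB j : u j 0 < B by rewrite ltNge; apply/negP; exact: nB.
have [k hk] := exists_natr ((B + 1) / eta).
set p := fine (P E) ^+ k; have p0 : 0 < p by exact: exprn_gt0.
have kB : B + 1 <= k%:R * eta by rewrite -ler_pdivrMr.
have step j : u j 0 + p <= u (j + k) 0.
  rewrite iterD.
  have l1 := lip_id (R := R); have l2 := lip_cst (p * (k%:R * eta)) (lexx 0).
  have lp := lipZ (1 - p) l1.
  (* The lower bound for the last [k] steps is affine in [y], so only the mean [u j 0] of the first
     [j] steps enters. *)
  apply: (@le_trans _ _ (Tn j (fun y => (1 - p) * y + p * (k%:R * eta)) 0)).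
    rewrite (iter_lindleyD r iD j lp l2) (iter_lindleyZ r iD _ j l1) iter_lindley_cst.
    have := uB j; nra.
  apply: (iter_lindley_le r D_ge0 iD j (lipD lp l2) (u_lip r iD k)) => // y y0.
  apply: le_trans (_ : y + deficit k y <= _).
    have := deficit_ge k y mE HE; rewrite -/p; lra.
  by have := deficit_le_u k y Dr; rewrite (max_r y0).
have lin i : i%:R * p <= u (i * k) 0.
  elim: i => [|i IH]; first by rewrite mul0r mul0n.
  rewrite mulSn addnC -natr1 mulrDl mul1r; apply: le_trans (step _).
  by rewrite lerD2r.
have [i hi] := exists_natr (B / p).
have := le_lt_trans (lin i) (uB _); rewrite ltNge => /negP; apply.
by rewrite -ler_pdivrMr.
Qed.

End Critical.

(** * Multipliers of the finite-horizon problem *)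

Section Cost.
Context {R : realType}.
Implicit Types h b y z w delta : R.

Lemma holding_backorder_lip h b : 0 <= h -> 0 <= b ->
  lip (h + b) (holding_backorder h b).
Proof.
move=> h0 b0.
have lN : lip 1 (fun y : R => - y) by move=> x y; rewrite -opprD normrN mul1r.
have l1 := lipZ h (lip_max (0 : R)).
have l2 := lipZ b (lip_comp (lip_max (0 : R)) lN).
rewrite (_ : holding_backorder h b = fun y => h * Num.max 0 y + b * Num.max 0 (- y)).
  by have := lipD l1 l2; rewrite !mulr1 !ger0_norm.
by apply/funext => y; rewrite /holding_backorder maxC (maxC (- y)).
Qed.

Lemma holding_backorder_ge h b y : 0 <= h -> 0 <= b ->
  h * y <= holding_backorder h b y /\ - (b * y) <= holding_backorder h b y.
Proof.
move=> h0 b0; rewrite /holding_backorder.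
by case: (leP y 0) => y0; case: (leP (- y) 0) => y0'; split; nra.
Qed.

(* A continuous approximate derivative of the kinked cost. *)
Definition clamp h b delta w : R := Num.max (- b) (Num.min h (delta^-1 * w)).

Lemma clamp_lip h b delta : 0 < delta -> lip delta^-1 (clamp h b delta).
Proof.
move=> d0; have := lip_maxl (- b) (lip_comp (lip_min h) (lipZ delta^-1 (@lip_id R))).
rewrite mulr1 mul1r ger0_norm ?invr_ge0 ?ltW//.
by rewrite (_ : (fun x => _) = clamp h b delta)//; apply/funext => w; rewrite /clamp minC.
Qed.

Lemma clamp_ndecr h b delta : 0 < delta -> ndecr (clamp h b delta).
Proof.
move=> d0 x y xy; rewrite /clamp le_max2// le_min2//.
by rewrite ler_pM2l// invr_gt0.
Qed.

Lemma clamp_bound h b delta w : 0 <= h -> 0 <= b ->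
  - b <= clamp h b delta w <= h.
Proof.
move=> h0 b0; rewrite /clamp le_max lexx/= ge_max.
by rewrite (_ : - b <= h) ?ge_min ?lexx//; lra.
Qed.

(** Any slope in [[-b, h]] supports the cost at 0. Relative to the true subgradient at [w], an error
    occurs only where [delta^-1 * w] lies strictly between [-b] and [h], and it is of order [delta]
    there. *)
Lemma clamp_subgrad h b delta z w : 0 <= h -> 0 <= b -> 0 < delta ->
  holding_backorder h b w + clamp h b delta w * (z - w) - (h + b) ^+ 2 * delta
    <= holding_backorder h b z.
Proof.
move=> h0 b0 d0.
have /andP[c1 c2] := clamp_bound delta w h0 b0.
have h1 : clamp h b delta w * z <= holding_backorder h b z.
  rewrite /holding_backorder.
  by case: (leP z 0) => z0; case: (leP (- z) 0) => z0'; nra.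
suff : holding_backorder h b w - (h + b) ^+ 2 * delta <= clamp h b delta w * w by lra.
rewrite /holding_backorder /clamp.
have [v -> ] : exists v, w = delta * v by exists (delta^-1 * w); rewrite mulVKf// gt_eqF.
rewrite mulKf ?gt_eqF//.
have e0 : 0 <= (h + b) ^+ 2 * delta by rewrite mulr_ge0 ?sqr_ge0// ltW.
case: (leP v 0) => v0.
  have w0 : delta * v <= 0 by rewrite pmulr_rle0.
  rewrite (min_r (le_trans v0 h0)) (max_r w0) (max_l (_ : 0 <= - (delta * v))); last by rewrite oppr_ge0.
  case: (leP (- b) v) => bv; last by lra.
  have : 0 <= (- v) * delta * (b + v) by rewrite !mulr_ge0 ?oppr_ge0//; lra.
  have : 0 <= delta * (h ^+ 2 + 2 * h * b + b * (b + v)).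
    by rewrite mulr_ge0 ?addr_ge0 ?mulr_ge0 ?sqr_ge0//; lra.
  have : 0 <= delta * v ^+ 2 by rewrite mulr_ge0 ?sqr_ge0// ltW.
  lra.
have w0 : 0 < delta * v by rewrite mulr_gt0.
have w1 : - (delta * v) <= 0 by rewrite oppr_le0 ltW.
rewrite (max_l (ltW w0)) (max_r w1).
rewrite max_r; last by rewrite le_min; apply/andP; split; lra.
case: (leP h v) => hv; first by lra.
have : 0 <= delta * (b ^+ 2 + 2 * h * b + h * (h - v)).
  by rewrite mulr_ge0 ?addr_ge0 ?mulr_ge0 ?sqr_ge0//; lra.
have : 0 <= delta * v ^+ 2 by rewrite mulr_ge0 ?sqr_ge0// ltW.
lra.
Qed.

End Cost.

Section AveragedCost.
Context {d} {Om : measurableType d} {R : realType} (P : probability Om R).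
Context (D : Om -> R).
Hypothesis D_ge0 : forall w, 0 <= D w.
Local Notation L1 X := (P.-integrable [set: Om] (EFin \o X)).
Local Notation Ex X := (Rintegral P [set: Om] X).
Hypothesis iD : L1 D.
Implicit Types (f g : R -> R) (x y z w : R).
Local Notation A := (avg P D).

(** A selection of eps-subgradients; the slack pays for the smoothing of the kink by [clamp]. *)
Definition subgrad (eps : R) f g := forall z w, f w + g w * (z - w) - eps <= f z.

Lemma avg_subgrad k l eps f g : lip k f -> lip l g ->
  subgrad eps f g -> subgrad eps (A f) (A g).
Proof.
move=> kf lg fg z w.
have i1 := L1_avg iD w kf; have i2 := L1_avg iD w lg.
rewrite -(Ex_cst P eps) mulrC /avg -ExZ// -ExD//; last exact: L1Z.
rewrite -ExB; [|by apply: L1D => //; exact: L1Z|exact: L1_cst].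
apply: Ex_le; [|exact: (L1_avg iD _ kf)|].
  by apply: L1B; [apply: L1D => //; exact: L1Z|exact: L1_cst].
move=> o; have := fg (z - D o) (w - D o).
by rewrite opprB addrA subrK mulrC.
Qed.

Lemma iter_avg_lip k f n : lip k f -> lip k (iter n A f).
Proof. by move=> kf; elim: n => //= n; exact: avg_lip. Qed.

Lemma iter_avg_subgrad k l eps f g n : lip k f -> lip l g ->
  subgrad eps f g -> subgrad eps (iter n A f) (iter n A g).
Proof.
move=> kf lg fg; elim: n => //= n.
exact: (avg_subgrad (iter_avg_lip n kf) (iter_avg_lip n lg)).
Qed.

Lemma iter_avg_ndecr k f n : lip k f -> ndecr f -> ndecr (iter n A f).
Proof.
by move=> kf nf; elim: n => //= n; apply: avg_ndecr iD _ _ (iter_avg_lip n kf).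
Qed.

Lemma iter_avg_bound k f a n : lip k f -> (forall y, `|f y| <= a) ->
  forall y, `|iter n A f y| <= a.
Proof.
move=> kf fa; elim: n => //= n IH y.
exact: (avg_bound iD _ (iter_avg_lip n kf)).
Qed.

Lemma iter_avg_ge_affine k f a a0 n : lip k f -> (forall y, a * y + a0 <= f y) ->
  forall y, a * y + a0 - n%:R * (a * Ex D) <= iter n A f y.
Proof.
move=> kf fa; elim: n => [|n IH] y /=; first by rewrite mul0r subr0.
have la := lipD (lipZ a lip_id) (lip_cst (a0 - n%:R * (a * Ex D)) (lexx 0)).
apply: (@le_trans _ _ (A (fun z => a * z + (a0 - n%:R * (a * Ex D))) y)).
  rewrite (avgD iD y (lipZ a lip_id) (lip_cst _ (lexx 0))).
  by rewrite (avgZ iD a y lip_id) avg_id// avg_cst -natr1; lra.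
by apply: (avg_le D_ge0 iD la (iter_avg_lip n kf)) => z; rewrite addrA.
Qed.

Lemma iter_avg_ge0 k f n : lip k f -> (forall y, 0 <= f y) -> forall y, 0 <= iter n A f y.
Proof.
move=> kf f0 y; have := iter_avg_ge_affine (a := 0) (a0 := 0) n kf.
by move=> /(_ _ y); rewrite !mul0r mulr0 subr0 addr0; apply => z; rewrite mul0r addr0.
Qed.

End AveragedCost.

Section Adjoint.
Context {d} {Om : measurableType d} {R : realType} (P : probability Om R).
Context (D : Om -> R) (r : R).
Hypothesis D_ge0 : forall w, 0 <= D w.
Local Notation L1 X := (P.-integrable [set: Om] (EFin \o X)).
Hypothesis iD : L1 D.
Hypothesis r_ge0 : 0 <= r.
Implicit Types (x y z w : R).
Local Notation A := (avg P D).
Variables (gam : R -> R) (kgam bgam : R).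
Hypothesis gam_lip : lip kgam gam.
Hypothesis gam_ndecr : ndecr gam.
Hypothesis gam_bound : forall y, `|gam y| <= bgam.
Hypothesis gam_pos : exists z, 0 < gam z.
Hypothesis gam_neg : exists z, gam z < 0.

(* The multiplier of the order constraint with k periods to go: the marginal
   cost of raising the position, given that the base-stock policy lets the
   effect of the increase vanish at the next express order. *)
Fixpoint adjoint (k : nat) : R -> R :=
  if k is k'.+1 then
    fun z => gam z + A (fun y => Num.max 0 (adjoint k' y)) (z + r)
  else fun=> 0.

Lemma adjointS k z :
  adjoint k.+1 z = gam z + A (fun y => Num.max 0 (adjoint k y)) (z + r).
Proof. by []. Qed.

Lemma adjoint_lip k : lip (k%:R * kgam) (adjoint k).
Proof.
elim: k => [|k IH] /=; first by apply: lip_cst; rewrite mul0r.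
rewrite -nat1r mulrDl mul1r; apply: lipD => //.
exact/lip_shift/avg_lip/lip_maxl.
Qed.

Lemma adjoint_pos_lip k : lip (k%:R * kgam) (fun y => Num.max 0 (adjoint k y)).
Proof. exact/lip_maxl/adjoint_lip. Qed.

Lemma adjoint_ndecr k : ndecr (adjoint k).
Proof.
elim: k => [//|k IH] x y xy /=; apply: lerD; first exact: gam_ndecr.
apply: (avg_ndecr iD (adjoint_pos_lip k)); last by rewrite lerD2r.
by move=> x' y' /IH h; rewrite le_max2.
Qed.

Lemma adjoint_bound k y : `|adjoint k y| <= k%:R * bgam.
Proof.
elim: k y => [|k IH] y /=; first by rewrite normr0 mul0r.
rewrite -nat1r mulrDl mul1r; apply: le_trans (ler_normD _ _) _.
apply: lerD => //; apply: (avg_bound iD _ (adjoint_pos_lip k)) => z.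
by apply: le_trans (IH z); case: (leP 0 (adjoint k z)) => //; rewrite normr0.
Qed.

(** The comparison starts at horizon 1: [gam] takes negative values, so [adjoint 1] does not
    dominate [adjoint 0], but the positive parts inside the recursion are ordered from the start. It
    makes base-stock levels nonincreasing in the horizon. *)
Lemma adjoint_step k y : adjoint k.+1 y <= adjoint k.+2 y.
Proof.
elim: k y => [|k IH] y; rewrite adjointS [leRHS]adjointS lerD2l.
  apply: (avg_le D_ge0 iD (adjoint_pos_lip 0) (adjoint_pos_lip 1)) => z.
  by rewrite [leLHS]maxxx le_max lexx.
apply: (avg_le D_ge0 iD (adjoint_pos_lip k.+1) (adjoint_pos_lip k.+2)) => z.
by rewrite le_max2.
Qed.

(** Far to the left, [z + r - D] stays where the multiplier with one period less is nonpositive; the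
    positive part vanishes and only [gam z < 0] remains. *)
Lemma adjoint_neg k : exists z, adjoint k.+1 z < 0.
Proof.
have [z0 gz0] := gam_neg.
suff [z1 H] : exists z, forall y, y <= z -> adjoint k y <= 0.
  exists (Num.min z0 (z1 - r)) => /=.
  rewrite (_ : A _ _ = 0) ?addr0.
    by apply: le_lt_trans gz0; apply: gam_ndecr; rewrite ge_min lexx.
  rewrite -[RHS](avg_cst P D 0 0); apply: eq_Ex => w.
  rewrite max_l//; apply: H; rewrite lerBlDr.
  apply: le_trans (_ : z1 <= _); last by rewrite lerDl.
  by rewrite -lerBrDr ge_min lexx orbT.
elim: k => [|k [z1 H]]; first by exists 0.
exists (Num.min z0 (z1 - r)) => y; rewrite le_min => /andP[yz0 yz1] /=.
rewrite (_ : A _ _ = 0) ?addr0.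
  by apply: le_trans (ltW gz0); exact: gam_ndecr.
rewrite -[RHS](avg_cst P D 0 0); apply: eq_Ex => w.
rewrite max_l//; apply: H; rewrite lerBlDr.
apply: le_trans (_ : z1 <= _); last by rewrite lerDl.
by rewrite -lerBrDr.
Qed.

Lemma adjoint_zero k z : 0 <= adjoint k.+1 z -> exists2 s, s <= z & adjoint k.+1 s = 0.
Proof.
move=> z0; have [a a0] := adjoint_neg k.
have az : a <= z.
  rewrite leNgt; apply/negP => /ltW/(adjoint_ndecr k.+1).
  by rewrite leNgt (lt_le_trans a0 z0).
have cont : {within `[a, z], continuous (adjoint k.+1)}.
  exact/continuous_subspaceT/(lip_continuous (adjoint_lip k.+1)).
have [|s] := IVT az cont (v := 0).
  by rewrite ge_min (ltW a0)/= le_max z0 orbT.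
by rewrite in_itv/= => /andP[_ sz] s0; exists s.
Qed.

(** Zeros need not be unique, so they are chosen one after the other: the next multiplier is at
    least 0 at the current level by [adjoint_step], and has a zero at or to the left of it. *)
Lemma base_stock_levels : exists S : nat -> R,
  forall k, adjoint k.+1 (S k) = 0 /\ S k.+1 <= S k.
Proof.
have [z gz] := gam_pos.
have Z0 : exists s, adjoint 1 s == 0.
  have [|s _ s0] := @adjoint_zero 0 z; last by exists s; rewrite s0.
  rewrite /= (_ : A _ _ = 0) ?addr0 ?ltW//.
  by rewrite -[RHS](avg_cst P D 0 0); apply: eq_Ex => w; rewrite maxxx.
(* The condition on [s] sits under the quantifier, so that a successor can be chosen for every [s]
   and the recursion needs no proof argument. *)
have next k s : exists s', adjoint k.+1 s == 0 -> adjoint k.+2 s' == 0 /\ s' <= s.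
  case: (eqVneq (adjoint k.+1 s) 0) => s0; last by exists 0.
  have [|s' s's s'0] := @adjoint_zero k.+1 s.
    by rewrite -s0; exact: adjoint_step.
  by exists s'; rewrite s'0.
pose F k s := projT1 (cid (next k s)).
pose S := fix S k := if k is k'.+1 then F k' (S k') else projT1 (cid Z0).
have S0 k : adjoint k.+1 (S k) == 0.
  elim: k => [|k IH]; first exact: (projT2 (cid Z0)).
  by have [] := projT2 (cid (next k (S k))) IH.
exists S => k; split; first exact/eqP.
by have [] := projT2 (cid (next k (S k))) (S0 k).
Qed.

End Adjoint.

(** * Independence of the demands from the past *)

Section IndependentPair.
Context {d} {Om : measurableType d} {R : realType} (P : probability Om R).
Context {d1 d2} {T1 : measurableType d1} {T2 : measurableType d2}.
Context (X : Om -> T1) (Y Y' : {mfun Om >-> T2}).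
Hypothesis mX : measurable_fun [set: Om] X.
Hypothesis indepXY : forall A B, measurable A -> measurable B ->
  P (X @^-1` A `&` Y @^-1` B) = (P (X @^-1` A) * P (Y @^-1` B))%E.
Hypothesis YY' : distribution P Y = distribution P Y'.
Local Notation L1 X := (P.-integrable [set: Om] (EFin \o X)).

Let X' : {mfun Om >-> T1} := HB.pack X (isMeasurableFun.Build _ _ _ _ X mX).
Let XY w := (X w, Y w).

Let mXY : measurable_fun [set: Om] XY.
Proof. exact: measurable_fun_pair. Qed.

Let XY' : {mfun Om >-> (T1 * T2)%type} :=
  HB.pack XY (isMeasurableFun.Build _ _ _ _ XY mXY).

Let law_pair (C : set (T1 * T2)) : measurable C ->
  (distribution P X' \x distribution P Y')%E C = distribution P XY' C.
Proof.
move=> mC; apply: product_measure_unique => // A B mA mB.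
transitivity (P (X @^-1` A) * P (Y @^-1` B))%E; first exact: indepXY.
by congr (_ * _)%E; exact: (congr1 (fun m : set T2 -> \bar R => m B) YY').
Qed.

(** [Y'] is any variable with the law of [Y]; this allows the inner integral to be taken over the
    one variable [D] whatever the period. *)
Lemma ge0_integral_indep_pair (F : T1 * T2 -> \bar R) :
  measurable_fun [set: T1 * T2] F -> (forall z, 0 <= F z)%E ->
  (\int[P]_w F (X w, Y w) = \int[P]_w \int[P]_w' F (X w, Y' w'))%E.
Proof.
move=> mF F0.
have -> : (\int[P]_w F (X w, Y w) = \int[distribution P XY']_z F z)%E.
  by rewrite (ge0_integral_pushforward mXY).
rewrite -(@eq_measure_integral _ _ _ _ _ (distribution P X' \x distribution P Y')%E) => //; last first.
  by move=> A mA _; (exact: law_pair || exact: (esym (law_pair mA))).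
rewrite fubini_tonelli1// (ge0_integral_pushforward mX)//; first last.
- by move=> x _; apply: integral_ge0.
- exact: measurable_fun_fubini_tonelli_F.
apply: eq_integral => w _ /=; rewrite /fubini_F ge0_integral_pushforward//.
by apply: measurableT_comp mF _; exact: measurable_fun_pair.
Qed.

Lemma Ex_indep_pair (F : T1 * T2 -> R) : measurable_fun [set: T1 * T2] F ->
  L1 (fun w => F (X w, Y w)) -> (forall x, L1 (fun w => F (x, Y' w))) ->
  \int[P]_w F (X w, Y w) = \int[P]_w \int[P]_w' F (X w, Y' w').
Proof.
move=> mF iF iFx; pose f z := (F z)%:E.
have mf : measurable_fun [set: T1 * T2] f by exact/measurable_EFinP.
have iP : (distribution P XY').-integrable setT f.
  exact: (integrable_pushforward mXY mf).
have iprod : (distribution P X' \x distribution P Y')%E.-integrable setT f.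
  apply/integrableP; split => //.
  have /integrableP[_] := iP; apply: le_lt_trans; rewrite le_eqVlt; apply/orP; left.
  by apply/eqP; apply: eq_measure_integral => A mA _; exact: law_pair.
rewrite /Rintegral; congr fine.
have -> : (\int[P]_w (F (X w, Y w))%:E = \int[distribution P XY']_z f z)%E.
  by rewrite (integral_pushforward mXY).
rewrite -(@eq_measure_integral _ _ _ _ _ (distribution P X' \x distribution P Y')%E) => //; last first.
  by move=> A mA _; (exact: law_pair || exact: (esym (law_pair mA))).
rewrite -integral12_prod_meas1//.
have iF12 := integrable_fubini_F iprod.
have mF12 := measurable_int _ iF12.
have iX : P.-integrable [set: Om] (fubini_F (distribution P Y') f \o X).
  apply/integrableP; split; first exact: measurableT_comp mF12 mX.
  have /integrableP[_] := iF12; apply: le_lt_trans.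
  rewrite (ge0_integral_pushforward mX)//; exact: measurableT_comp.
rewrite (integral_pushforward mX)//.
apply: eq_integral => w _ /=; rewrite /fubini_F integral_pushforward//.
- by rewrite Ex_EFin//; exact: iFx.
- by apply: measurableT_comp mf _; exact: measurable_fun_pair.
- exact: (iFx (X w)).
Qed.

End IndependentPair.

Section Filtration.
Context {d} {Om : measurableType d} {R : realType} (P : probability Om R).
Context (D : {RV P >-> R}) (dem dem' : int -> {RV P >-> R}) (Ghat : {RV P >-> nat}).
Hypothesis dem_law : forall t, distribution P (dem t) = distribution P D.
Hypothesis indep : mutually_independent P (source_sigma dem dem' Ghat).
Local Notation L1 X := (P.-integrable [set: Om] (EFin \o X)).
Local Notation Ex X := (Rintegral P [set: Om] X).
Local Notation src := (source_sigma dem dem' Ghat).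

(** All [dem'] and [Ghat] belong to the past of every period, since the initial inventory is built
    from them. *)
Definition before (t : nat) (i : int + int + unit) : bool :=
  if i is inl (inl s) then (s < t%:Z)%R else true.

Definition past (t : nat) : set (set Om) := \bigcup_(i in [set` before t]) src i.

(** Stated as measurability on [Om] equipped with the sigma-algebra of the past, so that the closure
    properties of measurable functions apply directly. *)
Definition adapted {d'} {T : measurableType d'} (t : nat) (X : Om -> T) : Prop :=
  measurable_fun [set: g_sigma_algebraType (past t)]
    (X : g_sigma_algebraType (past t) -> T).

Lemma src_measurable i A : src i A -> measurable A.
Proof.
by case: i => [[t|t]|[]] [B mB <-]; rewrite setTI -[X in measurable X]setTI;
  apply: measurable_funPT.
Qed.

Lemma src_setT i : src i setT.
Proof. by case: i => [[t|t]|[]]; exists setT => //; rewrite preimage_setT setTI. Qed.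

Lemma src_setI i A B : src i A -> src i B -> src i (A `&` B).
Proof.
by case: i => [[t|t]|[]] [A' mA <-] [B' mB <-]; exists (A' `&` B');
  rewrite ?preimage_setI ?setTI//; exact: measurableI.
Qed.

Lemma past_measurable t : <<s past t >> `<=` measurable.
Proof.
apply: smallest_sub; first exact: sigma_algebra_measurable.
by move=> A [i _ /src_measurable].
Qed.

(** Finite intersections of past events from distinct sources: a pi-system generating the past, on
    which mutual independence can be used as it is stated. *)
Let cyl t : set (set Om) := [set A | exists (J : seq (int + int + unit)) F,
  [/\ uniq J, forall j, j \in J -> before t j /\ src j (F j) &
      A = \bigcap_(j in [set` J]) F j]].

Let cyl_measurable t : cyl t `<=` measurable.
Proof.
move=> A [J [F [uJ HF ->]]]; apply: fin_bigcap_measurable => // j /= jJ.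
by have [_ /src_measurable] := HF j jJ.
Qed.

Let cyl_setT t : cyl t setT.
Proof.
exists [::], (fun=> setT); split => //.
by rewrite (_ : [set` [::]] = set0) ?bigcap_set0//; apply/seteqP; split.
Qed.

Let cyl_setI t : setI_closed (cyl t).
Proof.
move=> _ _ [J [F [uJ HF ->]]] [K [G [uK HG ->]]].
pose H j := (if j \in J then F j else setT) `&` (if j \in K then G j else setT).
exists (undup (J ++ K)), H; split; first exact: undup_uniq.
  move=> j; rewrite mem_undup mem_cat => jJK; split.
    by case/orP: jJK => [/HF[]|/HG[]].
  apply: src_setI; [case: ifPn => [/HF[]//|_]|case: ifPn => [/HG[]//|_]]; exact: src_setT.
apply/seteqP; split => [w [wF wG] j /=|w wH].
  by move=> _; split; case: ifPn => // jJ; [exact: wF|exact: wG].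
split => j /= jJ; have := wH j; rewrite /= mem_undup mem_cat jJ ?orbT /H jJ;
  by move=> /(_ isT)[].
Qed.

Let indep_cyl t A B : cyl t A -> src (inl (inl t%:Z)) B ->
  P (A `&` B) = (P A * P B)%E.
Proof.
move=> [J [F [uJ HF ->]]] sB; set tt := inl (inl t%:Z) : int + int + unit.
have ttJ : tt \notin J by apply/negP => /HF[/=]; rewrite ltxx.
pose H j := if j == tt then B else F j.
have HJ j : j \in J -> H j = F j.
  by move=> jJ; rewrite /H; case: eqP => // jt; rewrite -jt jJ in ttJ.
have -> : \bigcap_(j in [set` J]) F j `&` B = \bigcap_(j in [set` tt :: J]) H j.
  apply/seteqP; split => [w [wF wB] j /=|w wH].
    by rewrite inE => /orP[/eqP ->|jJ]; [rewrite /H eqxx|rewrite HJ//; exact: wF].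
  split => [j /= jJ|]; first by rewrite -HJ//; apply: wH; rewrite /= inE jJ orbT.
  by have := wH tt; rewrite /= mem_head /H eqxx; exact.
have Ht : H tt = B by rewrite /H eqxx.
rewrite [in RHS]indep//; last by move=> j /HF[].
rewrite indep/=; [|by rewrite ttJ|]; last first.
  by move=> j; rewrite inE => /orP[/eqP ->|jJ]; [rewrite Ht|rewrite HJ//; exact: (HF j jJ).2].
rewrite big_cons Ht muleC; congr (_ * _)%E.
by rewrite big_seq [RHS]big_seq; apply: eq_bigr => j /HJ <-.
Qed.

(** With [E] the event about [dem t], the finite measures [P(. & E)] and [P(E) P(.)] agree on the
    pi-system [cyl t], hence on the sigma-algebra it generates. *)
Lemma past_indep t A B : <<s past t >> A -> measurable B ->
  P (A `&` dem t%:Z @^-1` B) = (P A * P (dem t%:Z @^-1` B))%E.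
Proof.
move=> pA mB; set E := dem t%:Z @^-1` B.
have sE : src (inl (inl t%:Z)) E by exists B => //; rewrite setTI.
have mE := src_measurable sE.
have pE : (0 <= fine (P E))%R by rewrite fine_ge0.
have PAE : P E = (fine (P E))%:E by rewrite fineK//; exact: fin_num_measure.
suff : mrestr P mE A = mscale (NngNum pE) P A.
  move=> h; transitivity (mscale (NngNum pE) P A); first exact: h.
  by rewrite muleC [in RHS]PAE.
apply: (@g_sigma_algebra_measure_unique _ _ _ (cyl t) (@cyl_measurable t)
  (fun=> setT)) => //.
by rewrite bigcup_const//; exists 0.
- move=> C /indep_cyl h; transitivity (P C * P E)%E; first exact: h.
  by rewrite muleC [in LHS]PAE.
- move=> _; rewrite /= /mrestr setTI; change (P E < +oo)%E.
  by rewrite PAE ltry.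
- apply: smallest_sub pA; first exact: smallest_sigma_algebra.
  move=> C [i ti sC]; apply: sub_sigma_algebra.
  exists [:: i], (fun=> C); split => //.
    by move=> j; rewrite inE => /eqP ->.
  apply/seteqP; split => [w wC j //|w]; apply; exact: mem_head.
Qed.

Section Adapted.
Context {d'} {T : measurableType d'}.

Lemma adapted_measurable t (X : Om -> T) : adapted t X -> measurable_fun [set: Om] X.
Proof.
move=> aX _ B mB; apply: (@past_measurable t).
exact: (aX measurableT B mB).
Qed.

Lemma adapted_le s t (X : Om -> T) : (s <= t)%N -> adapted s X -> adapted t X.
Proof.
move=> st aX _ B mB; have := aX measurableT B mB.
apply: smallest_sub; first exact: smallest_sigma_algebra.
move=> A [i si sA]; apply: sub_sigma_algebra; exists i => //.
by case: i si {sA} => [[u|//]|//] /= /lt_le_trans; apply; rewrite lez_nat.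
Qed.

Lemma adapted_src t i (X : Om -> T) : before t i ->
  (forall B, measurable B -> src i (X @^-1` B)) -> adapted t X.
Proof.
move=> ti sX _ B mB; apply: sub_sigma_algebra; exists i => //.
by rewrite setTI; exact: sX.
Qed.

End Adapted.

Lemma adapted_dem s t : (s < t)%N -> adapted t (dem s%:Z).
Proof.
move=> st; apply: (@adapted_src _ _ _ (inl (inl s%:Z))); first by rewrite /= ltz_nat.
by move=> B mB; exists B => //; rewrite setTI.
Qed.

Lemma adapted_dem' s t : adapted t (dem' s).
Proof.
apply: (@adapted_src _ _ _ (inl (inr s))) => //.
by move=> B mB; exists B => //; rewrite setTI.
Qed.

Lemma adapted_Ghat t : adapted t Ghat.
Proof.
apply: (@adapted_src _ _ _ (inr tt)) => //.
by move=> B mB; exists B => //; rewrite setTI.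
Qed.

(** The number of summands is random. The sum is a limit of sums of fixed length whose terms carry
    the indicator of [i <= Ghat]; at each point these are eventually constant. *)
Lemma adapted_initial_inventory t : adapted t (initial_inventory dem' Ghat).
Proof.
pose h n w := - \sum_(1 <= i < n) dem' (- i%:Z) w * (\1_(Ghat @^-1` [set k | (i <= k)%N]) w).
apply: (@measurable_fun_cvg _ (g_sigma_algebraType (past t)) R setT h).
  move=> n; apply: measurableT_comp => //; apply: measurable_sum => i.
  apply: measurable_funM; first exact: adapted_dem'.
  apply: measurable_indic.
  have mi : measurable [set k : nat | (i <= k)%N] by [].
  by have := @adapted_Ghat t measurableT _ mi; rewrite setTI.
move=> w _; apply: cvg_near_cst; near=> n.
rewrite /h /initial_inventory; congr (- _).
have nG : (Ghat w < n)%N by near: n; exact: nbhs_infty_gt.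
rewrite (big_cat_nat (n := (Ghat w).+1))//= [X in _ + X]big_nat_cond [X in _ + X]big1 ?addr0.
  apply: eq_big_nat => i /andP[_ iG]; rewrite indicE mem_set ?mulr1//=.
move=> i /andP[/andP[iG _] _]; rewrite indicE memNset ?mulr0//=.
by apply/negP; rewrite -ltnNge.
Unshelve. all: by end_near. Qed.

(** The freezing lemma: the demand of period [t] is averaged out with the adapted variable held
    fixed. *)
Lemma Ex_adapted {d'} {T : measurableType d'} t (X : Om -> T) (F : T * R -> R) :
  adapted t X -> measurable_fun [set: T * R] F ->
  L1 (fun w => F (X w, dem t%:Z w)) -> (forall x, L1 (fun w => F (x, D w))) ->
  Ex (fun w => F (X w, dem t%:Z w)) = Ex (fun w => Ex (fun w' => F (X w, D w'))).
Proof.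
move=> aX mF iF iFx; have mX := adapted_measurable aX.
apply: Ex_indep_pair => // A B mA mB.
by apply: past_indep => //; rewrite -[X in _ X]setTI; exact: aX.
Qed.

End Filtration.

(** * Verification on a window *)

Section Window.
Context {d} {Om : measurableType d} {R : realType} (P : probability Om R).
Context (D : {RV P >-> R}) (dem dem' : int -> {RV P >-> R}) (Ghat : {RV P >-> nat}).
Hypothesis D_ge0 : forall w, 0 <= D w.
Hypothesis dem_law : forall t, distribution P (dem t) = distribution P D.
Hypothesis indep : mutually_independent P (source_sigma dem dem' Ghat).
Local Notation L1 X := (P.-integrable [set: Om] (EFin \o X)).
Local Notation Ex X := (Rintegral P [set: Om] X).
Hypothesis iD : L1 D.
Local Notation adapted := (adapted dem dem' Ghat).
Local Notation A := (avg P D).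
Implicit Types (xi X Y : Om -> R) (f : R -> R).

Lemma L1_law (X Y : {RV P >-> R}) : distribution P X = distribution P Y -> L1 Y -> L1 X.
Proof.
move=> XY iY.
have mE : measurable_fun [set: R] (EFin : R -> \bar R) by exact/measurable_EFinP.
have /integrableP[_ iY'] := iY.
apply/integrableP; split; first exact/measurable_EFinP.
apply: le_lt_trans iY'; rewrite le_eqVlt; apply/orP; left; apply/eqP.
have mA : measurable_fun [set: R] (fun y : R => `|y%:E|%E) by exact: measurableT_comp.
transitivity (\int[distribution P X]_y `|y%:E|)%E.
  by rewrite ge0_integral_pushforward.
by rewrite XY ge0_integral_pushforward.
Qed.

Lemma Ex_law (X Y : {RV P >-> R}) : distribution P X = distribution P Y -> L1 Y -> Ex X = Ex Y.
Proof.
move=> XY iY; have iX := L1_law XY iY.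
have mE : measurable_fun [set: R] (EFin : R -> \bar R) by exact/measurable_EFinP.
rewrite /Rintegral; congr fine.
transitivity (\int[distribution P X]_y y%:E)%E.
  by rewrite integral_pushforward.
by rewrite XY integral_pushforward.
Qed.

Lemma L1_dem t : L1 (dem t). Proof. exact: L1_law (dem_law t) iD. Qed.

Lemma Ex_dem t : Ex (dem t) = Ex D. Proof. exact: Ex_law (dem_law t) iD. Qed.

Lemma L1M_bounded X Y a : L1 X -> measurable_fun [set: Om] Y ->
  (forall w, `|Y w| <= a) -> L1 (fun w => X w * Y w).
Proof.
move=> iX mY Ya.
apply: (L1_le _ (L1Z a (L1_norm iX))).
  exact: measurable_funM (L1_measurable iX) mY.
by move=> w; rewrite normrM mulrC ler_wpM2r.
Qed.

Lemma adaptedD t X Y : adapted t X -> adapted t Y -> adapted t (fun w => X w + Y w).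
Proof. exact: measurable_funD. Qed.

Lemma adaptedB t X Y : adapted t X -> adapted t Y -> adapted t (fun w => X w - Y w).
Proof. exact: measurable_funB. Qed.

Lemma adapted_cst t a : adapted t (fun=> a : R).
Proof. exact: measurable_cst. Qed.
Arguments adapted_cst t a : clear implicits.

Lemma adapted_comp t X f : adapted t X -> measurable_fun [set: R] f ->
  adapted t (fun w => f (X w)).
Proof. by move=> aX mf; exact: measurableT_comp mf aX. Qed.

(** The weight [xi] will be a deviation of the policy from the reference path, and [f] the positive
    part of a multiplier. *)
Lemma Ex_cond t xi X f k : adapted t xi -> adapted t X -> lip k f ->
  L1 (fun w => xi w * f (X w - dem t%:Z w)) ->
  Ex (fun w => xi w * f (X w - dem t%:Z w)) = Ex (fun w => xi w * A f (X w)).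
Proof.
move=> axi aX kf iF; pose F (z : R * R * R) := z.1.1 * f (z.1.2 - z.2).
have aP : adapted t (fun w => (xi w, X w)) by exact: measurable_fun_pair.
have mF : measurable_fun setT F.
  apply: measurable_funM; first exact: measurableT_comp measurable_fst _.
  apply: measurableT_comp (lip_measurable kf) _; apply: measurable_funB => //.
  exact: measurableT_comp measurable_snd _.
rewrite (Ex_adapted dem_law indep aP mF)//; last first.
  by move=> [x y]; apply/L1Z; exact: (L1_avg iD _ kf).
by apply: eq_Ex => w; rewrite /F /= ExZ//; exact: (L1_avg iD _ kf).
Qed.

(** Levels constantly 0 give the Lindley chain, base-stock levels the reference path; both are
    driven by the demands from period [s] on. *)
Fixpoint reflected (s : nat) (X0 : Om -> R) (sig : nat -> R) (r : R) (j : nat) : Om -> R :=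
  if j is i.+1 then
    fun w => Num.max (sig j) (reflected s X0 sig r i w + r - dem (s + i)%:Z w)
  else X0.

Lemma reflected_adapted s X0 sig r j : adapted s X0 -> adapted (s + j) (reflected s X0 sig r j).
Proof.
move=> aX; elim: j => [|j IH] /=; first by rewrite addn0.
apply: adapted_comp; last exact: lip_measurable (lip_max _).
apply: adaptedB; last by apply: adapted_dem; rewrite addnS.
apply: adaptedD; last exact: adapted_cst.
by apply: adapted_le IH; rewrite addnS.
Qed.

Lemma reflected_L1 s X0 sig r j : L1 X0 -> L1 (reflected s X0 sig r j).
Proof.
move=> iX; elim: j => [//|j IH] /=.
apply: (L1_lip (lip_max _)); apply: L1B; last exact: L1_dem.
by apply: L1D => //; exact: L1_cst.
Qed.

(* The expectation of f at step j of the path reflected at the levels sig; it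
   does not depend on the starting period, hence neither do the prices below. *)
Fixpoint refv (sig : nat -> R) (r : R) (j : nat) (f : R -> R) : R :=
  if j is i.+1 then
    refv sig r i (fun z => A (fun y => f (Num.max (sig j) y)) (z + r))
  else f (sig 0%N).

Lemma refv_ge0 sig r j f : (forall y, 0 <= f y) -> 0 <= refv sig r j f.
Proof. by elim: j f => //= j IH f f0; apply: IH => z; exact: Ex_ge0. Qed.

(** [xi] is known at [s], whereas the path has a deterministic start and depends on the demands from
    [s] on: the expectation factors. *)
Lemma Ex_refv s sig r j xi f k a : adapted s xi -> L1 xi -> lip k f ->
  (forall y, `|f y| <= a) ->
  Ex (fun w => xi w * f (reflected s (fun=> sig 0%N) sig r j w)) =
  Ex xi * refv sig r j f.
Proof.
move=> axi ixi; elim: j f => [|j IH] f kf fa /=.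
  by rewrite [RHS]mulrC -ExZ//; apply: eq_Ex => w; rewrite mulrC.
have kf' := lip_max_comp (sig j.+1) kf.
rewrite -IH; [|exact/lip_shift/avg_lip|]; last first.
  by move=> y; apply: avg_bound kf' _.
have aR := reflected_adapted (j := j) sig r (adapted_cst s (sig 0%N)).
rewrite -(@Ex_cond (s + j)%N xi (fun w => reflected s (fun=> sig 0%N) sig r j w + r)
  (fun y => f (Num.max (sig j.+1) y)) k)//.
- exact: adapted_le (leq_addr _ _) axi.
- exact: adaptedD aR (adapted_cst _ _).
- apply: (L1M_bounded (a := a)) => //.
  apply: measurableT_comp (lip_measurable kf') _.
  apply: (L1_measurable (P := P)); apply: L1B; last exact: L1_dem.
  by apply: L1D; [apply: reflected_L1|]; exact: L1_cst.
Qed.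

Lemma Ex_chain s X0 r j f k : adapted s X0 -> L1 X0 -> lip k f ->
  Ex (fun w => f (reflected s X0 (fun=> 0) r j w)) =
  Ex (fun w => iter j (lindley P D r) f (X0 w)).
Proof.
move=> aX iX; elim: j f => [//|j IH] f kf.
rewrite iterSr -IH; last exact: lindley_lip.
have kf' := lip_max_comp 0 kf.
have aR := reflected_adapted (j := j) (fun=> 0) r aX.
have iR := reflected_L1 s (fun=> 0) r j iX.
have iR' : L1 (fun w => reflected s X0 (fun=> 0) r j w + r - dem (s + j)%:Z w).
  by apply: L1B; [apply: L1D => //; exact: L1_cst|exact: L1_dem].
have i1 : L1 (fun w => 1 * f (Num.max 0 (reflected s X0 (fun=> 0) r j w + r - dem (s + j)%:Z w))).
  exact/L1Z/(L1_lip kf' iR').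
have := @Ex_cond (s + j)%N (fun=> 1) (fun w => reflected s X0 (fun=> 0) r j w + r)
  (fun y => f (Num.max 0 y)) k (adapted_cst _ _) (adaptedD aR (adapted_cst _ _)) kf' i1.
rewrite (eq_Ex P (Y := fun w => f (reflected s X0 (fun=> 0) r j.+1 w))); last first.
  by move=> w; rewrite mul1r.
by move=> ->; apply: eq_Ex => w; rewrite mul1r.
Qed.

Section Verification.
Variables (r kg kgam bgam eps : R) (g gam : R -> R) (S : nat -> R).
Hypothesis r_ge0 : 0 <= r.
Hypothesis g_lip : lip kg g.
Hypothesis gam_lip : lip kgam gam.
Hypothesis gam_ndecr : ndecr gam.
Hypothesis gam_bound : forall y, `|gam y| <= bgam.
Hypothesis g_gam : subgrad eps g gam.
Local Notation adj := (adjoint P D r gam).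
Hypothesis S_zero : forall k, adj k.+1 (S k) = 0.

(* S k is the base-stock level with k periods to go, hence the reversed index. *)
Definition levels (M j : nat) : R := S (M - j)%N.

Definition refpath (M s j : nat) : Om -> R :=
  reflected s (fun=> levels M 0) (levels M) r j.

(** The mean marginal cost of one more regular unit entering at step [j]. Only the positive part of
    the multiplier counts: where it is negative, the reference path orders up to its level
    anyway. *)
Definition price (M j : nat) : R :=
  refv (levels M) r j (fun z => A (fun y => Num.max 0 (adj (M - j)%N y)) (z + r)).

Lemma price_ge0 M j : 0 <= price M j.
Proof. by apply: refv_ge0 => z; apply: Ex_ge0 => w; rewrite le_max lexx. Qed.

Let adj_lip k : lip (k%:R * kgam) (adj k).
Proof. exact: adjoint_lip. Qed.

Let adjp_lip k : lip (k%:R * kgam) (fun y => Num.max 0 (adj k y)).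
Proof. by apply: lip_maxl; exact: adj_lip. Qed.

Let adjp_bound k y : `|Num.max 0 (adj k y)| <= k%:R * bgam.
Proof.
have := adjoint_bound r iD gam_lip gam_bound k y.
by case: (leP 0 (adj k y)) => // _; rewrite normr0; apply: le_trans.
Qed.

Lemma refpath_adapted M s j : adapted (s + j) (refpath M s j).
Proof. by apply: reflected_adapted; exact: adapted_cst. Qed.

Lemma refpath_L1 M s j : L1 (refpath M s j).
Proof. by apply: reflected_L1; exact: L1_cst. Qed.

(* Complementary slackness: the multiplier vanishes when the reference path
   places an express order. *)
Lemma adjoint_slackness k y x dx : 0 <= x ->
  Num.max 0 (adj k.+1 y) * dx <=
  adj k.+1 (Num.max (S k) y) * (dx + x - (Num.max (S k) y - y)).
Proof.
move=> x0; have adj_nd := adjoint_ndecr r iD gam_lip gam_ndecr k.+1.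
case: (leP (S k) y) => Sy.
  have : 0 <= adj k.+1 y by rewrite -(S_zero k); exact: adj_nd.
  move=> a0; rewrite (max_r a0) subrr subr0 mulrDr lerDl mulr_ge0//.
have : adj k.+1 y <= 0 by rewrite -(S_zero k); apply: adj_nd; exact: ltW.
by move=> a0; rewrite (max_l a0) S_zero !mul0r.
Qed.

(** Summation by parts along the multipliers. The subgradient bound leaves the terms [a j], the
    recursion for [adjoint] splits them as [b j - c j], and slackness bounds [c j] plus the price
    term by [b j.+1]. The boundary terms [b 0] and [c M] vanish, so [Z 0] does not enter the
    bound. *)
Lemma verification (M s : nat) (Z rho : nat -> Om -> R) :
  (forall j, (j <= M)%N -> adapted (s + j) (Z j) /\ L1 (Z j)) ->
  (forall j, (j < M)%N -> adapted s (rho j) /\ L1 (rho j)) ->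
  (forall j w, (j < M)%N -> Z j w + rho j w - dem (s + j)%:Z w <= Z j.+1 w) ->
  \sum_(j < M.+1) Ex (fun w => g (refpath M s j w)) - M.+1%:R * eps +
    \sum_(j < M) price M j * (Ex (rho j) - r)
  <= \sum_(j < M.+1) Ex (fun w => g (Z j w)).
Proof.
move=> HZ Hrho Zstep.
pose ref := refpath M s.
pose del j w := Z j w - ref j w.
have idel j : (j <= M)%N -> L1 (del j).
  by move=> jM; apply: L1B; [exact: (HZ j jM).2|exact: refpath_L1].
have adel j : (j <= M)%N -> adapted (s + j) (del j).
  by move=> jM; apply: adaptedB; [exact: (HZ j jM).1|exact: refpath_adapted].
have mref j f k : lip k f -> measurable_fun setT (fun w => f (ref j w)).
  move=> kf; apply: measurableT_comp (lip_measurable kf) _.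
  exact: L1_measurable (refpath_L1 M s j).
pose Yst j w := ref j w + r - dem (s + j)%:Z w.
have iY j : L1 (Yst j).
  apply: L1B; last exact: L1_dem.
  by apply: L1D; [exact: refpath_L1|exact: L1_cst].
have mY j f k : lip k f -> measurable_fun setT (fun w => f (Yst j w)).
  by move=> kf; apply: measurableT_comp (lip_measurable kf) (L1_measurable (iY j)).
pose a j := Ex (fun w => del j w * gam (ref j w)).
pose b j := Ex (fun w => del j w * adj (M - j).+1 (ref j w)).
pose c j := Ex (fun w => del j w * Num.max 0 (adj (M - j) (Yst j w))).
have iadj j k i : (i <= M)%N -> L1 (fun w => del i w * adj k (ref j w)).
  move=> iM; apply: (L1M_bounded (idel i iM) (mref j _ _ (adj_lip k))) => w.
  exact: (adjoint_bound r iD gam_lip gam_bound k).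
have iadjp xi j k : L1 xi -> L1 (fun w => xi w * Num.max 0 (adj k (Yst j w))).
  by move=> ixi; apply: (L1M_bounded ixi (mY j _ _ (adjp_lip k))) => w; exact: adjp_bound.
have abc j : (j <= M)%N -> a j = b j - c j.
  move=> jM; rewrite /b /c.
  have -> : Ex (fun w => del j w * Num.max 0 (adj (M - j) (Yst j w))) =
      Ex (fun w => del j w * A (fun y => Num.max 0 (adj (M - j) y)) (ref j w + r)).
    apply: (Ex_cond (k := (M - j)%:R * kgam)) => //.
    - exact: adel.
    - exact: adaptedD (@refpath_adapted M s j) (adapted_cst _ _).
    - by apply: iadjp; exact: idel.
  rewrite -ExB; [|exact: iadj|]; last first.
    have kl := lip_shift r (avg_lip iD (adjp_lip (M - j))).
    apply: (L1M_bounded (idel j jM) (mref j _ _ kl)) => w.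
    by apply: avg_bound (adjp_lip _) _ => // y; exact: adjp_bound.
  by apply: eq_Ex => w; rewrite adjointS; ring.
have bc j : (j < M)%N -> c j + price M j * (Ex (rho j) - r) <= b j.+1.
  move=> jM; have [arho irho] := Hrho j jM.
  have irr : L1 (fun w => rho j w - r) by apply: L1B => //; exact: L1_cst.
  have -> : price M j * (Ex (rho j) - r) =
      Ex (fun w => (rho j w - r) * Num.max 0 (adj (M - j) (Yst j w))).
    rewrite mulrC -[X in _ - X](Ex_cst P) -ExB//; last exact: L1_cst.
    have kl := lip_shift r (avg_lip iD (adjp_lip (M - j))).
    rewrite /price -(@Ex_refv s (levels M) r j (fun w => rho j w - r) _ _ ((M - j)%:R * bgam) _ irr kl); first last.
    - by move=> y; apply: avg_bound (adjp_lip _) _ => // z; exact: adjp_bound.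
    - exact: adaptedB arho (adapted_cst _ _).
    apply/esym; apply: (Ex_cond (k := (M - j)%:R * kgam) (t := (s + j)%N)) => //.
    - apply: adapted_le (leq_addr _ _) _; exact: adaptedB arho (adapted_cst _ _).
    - exact: adaptedD (@refpath_adapted M s j) (adapted_cst _ _).
    - exact: iadjp.
  rewrite /c -ExD; [|by apply: iadjp; exact: (idel j (ltnW jM))|exact: iadjp].
  apply: Ex_le.
  - by apply: L1D; apply: iadjp => //; exact: (idel j (ltnW jM)).
  - exact: iadj.
  move=> w; rewrite -mulrDl mulrC subnSK// [leRHS]mulrC.
  (* [x] is the express order of the policy, the slack in the constraint. *)
  pose x := Z j.+1 w - (Z j w + rho j w - dem (s + j)%:Z w).
  have x0 : 0 <= x by rewrite subr_ge0 Zstep.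
  have := adjoint_slackness (M - j.+1) (Yst j w) (del j w + (rho j w - r)) x0.
  rewrite subnSK//; move=> /le_trans; apply.
  rewrite (_ : ref j.+1 w = Num.max (S (M - j.+1)) (Yst j w))//.
  rewrite le_eqVlt; apply/orP; left; apply/eqP; congr (_ * _).
  rewrite /x /del (_ : ref j.+1 w = Num.max (S (M - j.+1)) (Yst j w))// /Yst.
  ring.
have suma m : (m <= M)%N ->
    \sum_(j < m) price M j * (Ex (rho j) - r) - c m <= \sum_(j < m.+1) a j.
  elim: m => [_|m IH mM].
    rewrite big_ord0 sub0r big_ord1 abc//.
    (* The reference path starts at [S M], a zero of the multiplier with [M + 1] periods to go. *)
    rewrite (_ : b 0%N = 0) ?sub0r// -[RHS](Ex_cst P 0); apply: eq_Ex => w.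
    have -> : ref 0%N w = S M by rewrite /ref /refpath /reflected /levels subn0.
    by rewrite subn0 S_zero mulr0.
  rewrite big_ord_recr [leRHS]big_ord_recr/= (abc _ mM).
  have := IH (ltnW mM); have := bc m mM; lra.
have cM : c M = 0.
  by rewrite -[RHS](Ex_cst P 0); apply: eq_Ex => w; rewrite subnn /= maxxx mulr0.
have : \sum_(j < M.+1) (Ex (fun w => g (ref j w)) + a j - eps) <=
       \sum_(j < M.+1) Ex (fun w => g (Z j w)).
  apply: ler_sum => j _; have jM : (j <= M)%N by rewrite -ltnS.
  have ig : L1 (fun w => g (ref j w)) by exact: L1_lip g_lip (refpath_L1 _ _ _).
  have ia : L1 (fun w => del j w * gam (ref j w)).
    exact: (L1M_bounded (idel j jM) (mref j _ _ gam_lip)).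
  rewrite /a -ExD// -[X in _ - X](Ex_cst P) -ExB; [|exact: L1D|exact: L1_cst].
  apply: Ex_le; [by apply: L1B; [exact: L1D|exact: L1_cst]| |].
    by apply: L1_lip g_lip _; exact: (HZ j jM).2.
  by move=> w; rewrite mulrC; exact: g_gam.
rewrite sumrB big_split/= sumr_const card_ord -mulr_natl.
have := suma M (leqnn M); rewrite cM; lra.
Qed.

End Verification.
End Window.

(** * Average cost of the reference path *)

Section ReferenceCost.
Context {d} {Om : measurableType d} {R : realType} (P : probability Om R).
Context (D : {RV P >-> R}) (dem dem' : int -> {RV P >-> R}) (Ghat : {RV P >-> nat}).
Hypothesis D_ge0 : forall w, 0 <= D w.
Hypothesis dem_law : forall t, distribution P (dem t) = distribution P D.
Hypothesis indep : mutually_independent P (source_sigma dem dem' Ghat).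
Local Notation L1 X := (P.-integrable [set: Om] (EFin \o X)).
Local Notation Ex X := (Rintegral P [set: Om] X).
Hypothesis iD : L1 D.
Variables (r kg bg C0 : R) (g : R -> R) (S : nat -> R).
Hypothesis r_ge0 : 0 <= r.
Hypothesis rD : r < Ex D.
Hypothesis g_lip : lip kg g.
Hypothesis bg_gt0 : 0 < bg.
Hypothesis g_ge : forall z, - (bg * z) <= g z.
Hypothesis S_nincr : forall k, S k.+1 <= S k.
Hypothesis C0_le : forall s,
  C0 <= limn (fun j => iter j (lindley P D r) (fun x => g (s + x)) 0).
Local Notation Tn j := (iter j (lindley P D r)).
Local Notation ref := (refpath dem r S).
Local Notation chain s j := (reflected dem s (fun=> 0) (fun=> 0) r j).

Let S_homo k l : (k <= l)%N -> S l <= S k.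
Proof.
move=> /subnK <-; elim: (l - k)%N => [//|n IH]; rewrite addSn.
exact: le_trans (S_nincr _) IH.
Qed.

Lemma ref_ge a M s j w : (forall k, a <= S k) -> (j <= M)%N ->
  a + chain s j w <= ref M s j w.
Proof.
move=> aS; elim: j => [|j IH] jM; first by rewrite addr0; exact: aS.
have := IH (ltnW jM); rewrite /refpath /= => h.
case: (leP 0 (_ + r - _)) => c0.
  by rewrite le_max; apply/orP; right; lra.
by rewrite addr0 le_max aS.
Qed.

(** Levels do not decrease as the window runs, so every earlier reflection level is at most the
    current one. *)
Lemma ref_le M s j w : (j <= M)%N -> ref M s j w <= levels S M j + chain s j w.
Proof.
elim: j => [|j IH] jM; first by rewrite addr0.
have := IH (ltnW jM); rewrite /refpath /= => h.
have : levels S M j <= levels S M j.+1 by apply: S_homo; lia.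
set c := reflected _ _ (fun=> 0) _ _ _ _ in h *; set q := reflected _ _ _ _ _ _ _ in h *.
set l := levels S M j.+1 => hl; set x := dem _ w.
have h1 : 0 <= Num.max 0 (c + r - x) by rewrite le_max lexx.
have h2 : c + r - x <= Num.max 0 (c + r - x) by rewrite le_max lexx orbT.
by rewrite ge_max; apply/andP; split; lra.
Qed.

Lemma chain_L1 s j : L1 (chain s j).
Proof. by apply: (reflected_L1 dem_law iD); exact: L1_cst. Qed.

Lemma Ex_chain0 s j f k : lip k f -> Ex (fun w => f (chain s j w)) = Tn j f 0.
Proof.
move=> kf; rewrite (Ex_chain dem_law indep iD r j _ (L1_cst P 0) kf) ?Ex_cst//.
exact: adapted_cst.
Qed.

Lemma g_shift_lip a : lip kg (fun x => g (a + x)).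
Proof. by move=> x y; have := g_lip (a + x) (a + y); rewrite opprD addrACA subrr add0r. Qed.

Lemma sum_levels M (F : R -> R) : \sum_(j < M.+1) F (levels S M j) = \sum_(k < M.+1) F (S k).
Proof.
rewrite [RHS](reindex_inj rev_ord_inj)/=; apply: eq_bigr => j _.
by rewrite /levels subSS.
Qed.

Lemma Ex_g_ref_ge_bounded a M s j : (forall k, a <= S k) -> (j <= M)%N ->
  Tn j (fun x => g (a + x)) 0 - kg * (levels S M j - a) <= Ex (fun w => g (ref M s j w)).
Proof.
move=> aS jM; have iR := refpath_L1 dem_law iD r S M s j.
have ic := chain_L1 s j.
rewrite -(Ex_chain0 s j (g_shift_lip a)) -[X in _ - X](Ex_cst P) -ExB; last 2 first.
- exact: L1_lip (g_shift_lip a) ic.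
- exact: L1_cst.
apply: Ex_le.
- by apply: L1B; [exact: L1_lip (g_shift_lip a) ic|exact: L1_cst].
- exact: L1_lip g_lip iR.
move=> w; have h1 := ref_ge s w aS jM; have h2 := ref_le s w jM.
have kg0 := lip_ge0 g_lip.
have := g_lip (a + chain s j w) (ref M s j w).
rewrite (_ : `|a + _ - _| = ref M s j w - (a + chain s j w)); last first.
  by rewrite distrC ger0_norm// subr_ge0.
have : kg * (ref M s j w - (a + chain s j w)) <= kg * (levels S M j - a).
  by apply: ler_wpM2l => //; lra.
by have := ler_norm (g (a + chain s j w) - g (ref M s j w)); lra.
Qed.

(** If the levels are bounded below they converge to their infimum [m]; the path differs from [m]
    plus the chain by at most the gap of the level to [m], and these gaps average to 0. Otherwise
    the levels tend to minus infinity and the backorder cost alone exceeds [C0] for all but finitely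
    many levels. *)
Lemma refcost_ge e : 0 < e -> exists M0 : nat, forall M s, (M0 <= M)%N ->
  (C0 - e) * M.+1%:R <= \sum_(j < M.+1) Ex (fun w => g (ref M s j w)).
Proof.
move=> e0; have e2 : 0 < e / 2 by rewrite divr_gt0.
have kg0 := lip_ge0 g_lip.
case: (pselect (exists a, forall k, a <= S k)) => [[a aS]|unb].
  have cS : S @ \oo --> inf (range S).
    apply: nonincreasing_cvgn; first by move=> k l; exact: S_homo.
    by exists a => _ [k _ <-].
  set m := inf (range S) in cS.
  have mS k : m <= S k.
    by apply: ge_inf; [exists a => _ [l _ <-]|exists k].
  have e3 : 0 < e / 2 / (kg + 1) by rewrite divr_gt0// ltr_wpDl.
  have [n1 h1] := cesaro_sum cS e3.
  have [n2 h2] := cesaro_sum (iter_lindley0_cvg D_ge0 iD r_ge0 rD (g_shift_lip m)) e2.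
  exists (maxn n1 n2) => M s; rewrite geq_max => /andP[n1M n2M].
  have {}h1 := h1 M.+1 (leqW n1M); have {}h2 := h2 M.+1 (leqW n2M).
  apply: (@le_trans _ _ (\sum_(j < M.+1) (Tn j (fun x => g (m + x)) 0 -
      kg * (levels S M j - m)))); last first.
    by apply: ler_sum => j _; apply: Ex_g_ref_ge_bounded => //; rewrite -ltnS.
  rewrite sumrB -mulr_sumr (sum_levels M (fun x => x - m)) sumrB sumr_const card_ord -mulr_natl.
  set l := limn _ in h2; have Cl : C0 * M.+1%:R <= M.+1%:R * l.
    by rewrite mulrC ler_wpM2l//; exact: C0_le.
  move: h1 h2; set N : R := M.+1%:R in Cl *; have N0 : 0 <= N by exact: ler0n.
  rewrite !ler_norml => /andP[_ h1] /andP[h2 _].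
  have hk : kg * (\sum_(k < M.+1) S k - N * m) <= e / 2 * N.
    apply: le_trans (ler_wpM2l kg0 h1) _.
    set q := e / 2 / (kg + 1) in e3 *.
    have -> : e / 2 = q * (kg + 1) by rewrite divfK// gt_eqF// ltr_wpDl.
    have : 0 <= q * N by rewrite mulr_ge0// ltW.
    lra.
  lra.
have [B [C [B0 C0' uB]]] := sum_u_le D_ge0 iD r_ge0 rD.
have u0B := u0_le D_ge0 iD uB.
(* [S k + B] bounds the mean position, hence the second term bounds the mean cost from below; the
   cap at [C0] makes [v] eventually constant. *)
pose v k := Num.min C0 (- (bg * (S k + B))).
have cv : v @ \oo --> C0.
  apply: cvg_near_cst.
  have [K SK] : exists K, S K < - (C0 / bg) - B.
    apply: contrapT => /forallNP H; apply: unb; exists (- (C0 / bg) - B) => k.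
    by rewrite leNgt; apply/negP; exact: H.
  exists K => // k /= Kk; rewrite /v min_l//.
  have : S k <= S K by exact: S_homo.
  have -> : C0 = bg * (C0 / bg) by rewrite mulrC divfK// gt_eqF.
  by rewrite -mulrN ler_pM2l//; lra.
have [n h] := cesaro_sum cv e0.
exists n => M s nM; have {}h := h M.+1 (leqW nM).
apply: (@le_trans _ _ (\sum_(j < M.+1) v (M - j)%N)).
  have -> : \sum_(j < M.+1) v (M - j)%N = \sum_(k < M.+1) v k.
    exact: (sum_levels M (fun x => Num.min C0 (- (bg * (x + B))))).
  move: h; rewrite ler_norml => /andP[h _]; lra.
apply: ler_sum => j _; have jM : (j <= M)%N by rewrite -ltnS.
have iR := refpath_L1 dem_law iD r S M s j.
apply: (@le_trans _ _ (Ex (fun w => - bg * ref M s j w))); last first.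
  apply: Ex_le; [exact: L1Z|exact: L1_lip g_lip iR|].
  by move=> w; rewrite mulNr.
rewrite ExZ// /v ge_min; apply/orP; right.
rewrite mulNr lerN2 ler_pM2l//.
apply: (@le_trans _ _ (Ex (fun w => levels S M j + chain s j w))).
  apply: Ex_le => //; last by move=> w; exact: ref_le.
  by apply: L1D; [exact: L1_cst|exact: chain_L1].
rewrite ExD ?Ex_cst; [|exact: L1_cst|exact: chain_L1].
by rewrite lerD2l (Ex_chain0 s j lip_id).
Qed.

End ReferenceCost.

(** * Paths of an arbitrary policy *)

Section PolicyPath.
Context {R : realType} (L L0 : nat).
Hypothesis L0L : (L0.+1 < L)%N.
Variables (f : policy (R := R) L L0) (x : R) (dm : nat -> R).

Local Notation J := (inventory f x dm).
Local Notation rho := (regular_order f x dm).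
Local Notation e := (express_order f x dm).
Local Notation n := (L - L0.+1)%N.

Definition position (t : nat) : R := expedited_position L L0 (J t) rho e t.

(** The position after the express order, which is the [Z] of the window problem. *)
Definition raised (t : nat) : R := position t + e t.

(** [q 0 = 0] stands for all orders before period 1, which keeps the identity valid when [t - a] is
    truncated. *)
Lemma window_pop (q : nat -> R) t a u : q 0%N = 0 -> ((a <= t)%N -> (t - a < u)%N) ->
  q (t - a)%N + \sum_(t.+1 - a <= k < u) q k = \sum_(t - a <= k < u) q k.
Proof.
move=> q0 au; case: (leqP a t) => at_.
  by rewrite subSn// [RHS]big_ltn//; exact: au.
have -> : (t - a = 0)%N by lia.
by have -> : (t.+1 - a = 0)%N by [lia]; rewrite q0 add0r.
Qed.

Lemma window_shift (q : nat -> R) t a b : q 0%N = 0 -> (b <= a)%N ->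
  q (t - a)%N + \sum_(t.+1 - a <= k < t.+1 - b) q k =
  \sum_(t - a <= k < t - b) q k + q (t - b)%N.
Proof.
move=> q0 ba; case: (leqP b t) => bt.
  rewrite window_pop//; last by lia.
  by rewrite subSn// big_nat_recr//=; lia.
have -> : (t.+1 - b = 0)%N by lia.
have -> : (t - b = 0)%N by lia.
have -> : (t - a = 0)%N by lia.
by rewrite !big_geq// q0.
Qed.

Let rho0 : rho 0 = 0. Proof. by have [] := orders0 f x dm. Qed.
Let e0 : e 0 = 0. Proof. by have [] := orders0 f x dm. Qed.

Lemma positionE t : position t =
  J t + \sum_(t - L0 <= k < t - 0) e k + \sum_(t - L <= k < t - n) rho k.
Proof. by rewrite /position /expedited_position subn0; have -> : ((t + L0).+1 - L = t - n)%N by [lia]. Qed.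

Lemma positionS t : (0 < t)%N ->
  position t.+1 = raised t + rho (t - n)%N - dm t.
Proof.
move=> t0; rewrite /raised !positionE inventoryS//.
have h1 := window_shift t e0 (leq0n L0).
have h2 := @window_shift rho t L n rho0 (leq_subr _ _).
rewrite !subn0 in h1 *; lra.
Qed.

Lemma raisedS t : (0 < t)%N ->
  raised t.+1 = raised t + rho (t - n)%N - dm t + e t.+1.
Proof. by move=> t0; rewrite {1}/raised positionS. Qed.

Lemma position1 : position 1 = x.
Proof.
rewrite positionE inventory1 [X in _ + X]big_geq; last by lia.
rewrite addr0; have [z|L0_gt0] := posnP L0; first by rewrite big_geq ?addr0//; lia.
have -> : (1 - L0 = 0)%N by lia.
by rewrite subn0 big_nat1 e0 addr0.
Qed.

(** Everything counted in [raised t] has arrived by period [t + L0], and nothing ordered otherwise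
    has; so the holding cost of that period depends on [raised t] and [L0 + 1] demands only. *)
Lemma arrived_inventory t : (0 < t)%N ->
  J (t + L0)%N + rho (t + L0 - L)%N + e (t + L0 - L0)%N - dm (t + L0)%N =
  raised t - \sum_(t <= i < (t + L0).+1) dm i.
Proof.
move=> t0; rewrite -inventoryS ?addn_gt0 ?t0//.
(* After [m] periods the two sums hold what is still in transit; they are empty at [m = L0 + 1]. *)
have H m : (m <= L0.+1)%N ->
   J (t + m)%N + \sum_(t + m - L0 <= k < t.+1) e k +
     \sum_(t + m - L <= k < t - n) rho k = raised t - \sum_(t <= i < t + m) dm i.
  elim: m => [_|m IH mL0].
    rewrite addn0 [in RHS]big_geq// subr0 /raised positionE subn0.
    by rewrite (big_nat_recr t (t - L0)) ?leq_subr//=; ring.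
  rewrite addnS inventoryS ?addn_gt0 ?t0// [in RHS](big_nat_recr (t + m) t) ?leq_addr//=.
  have h := IH (ltnW mL0).
  have h1 : e (t + m - L0)%N + \sum_((t + m).+1 - L0 <= k < t.+1) e k =
            \sum_(t + m - L0 <= k < t.+1) e k.
    by apply: window_pop => //; lia.
  have h2 : rho (t + m - L)%N + \sum_((t + m).+1 - L <= k < t - n) rho k =
            \sum_(t + m - L <= k < t - n) rho k.
    by apply: window_pop => //; lia.
  rewrite opprD addrA -h -h1 -h2; ring.
have := H L0.+1 (leqnn _); rewrite [X in _ + X + _]big_geq; last by lia.
by rewrite [X in _ + _ + X]big_geq ?addr0 ?addnS//; lia.
Qed.

Lemma orders_ge0 t : admissible f -> 0 <= rho t /\ 0 <= e t.
Proof.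
case: t => [|t] af; first by rewrite rho0 e0.
have [_ /(_ (pipeline L L0 rho t.+1, expedited_position L L0 (J t.+1) rho e t.+1))] :=
  af t.+1 isT.
by rewrite -(ordersE f x dm L0L)//.
Qed.

End PolicyPath.

Section PolicyProcess.
Context {d} {Om : measurableType d} {R : realType} (P : probability Om R).
Context (dem dem' : int -> {RV P >-> R}) (Ghat : {RV P >-> nat}).
Local Notation adapted := (adapted dem dem' Ghat).
Variables (L L0 : nat).
Hypothesis L0L : (L0.+1 < L)%N.
Variable f : policy (R := R) L L0.
Hypothesis af : admissible f.

Local Notation x0 := (initial_inventory dem' Ghat).
Local Notation dm w := (fun s => dem s%:Z w).
Definition invP t w := inventory f (x0 w) (dm w) t.
Definition rhoP t w := regular_order f (x0 w) (dm w) t.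
Definition expP t w := express_order f (x0 w) (dm w) t.
Definition raisedP t w := raised f (x0 w) (dm w) t.

Lemma adapted_sum (t : nat) (s : seq nat) (F : nat -> Om -> R) :
  (forall i, i \in s -> adapted t (F i)) -> adapted t (fun w => \sum_(i <- s) F i w).
Proof.
elim: s => [|i s IH] aF.
  rewrite (_ : (fun w => _) = fun=> 0); first exact: adapted_cst.
  by apply/funext => w; rewrite big_nil.
rewrite (_ : (fun w => _) = fun w => F i w + \sum_(j <- s) F j w).
  apply: adaptedD; first by apply: aF; rewrite mem_head.
  by apply: IH => j js; apply: aF; rewrite inE js orbT.
by apply/funext => w; rewrite big_cons.
Qed.

Lemma rhoP0 : rhoP 0 = fun=> 0.
Proof. by apply/funext => w; have [] := orders0 f (x0 w) (dm w). Qed.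

Lemma expP0 : expP 0 = fun=> 0.
Proof. by apply/funext => w; have [_] := orders0 f (x0 w) (dm w). Qed.

Lemma policy_adapted t : (0 < t)%N ->
  [/\ adapted t (invP t), adapted t (rhoP t) & adapted t (expP t)].
Proof.
elim/ltn_ind: t => -[//|t] IH _.
have a0 u k : (k <= t)%N -> (k <= u)%N -> adapted u (rhoP k) /\ adapted u (expP k).
  case: k => [|k] kt ku; last first.
    by have [_ ? ?] := IH k.+1 kt isT; split; apply: adapted_le ku _.
  by rewrite rhoP0 expP0; split; exact: adapted_cst.
have aJ : adapted t.+1 (invP t.+1).
  case: (posnP t) => [->|t0].
    exact: adapted_initial_inventory.
  rewrite (_ : invP t.+1 = fun w => invP t w + rhoP (t - L)%N w + expP (t - L0)%N w - dem t%:Z w).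
    apply: adaptedB; last exact: adapted_dem.
    apply: adaptedD; last by apply: (a0 _ _ _ _).2; lia.
    apply: adaptedD; last by apply: (a0 _ _ _ _).1; lia.
    by have [? _ _] := IH t (ltnSn t) t0; apply: adapted_le (leqnSn t) _.
  by apply/funext => w; rewrite /invP inventoryS.
pose pos w := expedited_position L L0 (invP t.+1 w) (rhoP ^~ w) (expP ^~ w) t.+1.
have apos : adapted t.+1 pos.
  apply: adaptedD; last first.
    by apply: adapted_sum => i; rewrite mem_index_iota => ?; apply: (a0 _ _ _ _).1; lia.
  apply: adaptedD => //.
  by apply: adapted_sum => i; rewrite mem_index_iota => ?; apply: (a0 _ _ _ _).2; lia.
pose pip w : (L - L0.+1).-tuple R := pipeline L L0 (rhoP ^~ w) t.+1.
have apip : adapted t.+1 pip.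
  apply/measurable_fun_tnthP => i; have iL := ltn_ord i.
  rewrite (_ : _ \o _ = rhoP (t.+1 + L0 + 1 + i - L)%N).
    by apply: (a0 _ _ _ _).1; lia.
  by apply/funext => w; rewrite /= tnth_mktuple.
have [mf _] := af (ltn0Sn t).
have aff : adapted t.+1 (fun w => f t.+1 (pip w, pos w)).
  apply: measurableT_comp mf _; exact: measurable_fun_pair.
have E w : (rhoP t.+1 w, expP t.+1 w) = f t.+1 (pip w, pos w) by rewrite /rhoP /expP ordersE.
split => //.
- rewrite (_ : rhoP t.+1 = fun w => (f t.+1 (pip w, pos w)).1).
    exact: measurableT_comp measurable_fst aff.
  by apply/funext => w; rewrite -E.
- rewrite (_ : expP t.+1 = fun w => (f t.+1 (pip w, pos w)).2).
    exact: measurableT_comp measurable_snd aff.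
  by apply/funext => w; rewrite -E.
Qed.

Lemma rhoP_adapted t u : (t <= u)%N -> adapted u (rhoP t).
Proof.
case: t => [_|t tu]; last by have [_ ? _] := policy_adapted (ltn0Sn t); apply: adapted_le tu _.
by rewrite rhoP0; exact: adapted_cst.
Qed.

Lemma expP_adapted t u : (t <= u)%N -> adapted u (expP t).
Proof.
case: t => [_|t tu]; last by have [_ _ ?] := policy_adapted (ltn0Sn t); apply: adapted_le tu _.
by rewrite expP0; exact: adapted_cst.
Qed.

Lemma raisedP_adapted t : (0 < t)%N -> adapted t (raisedP t).
Proof.
move=> t0; have [aJ arho aexp] := policy_adapted t0.
apply: adaptedD aexp; apply: adaptedD; last first.
  by apply: adapted_sum => i; rewrite mem_index_iota => ?; apply: rhoP_adapted; lia.
apply: adaptedD => //.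
by apply: adapted_sum => i; rewrite mem_index_iota => ?; apply: expP_adapted; lia.
Qed.

Lemma raisedPS t w : (0 < t)%N ->
  raisedP t.+1 w = raisedP t w + rhoP (t - (L - L0.+1))%N w - dem t%:Z w + expP t.+1 w.
Proof. by move=> t0; rewrite /raisedP raisedS. Qed.

Lemma rhoP_ge0 t w : 0 <= rhoP t w.
Proof. by have [] := @orders_ge0 _ _ _ L0L f (x0 w) (dm w) t af. Qed.

Lemma expP_ge0 t w : 0 <= expP t w.
Proof. by have [] := @orders_ge0 _ _ _ L0L f (x0 w) (dm w) t af. Qed.

End PolicyProcess.

(** * Averaging over windows *)

Section NatSums.
Context {R : realType}.
Implicit Type F : nat -> R.

Lemma sum_addn (V : nmodType) (H : nat -> V) m j :
  \sum_(1 <= s < m.+1) H (s + j)%N = \sum_(j.+1 <= t < (m + j).+1) H t.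
Proof.
elim: m => [|m IH]; first by rewrite !big_geq.
rewrite addSn (big_nat_recr m.+1 1)//= IH (big_nat_recr (m + j).+1 j.+1)//=.
by rewrite ltnS leq_addl.
Qed.

Lemma ler_sum_nat_sub F a b a' b' : (forall t, 0 <= F t) ->
  (a' <= a)%N -> (b <= b')%N ->
  \sum_(a <= t < b) F t <= \sum_(a' <= t < b') F t.
Proof.
move=> F0 aa bb; case: (leqP b a) => ab.
  by rewrite big_geq// sumr_ge0.
rewrite [leRHS](big_cat_nat (n := b))//=; last exact: leq_trans aa (ltnW ab).
rewrite [in leRHS](big_cat_nat (n := a))//=; last exact: ltnW.
have h1 : 0 <= \sum_(a' <= t < a) F t by apply: sumr_ge0.
have h2 : 0 <= \sum_(b <= t < b') F t by apply: sumr_ge0.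
lra.
Qed.

End NatSums.

(* In period t: Ee, Erho are the expected express and regular orders, EZ the
   expected position after ordering, Eg the expected holding and backorder cost;
   n is the delay between placing a regular order and its entering the position.
   phi i bounds the cost Eg at the constant regular rate i * Delta, and p i j are
   the prices of deviating from that rate. *)
Section WindowAveraging.
Context {R : realType}.
Variables (c mu C0 e Delta kap K : R) (n M I L0 T0 : nat).
Variables (Ee EZ Eg Erho : nat -> R) (phi : nat -> R) (p : nat -> nat -> R).
Hypothesis (c_gt0 : 0 < c) (e_gt0 : 0 < e) (Delta_gt0 : 0 < Delta) (mu_ge0 : 0 <= mu).
Hypothesis kap_ge0 : 0 <= kap.
Hypothesis cDelta : c * Delta <= e / 4.
Hypothesis I_gt0 : (0 < I)%N.
Hypothesis I_mu : mu <= I%:R * Delta.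
Hypothesis Mn : (M <= n)%N.
Hypothesis Ee_ge0 : forall t, 0 <= Ee t.
Hypothesis Eg_ge0 : forall t, 0 <= Eg t.
Hypothesis Erho_ge0 : forall t, 0 <= Erho t.
Hypothesis Erho0 : Erho 0 = 0.
Hypothesis EZS : forall t, (0 < t)%N -> EZ t.+1 = EZ t + Erho (t - n)%N - mu + Ee t.+1.
Hypothesis EZ_le : forall t, (0 < t)%N -> `|EZ t| <= kap * Eg t + K.
Hypothesis p_ge0 : forall i j, 0 <= p i j.
Hypothesis phi_ge : forall i, (i < I)%N -> C0 - e / 4 <= phi i + c * (mu - i%:R * Delta).
Hypothesis window : forall i s, (i < I)%N -> (0 < s)%N ->
  M.+1%:R * phi i + \sum_(j < M) p i j * (Erho (s + j - n)%N - i%:R * Delta) <=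
  \sum_(j < M.+1) Eg (s + j)%N.
Hypothesis cost_le : forall T, (T0 <= T)%N ->
  \sum_(1 <= s < T.+1) (c * Ee s + Eg s) <= (C0 - e) * (T + L0)%:R.

Lemma grid_point rho : 0 <= rho <= mu ->
  exists2 i, (i < I)%N & i%:R * Delta <= rho <= i.+1%:R * Delta.
Proof.
move=> /andP[rho0 rhomu]; have := le_trans rhomu I_mu.
elim: I I_gt0 => [//|k IH] _ rhok.
case: (posnP k) => [k0|k_gt0].
  by exists k => //; rewrite rhok k0 mul0r rho0.
case: (leP rho (k%:R * Delta)) => [/IH|/ltW rk].
  by move=> /(_ k_gt0)[i ik ?]; exists i => //; exact: ltnW.
by exists k => //; rewrite rk.
Qed.

(** The balance over periods 1 to [m] involves [EZ m], controlled only through [Eg m]. Costs above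
    the threshold at all late periods would contradict the average bound [C0 - e]. *)
Lemma cheap_period m0 : exists2 m, (m0 <= m)%N & Eg m <= `|C0 - e| + 1.
Proof.
apply: contrapT => H; set B := `|C0 - e| + 1 in H.
have B0 : 0 < B by rewrite ltr_wpDl.
have big m : (m0 <= m)%N -> B < Eg m.
  by move=> mm0; rewrite ltNge; apply/negP => ?; apply: H; exists m.
have [k hk] := exists_natr (B * m0.+1%:R + `|C0 - e| * (m0 + L0)%:R).
pose T := (m0 + maxn k T0)%N.
have TT0 : (T0 <= T)%N := leq_trans (leq_maxr k T0) (leq_addl _ _).
have m0T : (m0 <= T)%N := leq_addr _ _.
have := cost_le TT0.
have h1 : \sum_(1 <= s < T.+1) (c * Ee s + Eg s) >= B * (T.+1%:R - m0.+1%:R).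
  rewrite (big_cat_nat (n := m0.+1)) //=.
  have : 0 <= \sum_(1 <= s < m0.+1) (c * Ee s + Eg s).
    by apply: sumr_ge0 => s _; rewrite addr_ge0// mulr_ge0// ltW.
  have : \sum_(m0.+1 <= s < T.+1) B <= \sum_(m0.+1 <= s < T.+1) (c * Ee s + Eg s).
    rewrite big_nat [leRHS]big_nat; apply: ler_sum => s /andP[m0s _].
    apply: le_trans (ltW (big s (ltnW m0s))) _.
    by rewrite lerDr mulr_ge0// ltW.
  have -> : \sum_(m0.+1 <= s < T.+1) B = B * (T.+1%:R - m0.+1%:R).
    by rewrite sumr_const_nat -natrB ?mulr_natr.
  by lra.
move=> h2; have h3 := le_trans h1 h2.
have h4 : (C0 - e) * (T + L0)%:R <= `|C0 - e| * (T + L0)%:R.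
  by apply: ler_wpM2r => //; exact: ler_norm.
have h5 := le_trans h3 h4; move: h5; rewrite /B.
have kT : k%:R <= T%:R - m0%:R :> R.
  by rewrite lerBrDr -natrD ler_nat addnC leq_add2l leq_maxl.
clearbody T; rewrite natrD -[T.+1%:R]natr1 -[m0.+1%:R]natr1.
move: hk; rewrite /B -[m0.+1%:R]natr1 natrD.
have C0' : 0 <= `|C0 - e| by [].
have m0' : 0 <= m0%:R :> R by [].
have l0' : 0 <= L0%:R :> R by [].
have qa := mulr_ge0 C0' m0'; lra.
Qed.

(** Up to boundary terms, the balance gives express orders of total mean [m * mu - Rm], and the
    windows give holding costs of at least [m * phi i] for a grid rate just below [Rm / m]. Together
    they cost about [(C0 - e / 2) * m], more than [cost_le] allows for large [m]. *)
Lemma window_averaging_absurd : False.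
Proof.
have mu0 := mu_ge0.
(* [K1] bounds [EZ] at the cheap period [m], [K2] both ends of the balance, [K3] the resulting loss
   in cost. [m1] makes [e / 4 * m] exceed [K3] plus the budget of the [M + L0] extra periods. *)
pose K1 := kap * (`|C0 - e| + 1) + K.
pose K2 := K1 + `|EZ 1|.
pose K3 := c * (2 * K2 + mu).
have [m1 hm1] := exists_natr (4 / e * (K3 + `|C0 - e| * (M + L0)%:R) + 1).
have [m mm Egm] := cheap_period (maxn (maxn m1 T0) 1).
have m1m : (m1 <= m)%N := leq_trans (leq_trans (leq_maxl m1 T0) (leq_maxl _ 1)) mm.
have T0m : (T0 <= m + M)%N :=
  leq_trans (leq_trans (leq_trans (leq_maxr m1 T0) (leq_maxl _ 1)) mm) (leq_addr _ _).
have m0 : (0 < m)%N := leq_trans (leq_maxr _ 1) mm.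
have EZm : `|EZ m| <= K1.
  by apply: le_trans (EZ_le m0) _; rewrite lerD2r; apply: ler_wpM2l.
pose Rm := \sum_(1 <= t < m) Erho (t - n)%N.
have tele k : (0 < k)%N -> EZ k = EZ 1 + \sum_(1 <= t < k) Erho (t - n)%N
    - k.-1%:R * mu + \sum_(1 <= t < k) Ee t.+1.
  elim: k => [//|[_ _|k IH _]]; first by rewrite !big_geq// mul0r subr0 !addr0.
  rewrite EZS// IH// !(big_nat_recr k.+1 1)//= -[k.+1%:R]natr1; ring.
have sumE k : (0 < k)%N -> \sum_(1 <= t < k.+1) Ee t = Ee 1 + \sum_(1 <= t < k) Ee t.+1.
  by move=> k0; rewrite big_ltn// big_add1.
have Rm0 : 0 <= Rm by apply: sumr_ge0.
have m_pos : 0 < m%:R :> R by rewrite ltr0n.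
have pm : m.-1%:R = m%:R - 1 :> R by rewrite -[in RHS](prednK m0) -natr1 addrK.
have teleM := tele m m0; rewrite -/Rm pm in teleM.
have se0 : 0 <= \sum_(1 <= t < m) Ee t.+1 by apply: sumr_ge0.
have a1 := ler_norm (EZ m); have a2 := ler_norm (EZ 1).
have a3 := lerNnormlW (lexx `|EZ m|); have a4 := lerNnormlW (lexx `|EZ 1|).
have Rm_le : Rm <= m%:R * mu + K2 by rewrite /K2; lra.
have se_ge : m%:R * mu - Rm - K2 - mu <= \sum_(1 <= t < m.+1) Ee t.
  by rewrite sumE//; have := Ee_ge0 1; rewrite /K2; lra.
(* [Rm / m] may exceed [mu] by a boundary term; hence the cut at [mu] and the [K2] in the upper
   bound. *)
have [i iI /andP[ri1 ri2]] : exists2 i, (i < I)%N &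
    i%:R * Delta * m%:R <= Rm <= (i.+1%:R * Delta) * m%:R + K2.
  have K20 : 0 <= K2 by rewrite /K2 addr_ge0//; exact: le_trans EZm.
  have [|i iI /andP[h1 h2]] := @grid_point (Num.min (Rm / m%:R) mu).
    by rewrite le_min divr_ge0 ?ler0n// mu0 ge_min lexx orbT.
  exists i => //; apply/andP; split.
    by rewrite -ler_pdivlMr//; apply: le_trans h1 _; rewrite ge_min lexx.
  move: h2; case: (leP (Rm / m%:R) mu) => _ h2.
    by rewrite -[leLHS]addr0; apply: lerD => //; rewrite -ler_pdivrMr.
  by apply: le_trans Rm_le _; rewrite lerD2r mulrC ler_wpM2r// ltW.
set ri := i%:R * Delta in ri1.
have wsum : \sum_(1 <= s < m.+1) (M.+1%:R * phi i + \sum_(j < M) p i j * (Erho (s + j - n)%N - ri)) <=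
    \sum_(1 <= s < m.+1) \sum_(j < M.+1) Eg (s + j)%N.
  rewrite big_nat [leRHS]big_nat; apply: ler_sum => s /andP[s0 _]; exact: window.
(* Each period lies in at most [M + 1] windows. *)
have rhs_le : \sum_(1 <= s < m.+1) \sum_(j < M.+1) Eg (s + j)%N <=
    M.+1%:R * \sum_(1 <= t < (m + M).+1) Eg t.
  rewrite exchange_big/= mulr_natl -[X in _ *+ X]card_ord -sumr_const.
  apply: ler_sum => j _; have jM := ltn_ord j.
  rewrite sum_addn; apply: ler_sum_nat_sub => //.
  by rewrite ltnS leq_add2l -ltnS.
(* Shifting the sum by [j] loses only orders that would date from before period 1, as [j < M <= n].
   With nonnegative prices this makes every price term nonnegative. *)
have Rj j : (j < M)%N -> Rm <= \sum_(1 <= s < m.+1) Erho (s + j - n)%N.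
  move=> jM; rewrite (sum_addn (fun t => Erho (t - n)%N)).
  apply: (@le_trans _ _ (\sum_(1 <= t < (m + j).+1) Erho (t - n)%N)).
    by apply: ler_sum_nat_sub => //; exact: leqW (leq_addr j m).
  rewrite (big_cat_nat (n := j.+1))//=; last by rewrite ltnS leq_addl.
  rewrite big_nat big1 ?add0r// => t /andP[_ tj].
  have /eqP -> : (t - n == 0)%N; last exact: Erho0.
  by rewrite subn_eq0; apply: leq_trans (leq_trans (ltnW jM) Mn); rewrite -ltnS.
have lhs_ge : m%:R * (M.+1%:R * phi i) <=
    \sum_(1 <= s < m.+1) (M.+1%:R * phi i + \sum_(j < M) p i j * (Erho (s + j - n)%N - ri)).
  rewrite big_split/= sumr_const_nat subn1/= mulr_natl lerDl exchange_big/=.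
  apply: sumr_ge0 => j _; rewrite -mulr_sumr mulr_ge0// sumrB sumr_const_nat subn1/=.
  rewrite -[ri *+ m]mulr_natr subr_ge0; exact: le_trans ri1 (Rj j (ltn_ord j)).
have M1 : 0 < M.+1%:R :> R by rewrite ltr0n.
have phi_le : m%:R * phi i <= \sum_(1 <= t < (m + M).+1) Eg t.
  rewrite -(ler_pM2l M1) mulrCA.
  exact: le_trans lhs_ge (le_trans wsum rhs_le).
have Ee_le : \sum_(1 <= t < m.+1) Ee t <= \sum_(1 <= t < (m + M).+1) Ee t.
  by apply: ler_sum_nat_sub => //; rewrite ltnS leq_addr.
have := cost_le T0m; rewrite big_split/= -mulr_sumr.
have hE : c * (m%:R * mu - Rm - K2 - mu) <= c * \sum_(1 <= t < (m + M).+1) Ee t.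
  by rewrite ler_pM2l//; exact: le_trans Ee_le.
have hR : c * Rm <= c * (i.+1%:R * Delta * m%:R + K2) by rewrite ler_pM2l.
have hphi : m%:R * (C0 - e / 4) <= m%:R * (phi i + c * (mu - ri)).
  by rewrite ler_pM2l//; exact: phi_ge.
have hD : m%:R * (c * Delta) <= m%:R * (e / 4) by rewrite ler_pM2l.
have hT : (C0 - e) * (m + M + L0)%:R <= (C0 - e) * m%:R + `|C0 - e| * (M + L0)%:R.
  rewrite -addnA natrD mulrDr lerD2l; apply: ler_wpM2r => //; exact: ler_norm.
have hm : 4 / e * (K3 + `|C0 - e| * (M + L0)%:R) + 1 <= m%:R.
  by apply: le_trans hm1 _; rewrite ler_nat.
have hm' : K3 + `|C0 - e| * (M + L0)%:R < e / 4 * m%:R.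
  have e4 : 0 < e / 4 by rewrite divr_gt0.
  have : e / 4 * (4 / e * (K3 + `|C0 - e| * (M + L0)%:R) + 1) <= e / 4 * m%:R.
    by rewrite ler_pM2l.
  have -> : e / 4 * (4 / e * (K3 + `|C0 - e| * (M + L0)%:R) + 1) =
      K3 + `|C0 - e| * (M + L0)%:R + e / 4 by field; rewrite gt_eqF.
  lra.
move=> hc; have hc' := le_trans hc hT.
move: hR hphi; rewrite /ri -[i.+1%:R]natr1 => hR hphi.
have em : 0 < e * m%:R by rewrite mulr_gt0.
rewrite /K3 in hm'; lra.
Qed.

End WindowAveraging.

(** * Cost of a policy in terms of its raised position *)

Section PolicyCost.
Context {d} {Om : measurableType d} {R : realType} (P : probability Om R).
Context (D : {RV P >-> R}) (dem dem' : int -> {RV P >-> R}) (Ghat : {RV P >-> nat}).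
Hypothesis D_ge0 : forall w, 0 <= D w.
Hypothesis dem_law : forall t, distribution P (dem t) = distribution P D.
Hypothesis indep : mutually_independent P (source_sigma dem dem' Ghat).
Local Notation L1 X := (P.-integrable [set: Om] (EFin \o X)).
Local Notation Ex X := (Rintegral P [set: Om] X).
Hypothesis iD : L1 D.
Local Notation adapted := (adapted dem dem' Ghat).
Local Notation A := (avg P D).

Lemma Ex_cond1 t X f k : adapted t X -> L1 X -> lip k f ->
  Ex (fun w => f (X w - dem t%:Z w)) = Ex (fun w => A f (X w)).
Proof.
move=> aX iX kf.
have iXd : L1 (fun w => X w - dem t%:Z w).
  by apply: L1B => //; exact: (L1_dem dem_law iD).
have i1 : L1 (fun w => 1 * f (X w - dem t%:Z w)) by exact/L1Z/(L1_lip kf iXd).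
have a1 : adapted t (fun=> 1 : R) by exact: adapted_cst.
have := @Ex_cond _ _ _ _ _ _ _ _ dem_law indep iD t (fun=> 1) X f k a1 aX kf i1.
rewrite (eq_Ex P (Y := fun w => f (X w - dem t%:Z w))) => [->|w]; last by rewrite mul1r.
by apply: eq_Ex => w; rewrite mul1r.
Qed.

Lemma L1_sum_dem t u : L1 (fun w => \sum_(t <= i < u) dem i%:Z w).
Proof. by apply: L1_sum => i; exact: (L1_dem dem_law iD). Qed.

Lemma Ex_iter_avg t X m f k : adapted t X -> L1 X -> lip k f ->
  Ex (fun w => f (X w - \sum_(t <= i < t + m) dem i%:Z w)) = Ex (fun w => iter m A f (X w)).
Proof.
move=> aX iX; elim: m f => [|m IH] f kf.
  by apply: eq_Ex => w; rewrite addn0 big_geq// subr0.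
rewrite iterSr -IH; last exact: avg_lip.
rewrite -(@Ex_cond1 (t + m)%N _ _ k)//.
- apply: eq_Ex => w; rewrite addnS big_nat_recr/= ?leq_addr//.
  by rewrite opprD addrA.
- apply: adaptedB; first exact: adapted_le (leq_addr _ _) aX.
  apply: adapted_sum => i; rewrite mem_index_iota => /andP[_ i1].
  exact: adapted_dem.
- by apply: L1B => //; exact: L1_sum_dem.
Qed.

Variables (h b c : R) (L L0 : nat).
Hypothesis (h_gt0 : 0 < h) (b_gt0 : 0 < b) (c_gt0 : 0 < c).
Hypothesis L0L : (L0.+1 < L)%N.
Variable f : policy (R := R) L L0.
Hypothesis af : admissible f.
Local Notation x0 := (initial_inventory dem' Ghat).
Local Notation dm w := (fun s => dem s%:Z w).
Local Notation G := (holding_backorder h b).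
Local Notation rho := (rhoP dem dem' Ghat f).
Local Notation ord := (expP dem dem' Ghat f).
Local Notation raised := (raisedP dem dem' Ghat f).

(** The expected holding and backorder cost that a raised position incurs once [L0 + 1] demands have
    been met. *)
Definition gcost : R -> R := iter L0.+1 A G.

Let G_lip : lip (h + b) G.
Proof. by apply: holding_backorder_lip; exact: ltW. Qed.

Lemma gcost_lip : lip (h + b) gcost.
Proof. exact: iter_avg_lip. Qed.

Lemma G_ge0 y : 0 <= G y.
Proof.
by rewrite /holding_backorder addr_ge0// mulr_ge0 ?(ltW h_gt0) ?(ltW b_gt0)// le_max lexx orbT.
Qed.

Lemma norm_le_G y : `|y| <= (h^-1 + b^-1) * G y.
Proof.
have [h1 h2] := holding_backorder_ge y (ltW h_gt0) (ltW b_gt0).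
have i1 : y <= h^-1 * G y by rewrite mulrC ler_pdivlMr// mulrC.
have i2 : - y <= b^-1 * G y by rewrite mulrC ler_pdivlMr// mulrC mulrN.
have j1 : 0 <= h^-1 * G y by rewrite mulr_ge0 ?G_ge0// invr_ge0 ltW.
have j2 : 0 <= b^-1 * G y by rewrite mulr_ge0 ?G_ge0// invr_ge0 ltW.
by rewrite mulrDl ler_norml; apply/andP; split; lra.
Qed.

Lemma gcost_ge0 y : 0 <= gcost y.
Proof. by apply: (iter_avg_ge0 D_ge0 iD _ G_lip); exact: G_ge0. Qed.

Lemma gcost_ge_back y : - (b * y) <= gcost y.
Proof.
have := @iter_avg_ge_affine _ _ _ _ _ D_ge0 iD _ G (- b) 0 L0.+1 G_lip _ y.
rewrite addr0 => H; apply: le_trans (H _).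
  rewrite mulNr mulNr mulrN opprK lerDl mulr_ge0// mulr_ge0 ?(ltW b_gt0)//.
  exact: Ex_ge0.
by move=> z; rewrite addr0 mulNr; have [] := holding_backorder_ge z (ltW h_gt0) (ltW b_gt0).
Qed.

Lemma gcost_ge_hold y : h * y - L0.+1%:R * (h * Ex D) <= gcost y.
Proof.
have := @iter_avg_ge_affine _ _ _ _ _ D_ge0 iD _ G h 0 L0.+1 G_lip _ y.
rewrite addr0; apply => z; rewrite addr0.
by have [] := holding_backorder_ge z (ltW h_gt0) (ltW b_gt0).
Qed.

Definition costP t w : R :=
  c * ord t w + G (raised t w - \sum_(t <= i < (t + L0).+1) dem i%:Z w).

Lemma period_costE t w : (0 < t)%N ->
  period_cost h b c f (x0 w) (dm w) (t + L0)%N = costP t w.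
Proof.
move=> t0; rewrite /period_cost arrived_inventory// addnK.
by [].
Qed.

Lemma costP_ge0 t w : 0 <= costP t w.
Proof. by rewrite addr_ge0 ?G_ge0// mulr_ge0 ?(ltW c_gt0)//; exact: expP_ge0. Qed.

Lemma costP_measurable t : (0 < t)%N -> measurable_fun [set: Om] (costP t).
Proof.
move=> t0; apply: measurable_funD.
  apply: measurable_funM => //; exact: adapted_measurable (expP_adapted L0L af (leqnn t)).
apply: measurableT_comp (lip_measurable G_lip) _.
apply: measurable_funB.
  exact: adapted_measurable (raisedP_adapted L0L af t0).
exact: L1_measurable (L1_sum_dem _ _).
Qed.

Lemma expected_costE t : (0 < t)%N ->
  expected_cost P dem dem' Ghat h b c f (t + L0)%N = (\int[P]_w (costP t w)%:E)%E.
Proof.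
move=> t0; rewrite /expected_cost unlock.
by apply: eq_integral => w _; rewrite period_costE.
Qed.

Lemma expected_cost_ge0 t : (0 < t)%N ->
  (0 <= expected_cost P dem dem' Ghat h b c f (t + L0)%N)%E.
Proof.
by move=> t0; rewrite expected_costE//; apply: integral_ge0 => w _; rewrite lee_fin costP_ge0.
Qed.

Lemma Ex_costP t : (0 < t)%N -> L1 (ord t) -> L1 (raised t) ->
  expected_cost P dem dem' Ghat h b c f (t + L0)%N =
  (c * Ex (ord t) + Ex (fun w => gcost (raised t w)))%:E.
Proof.
move=> t0 ie iz; rewrite expected_costE//.
have iy : L1 (fun w => raised t w - \sum_(t <= i < (t + L0).+1) dem i%:Z w).
  by apply: L1B => //; exact: L1_sum_dem.
rewrite Ex_EFin; last by apply: L1D; [exact: L1Z|exact: L1_lip G_lip iy].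
rewrite ExD; [|exact: L1Z|exact: L1_lip G_lip iy].
rewrite ExZ// -(@Ex_iter_avg t _ L0.+1 G (h + b)) ?addnS//.
exact: raisedP_adapted.
Qed.

(** Coercivity: the cost dominates [c] times the express order, and through [norm_le_G] a multiple
    of the absolute inventory level. *)
Lemma finite_cost t : (0 < t)%N ->
  (expected_cost P dem dem' Ghat h b c f (t + L0)%N < +oo)%E ->
  L1 (ord t) /\ L1 (raised t).
Proof.
move=> t0; rewrite expected_costE// => fin.
have ic : L1 (costP t).
  apply/integrableP; split; first exact/measurable_EFinP/costP_measurable.
  apply: le_lt_trans fin; rewrite le_eqVlt; apply/orP; left; apply/eqP.
  by apply: eq_integral => w _ /=; rewrite ger0_norm// costP_ge0.
have mG w := G_ge0 (raised t w - \sum_(t <= i < (t + L0).+1) dem i%:Z w).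
split.
  apply: (L1_le _ (L1Z c^-1 ic)).
    exact: adapted_measurable (expP_adapted L0L af (leqnn t)).
  move=> w; rewrite ger0_norm ?expP_ge0// mulrC ler_pdivlMr// mulrC.
  by rewrite lerDl.
have iy : L1 (fun w => raised t w - \sum_(t <= i < (t + L0).+1) dem i%:Z w).
  apply: (L1_le _ (L1Z (h^-1 + b^-1) ic)).
    apply: measurable_funB; last exact: L1_measurable (L1_sum_dem _ _).
    exact: adapted_measurable (raisedP_adapted L0L af t0).
  move=> w; apply: le_trans (norm_le_G _) _; apply: ler_wpM2l.
    by rewrite addr_ge0// invr_ge0 ltW.
  by rewrite lerDr mulr_ge0 ?(ltW c_gt0)//; exact: expP_ge0.
have := L1D iy (L1_sum_dem t (t + L0).+1).
by under eq_fun do rewrite subrK.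
Qed.

Lemma Ex_raised_le t : L1 (raised t) ->
  `|Ex (raised t)| <= (h^-1 + b^-1) * Ex (fun w => gcost (raised t w)) + L0.+1%:R * Ex D.
Proof.
move=> iz; have ig := L1_lip gcost_lip iz.
have D0 : 0 <= Ex D by exact: Ex_ge0.
have n0 : 0 <= L0.+1%:R :> R by [].
have nD := mulr_ge0 n0 D0.
rewrite -[X in _ + X](Ex_cst P) -ExZ// -ExD; [|exact: L1Z|exact: L1_cst].
apply: le_trans (Ex_norm iz) _; apply: Ex_le; first exact: L1_norm.
  by apply: L1D; [exact: L1Z|exact: L1_cst].
move=> w; set y := raised t w.
have h1 := gcost_ge_hold y; have h2 := gcost_ge_back y; have h3 := gcost_ge0 y.
have i1 : y - L0.+1%:R * Ex D <= h^-1 * gcost y.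
  by rewrite [leRHS]mulrC ler_pdivlMr//; move: h1; lra.
have i2 : - y <= b^-1 * gcost y by rewrite [leRHS]mulrC ler_pdivlMr//; move: h2; lra.
have j1 : 0 <= h^-1 * gcost y by rewrite mulr_ge0// invr_ge0 ltW.
have j2 : 0 <= b^-1 * gcost y by rewrite mulr_ge0// invr_ge0 ltW.
by rewrite mulrDl ler_norml; apply/andP; split; lra.
Qed.

End PolicyCost.

(** * Lower bound for every policy *)

Lemma limn_esup_lt {R : realType} (u : nat -> \bar R) (x : \bar R) :
  (limn_esup u < x)%E -> exists N : nat, forall n, (N <= n)%N -> (u n < x)%E.
Proof.
rewrite /limn_esup /limf_esup => /ereal_inf_lt[_ [V [N _ NV] <-] Vx].
exists N => n Nn; apply: le_lt_trans Vx; apply: ereal_sup_ubound.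
by exists n => //; exact: NV.
Qed.

Section LowerBound.
Context {d} {Om : measurableType d} {R : realType} (P : probability Om R).
Context (D : {RV P >-> R}) (dem dem' : int -> {RV P >-> R}) (Ghat : {RV P >-> nat}).
Hypothesis D_ge0 : forall w, 0 <= D w.
Hypothesis dem_law : forall t, distribution P (dem t) = distribution P D.
Hypothesis indep : mutually_independent P (source_sigma dem dem' Ghat).
Local Notation L1 X := (P.-integrable [set: Om] (EFin \o X)).
Local Notation Ex X := (Rintegral P [set: Om] X).
Hypothesis iD : L1 D.
Local Notation adapted := (adapted dem dem' Ghat).
Local Notation A := (avg P D).
Variables (h b c C0 : R) (L0 : nat).
Hypothesis (h_gt0 : 0 < h) (b_gt0 : 0 < b) (c_gt0 : 0 < c).
Local Notation mu := (Ex D).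
Hypothesis mu_gt0 : 0 < mu.
Local Notation g := (gcost D h b L0).
Hypothesis C0_le : forall (r s : R), 0 <= r -> r < mu ->
  C0 <= c * (mu - r) + limn (fun j => iter j (lindley P D r) (fun x => g (s + x)) 0).

Let h0 : 0 <= h := ltW h_gt0.
Let b0 : 0 <= b := ltW b_gt0.
Let g_lip : lip (h + b) g := gcost_lip iD L0 h_gt0 b_gt0.

(** [M0] and the prices are obtained before [s], [Z] and [rho], with no lead time or policy in
    sight. Half of [e] pays for the smoothing, half for the length of the window. *)
Lemma window_bound (r e : R) : 0 <= r -> r < mu -> 0 < e ->
  exists M0 : nat, forall M, (M0 <= M)%N -> exists p : nat -> R,
    (forall j, 0 <= p j) /\ forall s Z rho,
    (forall j, (j <= M)%N -> adapted (s + j) (Z j) /\ L1 (Z j)) ->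
    (forall j, (j < M)%N -> adapted s (rho j) /\ L1 (rho j)) ->
    (forall j w, (j < M)%N -> Z j w + rho j w - dem (s + j)%:Z w <= Z j.+1 w) ->
    M.+1%:R * (C0 - c * (mu - r) - e) + \sum_(j < M) p j * (Ex (rho j) - r) <=
    \sum_(j < M.+1) Ex (fun w => g (Z j w)).
Proof.
move=> r0 rmu e0; have e2 : 0 < e / 2 by rewrite divr_gt0.
have hb2 : 0 < (h + b) ^+ 2 by rewrite exprn_gt0// addr_gt0.
pose delta := e / 2 / (h + b) ^+ 2; have d0 : 0 < delta by rewrite divr_gt0.
have epsE : (h + b) ^+ 2 * delta = e / 2 by rewrite mulrC divfK// gt_eqF.
pose gam := iter L0.+1 A (clamp h b delta).
have cl := clamp_lip h b d0.
have gam_lip : lip delta^-1 gam by exact: iter_avg_lip.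
have gam_nd : ndecr gam by exact: (iter_avg_ndecr iD L0.+1 cl (clamp_ndecr h b d0)).
have gam_bd y : `|gam y| <= h + b.
  apply: (iter_avg_bound iD L0.+1 cl) => z.
  have /andP[c1 c2] := clamp_bound delta z h0 b0.
  rewrite ler_norml; apply/andP; split.
    by apply: le_trans c1; rewrite lerN2 lerDr.
  by apply: le_trans c2 _; rewrite lerDl.
have g_gam : subgrad (e / 2) g gam.
  apply: (iter_avg_subgrad iD L0.+1 (holding_backorder_lip h0 b0) cl) => z w.
  by rewrite -epsE; exact: clamp_subgrad.
have g0 := gcost_ge0 D_ge0 iD L0 h_gt0 b_gt0 0.
have K0 : 0 <= L0.+1%:R * (h * mu) by rewrite mulr_ge0// mulr_ge0// ltW.
(* Otherwise the subgradient inequality at a large [w] would keep [g w] below [g 0 + e / 2], against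
   its linear growth. *)
have gam_pos : exists z, 0 < gam z.
  apply: contrapT => /forallNP H.
  pose w := (g 0 + L0.+1%:R * (h * mu) + e / 2 + 1) / h.
  have w0 : 0 <= w by rewrite divr_ge0//; lra.
  have hw : h * w = g 0 + L0.+1%:R * (h * mu) + e / 2 + 1.
    by rewrite mulrC divfK// gt_eqF.
  have h1 := g_gam 0 w; have h2 := gcost_ge_hold D_ge0 iD L0 h_gt0 b_gt0 w.
  have : gam w <= 0 by rewrite leNgt; apply/negP; exact: H.
  move=> gw; have : 0 <= (- gam w) * w by rewrite mulr_ge0// oppr_ge0.
  lra.
have gam_neg : exists z, gam z < 0.
  apply: contrapT => /forallNP H.
  pose w := (g 0 + e / 2 + 1) / b.
  have w0 : 0 <= w by rewrite divr_ge0//; lra.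
  have bw : b * w = g 0 + e / 2 + 1 by rewrite mulrC divfK// gt_eqF.
  have h1 := g_gam 0 (- w); have h2 := gcost_ge_back D_ge0 iD L0 h_gt0 b_gt0 (- w).
  have : 0 <= gam (- w) by rewrite leNgt; apply/negP; exact: H.
  move=> gw; have : 0 <= gam (- w) * w by rewrite mulr_ge0.
  lra.
have [S HS] := base_stock_levels r D_ge0 iD gam_lip gam_nd gam_pos gam_neg.
have S_zero k := (HS k).1; have S_nincr k := (HS k).2.
have C0r s : C0 - c * (mu - r) <= limn (fun j => iter j (lindley P D r) (fun x => g (s + x)) 0).
  by have := @C0_le r s r0 rmu; lra.
have [M0 HM0] := refcost_ge D_ge0 dem_law indep iD r0 rmu g_lip b_gt0
  (gcost_ge_back D_ge0 iD L0 h_gt0 b_gt0) S_nincr C0r e2.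
exists M0 => M M0M; exists (price D r gam S M); split; first exact: price_ge0.
move=> s Z rho HZ Hrho Zstep.
have V := verification dem_law indep iD g_lip gam_lip gam_nd gam_bd g_gam S_zero
  HZ Hrho Zstep.
apply: le_trans V; rewrite lerD2r; have := HM0 M s M0M; lra.
Qed.

Lemma long_run_cost_ge (e : R) : 0 < e -> exists Lmin : nat, forall L (f : policy (R := R) L L0),
  (Lmin <= L)%N -> (L0.+1 < L)%N -> admissible f ->
  ((C0 - e)%:E <= long_run_cost P dem dem' Ghat h b c f)%E.
Proof.
move=> e0; have e4 : 0 < e / 4 by rewrite divr_gt0.
pose Delta := e / 4 / c; have Delta0 : 0 < Delta by rewrite divr_gt0.
have cDelta : c * Delta <= e / 4 by rewrite mulrC divfK// gt_eqF.
have exI : exists I, mu <= I%:R * Delta.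
  have [I hI] := exists_natr (mu / Delta); exists I.
  by rewrite -ler_pdivrMr.
pose I := ex_minn exI.
have I_mu : mu <= I%:R * Delta by rewrite /I; case: ex_minnP.
have I_min i : (i < I)%N -> i%:R * Delta < mu.
  rewrite /I; case: ex_minnP => k _ kmin ik; rewrite ltNge; apply/negP => /kmin.
  by rewrite leqNgt ik.
have I_gt0 : (0 < I)%N.
  by rewrite lt0n; apply/eqP => I0; move: I_mu; rewrite I0 mul0r leNgt mu_gt0.
have grid i : exists M0 : nat, (i < I)%N -> forall M, (M0 <= M)%N -> exists p : nat -> R,
    (forall j, 0 <= p j) /\ forall s Z rho,
    (forall j, (j <= M)%N -> adapted (s + j) (Z j) /\ L1 (Z j)) ->
    (forall j, (j < M)%N -> adapted s (rho j) /\ L1 (rho j)) ->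
    (forall j w, (j < M)%N -> Z j w + rho j w - dem (s + j)%:Z w <= Z j.+1 w) ->
    M.+1%:R * (C0 - c * (mu - i%:R * Delta) - e / 4) +
      \sum_(j < M) p j * (Ex (rho j) - i%:R * Delta) <=
    \sum_(j < M.+1) Ex (fun w => g (Z j w)).
  case: (ltnP i I) => iI; last by exists 0%N.
  have [|M0 HM0] := window_bound _ (I_min i iI) e4.
    by rewrite mulr_ge0// ltW.
  by exists M0.
have [M0 HM0] := choice grid.
(* The grid is finite, so one window length serves all its rates. *)
pose M := (\max_(i < I) M0 i)%N.
have M0M i : (i < I)%N -> (M0 i <= M)%N.
  by move=> iI; exact: (leq_bigmax (Ordinal iI)).
have grid' i : exists p : nat -> R, (forall j, 0 <= p j) /\ ((i < I)%N -> forall s Z rho,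
    (forall j, (j <= M)%N -> adapted (s + j) (Z j) /\ L1 (Z j)) ->
    (forall j, (j < M)%N -> adapted s (rho j) /\ L1 (rho j)) ->
    (forall j w, (j < M)%N -> Z j w + rho j w - dem (s + j)%:Z w <= Z j.+1 w) ->
    M.+1%:R * (C0 - c * (mu - i%:R * Delta) - e / 4) +
      \sum_(j < M) p j * (Ex (rho j) - i%:R * Delta) <=
    \sum_(j < M.+1) Ex (fun w => g (Z j w))).
  case: (ltnP i I) => iI; last by exists (fun=> 0).
  by have [p [p0 Hp]] := HM0 i iI M (M0M i iI); exists p.
have [p Hp] := choice grid'.
(* This threshold gives [M <= n]: orders entering during a window were placed before it starts. *)
exists (M + L0.+1)%N => L f LM L0L af.
rewrite leNgt; apply/negP => /limn_esup_lt[T0 HT0].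
pose n := (L - L0.+1)%N.
have Mn : (M <= n)%N by rewrite -(addnK L0.+1 M) leq_sub2r.
pose ec := expected_cost P dem dem' Ghat h b c f.
pose rho := rhoP dem dem' Ghat f.
pose ord := expP dem dem' Ghat f.
pose Z := raisedP dem dem' Ghat f.
have ec0 t : (0 < t)%N -> (0 <= ec (t + L0)%N)%E.
  exact: expected_cost_ge0.
have sumec T : (\sum_(L0.+1 <= t < (T + L0).+1) ec t = \sum_(1 <= s < T.+1) ec (s + L0)%N)%E.
  by rewrite (sum_addn ec).
have sum_lt T : (T0 <= T + L0)%N -> (0 < T + L0)%N ->
    (\sum_(1 <= s < T.+1) ec (s + L0)%N < ((C0 - e) * (T + L0)%:R)%:E)%E.
  move=> T0T TL0; have := HT0 _ T0T; rewrite sumec.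
  by rewrite muleC lte_pdivrMr ?ltr0n// -EFinM.
(* A nonnegative term of the finite partial sum at horizon [t + T0]. *)
have fin t : (0 < t)%N -> (ec (t + L0)%N < +oo)%E.
  move=> t0; have := @sum_lt (t + T0)%N _ _.
  rewrite (big_cat_nat (n := t))//=; last by rewrite leqW// leq_addr.
  rewrite [X in (_ + X)%E]big_ltn; last by rewrite ltnS leq_addr.
  have S1 : (0 <= \sum_(1 <= s < t) ec (s + L0)%N)%E.
    by rewrite big_nat; apply: sume_ge0 => s /andP[s0 _]; exact: ec0.
  have S2 : (0 <= \sum_(t.+1 <= s < (t + T0).+1) ec (s + L0)%N)%E.
    by rewrite big_nat; apply: sume_ge0 => s /andP[ts _]; apply: ec0; exact: leq_trans ts.
  move=> H; apply: le_lt_trans (_ : ec (t + L0)%N <= _)%E _; last first.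
    apply: lt_trans (H _ _) (ltry _).
    - by rewrite addnAC leq_addl.
    - by rewrite -addnA addn_gt0 t0.
  by apply: le_trans (leeDl _ S2) _; exact: leeDr.
have iord t : L1 (ord t).
  case: t => [|t]; last first.
    by have [] := finite_cost dem_law iD h_gt0 b_gt0 c_gt0 L0L af (ltn0Sn t) (fin _ (ltn0Sn t)).
  by rewrite /ord expP0; exact: L1_cst.
have iZ t : (0 < t)%N -> L1 (Z t).
  by move=> t0; have [] := finite_cost dem_law iD h_gt0 b_gt0 c_gt0 L0L af t0 (fin _ t0).
have idem t : L1 (dem t) := L1_dem dem_law iD t.
have ZS t w : (0 < t)%N -> Z t.+1 w = Z t w + rho (t - n)%N w - dem t%:Z w + ord t.+1 w.
  exact: raisedPS.
(* The cost does not control regular orders directly; the balance at the period in which the order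
   enters the position expresses it through integrable variables. *)
have irho k : L1 (rho k).
  case: k => [|k]; first by rewrite /rho rhoP0; exact: L1_cst.
  have i1 : L1 (fun w => Z (k.+1 + n).+1 w - Z (k.+1 + n)%N w + dem (k.+1 + n)%:Z w - ord (k.+1 + n).+1 w).
    by apply: L1B => //; apply: L1D => //; apply: L1B; exact: iZ.
  move: i1; congr (P.-integrable setT (EFin \o _)); apply/funext => w.
  rewrite ZS// addnK; ring.
pose Ee t := Ex (ord t); pose EZ t := Ex (Z t); pose Erho t := Ex (rho t).
pose Eg t := Ex (fun w => g (Z t w)).
have EZS t : (0 < t)%N -> EZ t.+1 = EZ t + Erho (t - n)%N - mu + Ee t.+1.
  move=> t0; have i1 := L1D (iZ t t0) (irho (t - n)%N).
  rewrite /EZ /Erho /Ee -ExD//; last exact: iZ.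
  rewrite -(Ex_dem dem_law iD t%:Z) -ExB// -ExD//; last exact: L1B.
  by apply: eq_Ex => w; rewrite ZS.
have cost_le T : (T0.+1 <= T)%N ->
    \sum_(1 <= s < T.+1) (c * Ee s + Eg s) <= (C0 - e) * (T + L0)%:R.
  move=> T0T; rewrite -lee_fin -sumEFin; apply/ltW.
  have := @sum_lt T _ _.
  rewrite big_nat [X in (_ -> _ -> X < _)%E -> _](_ : _ = \sum_(1 <= s < T.+1) (c * Ee s + Eg s)%:E)%E.
    by apply; [apply: leq_trans (ltnW T0T) (leq_addr _ _)|rewrite addn_gt0 (leq_trans _ T0T)].
  rewrite [RHS]big_nat; apply: eq_bigr => s /andP[s0 _].
  rewrite /ec (Ex_costP dem_law indep iD c h_gt0 b_gt0 L0L af s0)//.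
  exact: iZ.
apply: (@window_averaging_absurd R c mu C0 e Delta (h^-1 + b^-1) (L0.+1%:R * mu)
  n M I L0 T0.+1 Ee EZ Eg Erho
  (fun i => C0 - c * (mu - i%:R * Delta) - e / 4) p) => //.
- exact: ltW.
- by rewrite addr_ge0// invr_ge0 ltW.
- by move=> t; apply: Ex_ge0 => w; exact: expP_ge0.
- by move=> t; apply: Ex_ge0 => w; exact: gcost_ge0.
- by move=> t; apply: Ex_ge0 => w; exact: rhoP_ge0.
- by rewrite /Erho /rho rhoP0 Ex_cst.
- move=> t t0; exact: (Ex_raised_le D_ge0 iD h_gt0 b_gt0 (iZ t t0)).
- by move=> i j; exact: (Hp i).1.
- by move=> i _; lra.
move=> i s iI s0.
apply: ((Hp i).2 iI s (fun j => Z (s + j)%N) (fun j => rho (s + j - n)%N)).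
- move=> j jM; split; last by apply: iZ; rewrite addn_gt0 s0.
  by apply: raisedP_adapted => //; rewrite addn_gt0 s0.
- move=> j jM; split; last exact: irho.
  apply: rhoP_adapted => //; rewrite leq_subLR addnC leq_add2r.
  exact: leq_trans (ltnW jM) Mn.
- move=> j w jM; rewrite addnS ZS ?addn_gt0 ?s0// lerDl; exact: expP_ge0.
Qed.

End LowerBound.

(** * Cost of the TBS policies *)

Section InitialInventory.
Context {d} {Om : measurableType d} {R : realType} (P : probability Om R).
Context (D : {RV P >-> R}) (dem dem' : int -> {RV P >-> R}) (Ghat : {RV P >-> nat}).
Hypothesis D_ge0 : forall w, 0 <= D w.
Hypothesis dem'_law : forall t, distribution P (dem' t) = distribution P D.
Hypothesis Ghat_law : forall k : nat, (0 < k)%N -> P (Ghat @^-1` [set k]) = ((2 ^- k)%:E)%E.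
Hypothesis indep : mutually_independent P (source_sigma dem dem' Ghat).
Local Notation L1 X := (P.-integrable [set: Om] (EFin \o X)).
Local Notation Ex X := (Rintegral P [set: Om] X).
Hypothesis iD : L1 D.
Local Notation x0 := (initial_inventory dem' Ghat).

Let mG (B : set nat) : measurable (Ghat @^-1` B).
Proof. by rewrite -[X in measurable X]setTI; apply: measurable_funPT. Qed.

Lemma Ghat_between i :
  P (Ghat @^-1` [set k | (0 < k <= i)%N]) = (1 - 2 ^- i)%:E.
Proof.
elim: i => [|i IH].
  rewrite (_ : [set k | _] = set0) ?preimage_set0 ?measure0 ?expr0 ?invr1 ?subrr//.
  by apply/seteqP; split => k //= /andP[]; case: k.
rewrite (_ : [set k | _] = [set k | (0 < k <= i)%N] `|` [set i.+1]); last first.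
  apply/seteqP; split => k /=.
    by rewrite [(k <= i.+1)%N]leq_eqVlt => /andP[k0 /orP[/eqP ->|ki]]; [right|left; rewrite k0].
  by move=> [/andP[k0 /leqW ->]|->]; rewrite ?k0//= leqnn.
rewrite preimage_setU measureU//; last first.
  apply/seteqP; split => w //= [/andP[_ wi] wi']; move: wi; rewrite wi'.
  by rewrite ltnn.
have -> : (1 - 2 ^- i.+1)%:E = ((1 - 2 ^- i)%:E + (2 ^- i.+1)%:E)%E :> \bar R.
  rewrite -EFinD; congr EFin; rewrite exprS invfM.
  set x := (2 ^+ i)^-1; lra.
by congr (_ + _)%E; [exact: IH|exact: Ghat_law].
Qed.

(** The tail lies in the complement of [0 < Ghat <= i], whose probability is a finite sum. *)
Lemma Ghat_tail i : (P (Ghat @^-1` [set k | (i < k)%N]) <= (2 ^- i)%:E)%E.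
Proof.
apply: (@le_trans _ _ (P (~` (Ghat @^-1` [set k | (0 < k <= i)%N])))).
  apply: le_measure; rewrite ?inE//; first exact: measurableC.
  by move=> w /= iw /andP[_]; rewrite leqNgt iw.
rewrite probability_setC//.
have -> : P (Ghat @^-1` [set k | (0 < k <= i)%N]) = (1 - 2 ^- i)%:E := Ghat_between i.
by rewrite -EFinB lee_fin; lra.
Qed.

Lemma Ghat_dem'_indep i A B : measurable A -> measurable B ->
  P (Ghat @^-1` A `&` dem' i @^-1` B) = (P (Ghat @^-1` A) * P (dem' i @^-1` B))%E.
Proof.
move=> mA mB; set a := inr tt : int + int + unit; set b := inl (inr i) : int + int + unit.
pose H j := if j == a then Ghat @^-1` A else dem' i @^-1` B.
have := indep (J := [:: a; b]) (A := H).
have Ha : H a = Ghat @^-1` A by [].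
have Hb : H b = dem' i @^-1` B by [].
have hb : b \in [:: a; b] by rewrite !inE eqxx orbT.
rewrite !big_cons big_nil mule1 Ha Hb => <- //.
  congr (P _); apply/seteqP; split => [w [wA wB] j /=|w h].
    by rewrite !inE => /orP[/eqP ->|/eqP ->].
  by split; [exact: (h a (mem_head _ _))|exact: (h b hb)].
move=> j; rewrite !inE => /orP[/eqP ->|/eqP ->].
  by exists A => //; rewrite setTI.
by exists B => //; rewrite setTI.
Qed.

(** The bound is [Ex D] times [2 ^- n], written in the form that [epsilon_trick0] sums. *)
Lemma int_dem'_Ghat (n : nat) (s : int) :
  (\int[P]_w (`|dem' s w| * \1_(Ghat @^-1` [set k | (n < k)%N]) w)%:E
    <= (Ex D * 2 / (2 ^ n.+1)%:R)%:E)%E.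
Proof.
pose F (z : nat * R) := (`|z.2| * \1_[set k | (n < k)%N] z.1)%:E.
have mF : measurable_fun [set: nat * R] F.
  apply/measurable_EFinP; apply: measurable_funM.
    have mn : measurable_fun [set: R] (@Num.norm R R) by exact: normr_measurable.
    exact: measurableT_comp mn measurable_snd.
  have mi : measurable_fun [set: nat] (\1_[set k | (n < k)%N] : nat -> R) by [].
  exact: measurableT_comp mi measurable_fst.
have mGh : measurable_fun [set: Om] Ghat by [].
have := ge0_integral_indep_pair mGh (@Ghat_dem'_indep s) (dem'_law s) mF.
rewrite /F/= => ->; last by move=> z; rewrite lee_fin mulr_ge0.
have D0 : 0 <= Ex D by exact: Ex_ge0.
under eq_integral => w _.
  rewrite Ex_EFin; last first.
    apply: (L1_le _ iD); last first.
      move=> w'; rewrite normrM normr_id (ger0_norm (D_ge0 w')) ger0_norm//.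
      by rewrite -[leRHS]mulr1 ler_wpM2l// indicE lern1 leq_b1.
    by apply: measurable_funM => //; exact: measurableT_comp.
  rewrite (eq_Ex P (Y := fun w' => \1_[set k : nat | (n < k)%N] (Ghat w) * D w')); last first.
    by move=> w'; rewrite (ger0_norm (D_ge0 w')) mulrC.
  rewrite ExZ// mulrC EFinM.
  over.
have mI : measurable (Ghat @^-1` [set k | (n < k)%N]) by exact: mG.
have -> : (\int[P]_w ((Ex D)%:E * (\1_[set k : nat | (n < k)%N] (Ghat w))%:E) =
    (Ex D)%:E * P (Ghat @^-1` [set k | (n < k)%N]))%E.
  rewrite ge0_integralZl//.
    congr (_ * _)%E.
    by rewrite -[X in P X]setIT -integral_indic.
  have mi : measurable_fun [set: nat] (\1_[set k | (n < k)%N] : nat -> R) by [].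
  exact/measurable_EFinP/(measurableT_comp mi mGh).
rewrite -mulrA EFinM; apply: lee_wpmul2l; first by rewrite lee_fin.
apply: le_trans (Ghat_tail n) _.
by rewrite lee_fin natrX exprS invfM mulVKf.
Qed.

(** The random sum is dominated by the series of [dem'] weighted with the indicators of [n < Ghat];
    by independence the means decay geometrically. *)
Lemma initial_inventory_L1 : L1 x0.
Proof.
have mx0 : measurable_fun [set: Om] x0.
  exact: adapted_measurable (@adapted_initial_inventory _ _ _ _ dem dem' Ghat 0).
pose f (n : nat) w := (`|dem' (- n.+1%:Z) w| * \1_(Ghat @^-1` [set k | (n < k)%N]) w)%:E.
have mf n : measurable_fun [set: Om] (f n).
  apply/measurable_EFinP; apply: measurable_funM; first exact: measurableT_comp.
  exact: measurable_indic.
have f0 n w : [set: Om] w -> (0 <= f n w)%E by move=> _; rewrite lee_fin mulr_ge0.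
apply/integrableP; split.
  exact/measurable_EFinP.
have bnd : (\int[P]_w `|(x0 w)%:E| <= \int[P]_w \sum_(0 <= n <oo) f n w)%E.
  apply: ge0_le_integral => //.
  - by apply: measurableT_comp => //; exact/measurable_EFinP.
  - by apply: (@ge0_emeasurable_sum _ _ _ setT f xpredT) => // n w _ _; exact: f0.
  move=> w _; apply: le_trans (nneseries_lim_ge (Ghat w) _); last by move=> n _ _; exact: f0.
  rewrite /= sumEFin lee_fin /initial_inventory normrN.
  apply: le_trans (ler_norm_sum _ _ _) _.
  rewrite big_add1/= big_nat [leRHS]big_nat; apply: ler_sum => i /andP[_ iG].
  by rewrite indicE mem_set// mulr1.
apply: le_lt_trans bnd _; rewrite integral_nneseries//.
apply: (@le_lt_trans _ _ (Ex D * 2)%:E); last exact: ltry.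
have D2 : 0 <= Ex D * 2 by rewrite mulr_ge0//; exact: Ex_ge0.
apply: le_trans (epsilon_trick0 xpredT D2).
apply: lee_nneseries => n _; first by move=> _; apply: integral_ge0 => w _; exact: f0.
exact: int_dem'_Ghat.
Qed.

(** Only almost surely, since [dem'] shares the law of [D] but need not be nonnegative
    everywhere. *)
Lemma initial_inventory_le0 : {ae P, forall w, x0 w <= 0}.
Proof.
have : {ae P, forall w, forall n : nat, 0 <= dem' (- n%:Z) w}.
  apply: ae_foralln => n; set s := - n%:Z.
  have mN : measurable [set y : R | y < 0].
    by rewrite (_ : [set y | _] = `]-oo, 0[%classic)//; apply/seteqP; split => y /=; rewrite in_itv.
  exists (dem' s @^-1` [set y | y < 0]); split.
  - by rewrite -[X in measurable X]setTI; apply: measurable_funPT.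
  - have := congr1 (fun m : set R -> \bar R => m [set y | y < 0]) (dem'_law s).
    rewrite /distribution /pushforward /= => ->.
    rewrite (_ : _ @^-1` _ = set0) ?measure0//.
    by apply/seteqP; split => w //=; rewrite ltNge D_ge0.
  - by move=> w /= /negP; rewrite -ltNge.
apply: filterS => w Hw; rewrite /initial_inventory oppr_le0.
by apply: sumr_ge0.
Qed.

End InitialInventory.

Section CesaroLimits.
Context {R : realType}.
Variables (n L0 : nat) (F : nat -> R).

(** The first [n] periods, the shift by [L0] and the constant [K] vanish after division by [T]. *)
Lemma limn_esup_cesaro (l : R) :
  (forall e : R, 0 < e -> exists K, exists N : nat, forall k, (N <= k)%N ->
    `|F (n + k)%N - l * k%:R| <= e * k%:R + K) ->
  limn_esup (fun T : nat => (T%:R^-1)%:E * (F (T - L0)%N)%:E)%E = l%:E.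
Proof.
move=> H; apply: (cvg_limn_einf_sup _).2.
apply/fine_cvgP; split; first by near=> T; rewrite -EFinM.
apply/cvgrPdist_le => e e0 /=.
have e2 : 0 < e / 2 by rewrite divr_gt0.
have [K [N HK]] := H _ e2.
have [m hm] := exists_natr ((`|K| + `|l| * (n + L0)%:R) / (e / 2)).
exists (maxn m (N + n + L0).+1) => // T /=; rewrite geq_max => /andP[mT NT].
pose k := (T - L0 - n)%N.
have Tk : T = (n + k + L0)%N by rewrite /k; lia.
have Nk : (N <= k)%N by rewrite /k; lia.
have T0 : 0 < T%:R :> R by rewrite ltr0n (leq_ltn_trans _ NT).
have -> : (T - L0 = n + k)%N by rewrite Tk addnK.
rewrite -(ler_pM2l T0) -[X in X * _](gtr0_norm T0) -normrM mulrBr mulrA.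
rewrite mulfV ?gt_eqF// mul1r distrC.
have TR : T%:R = n%:R + k%:R + L0%:R :> R by rewrite Tk !natrD.
have -> : F (n + k)%N - T%:R * l = (F (n + k)%N - l * k%:R) - l * (n + L0)%:R.
  by rewrite TR natrD; ring.
apply: le_trans (ler_normB _ _) _; rewrite normrM normr_nat.
have h1 := HK k Nk.
have h2 : `|K| + `|l| * (n + L0)%:R <= e / 2 * T%:R.
  by rewrite [leRHS]mulrC -ler_pdivrMr//; apply: le_trans hm _; rewrite ler_nat.
have h3 : e / 2 * k%:R <= e / 2 * T%:R.
  by rewrite ler_pM2l// ler_nat Tk; lia.
have h4 := ler_norm K; lra.
Unshelve. all: by end_near. Qed.

Lemma limn_esup_cesaro_pinfty :
  (forall B, exists K, exists N : nat, forall k, (N <= k)%N ->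
    B * k%:R - K <= F (n + k)%N) ->
  limn_esup (fun T : nat => (T%:R^-1)%:E * (F (T - L0)%N)%:E)%E = +oo%E.
Proof.
move=> H; apply/eqP; rewrite -leye_eq leNgt; apply/negP => lt_oo.
have [x lt_x] : exists x : R, (limn_esup (fun T : nat => (T%:R^-1)%:E * (F (T - L0)%N)%:E) < x%:E)%E.
  case E : (limn_esup _) lt_oo => [y| |] // _.
  - by exists (y + 1); rewrite lte_fin ltrDl.
  - by exists 0; rewrite ltNyr.
have [N1 HN1] := limn_esup_lt lt_x.
have [K [N HK]] := H (`|x| + 1).
have [m hm] := exists_natr (K + `|x| * (n + L0)%:R).
pose k := (maxn N1 (maxn N m)).+1.
have N1k : (N1 <= k)%N by rewrite /k; lia.
have Nk : (N <= k)%N by rewrite /k; lia.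
have mk : (m < k)%N by rewrite /k; lia.
have := HN1 (n + k + L0)%N _; rewrite addnK => /(_ _)/=.
have T0 : 0 < (n + k + L0)%:R :> R by rewrite ltr0n; lia.
rewrite -EFinM lte_fin mulrC ltr_pdivrMr// => /(_ _).
have h1 := HK k Nk.
have h2 : x * (n + k + L0)%:R <= `|x| * (n + k + L0)%:R.
  by apply: ler_wpM2r => //; exact: ler_norm.
have h3 : m%:R < k%:R :> R by rewrite ltr_nat.
have TR : (n + k + L0)%:R = n%:R + k%:R + L0%:R :> R by rewrite !natrD.
have TR' : (n + L0)%:R = n%:R + L0%:R :> R by rewrite natrD.
move=> h4; have : (N1 <= n + k + L0)%N by lia.
move=> /h4; rewrite TR in h2 *; rewrite TR' in hm; lra.
Qed.

End CesaroLimits.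

Section TbsPath.
Context {R : realType} (L L0 : nat).
Hypothesis L0L : (L0.+1 < L)%N.
Variables (r S x : R) (dm : nat -> R).
Local Notation f := (tbs (L := L) (L0 := L0) r S).
Local Notation n := (L - L0.+1)%N.

Lemma tbs_orders t : (0 < t)%N ->
  regular_order f x dm t = r /\
  express_order f x dm t = Num.max 0 (S - position f x dm t).
Proof. by move=> t0; have := ordersE f x dm L0L t0 => -[-> ->]. Qed.

Lemma tbs_raised t : (0 < t)%N -> raised f x dm t - S = Num.max 0 (position f x dm t - S).
Proof.
move=> t0; rewrite /raised (tbs_orders t0).2.
by case: (leP 0 (S - _)) => h1; case: (leP 0 (_ - S)) => h2; lra.
Qed.

Lemma tbs_overshoot1 : raised f x dm 1 - S = Num.max 0 (x - S).
Proof. by rewrite tbs_raised// position1. Qed.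

(** The regular orders entering the position up to period [n] date from before period 1 and are 0,
    so the chain first runs at rate 0. *)
Lemma tbs_overshootS t : (0 < t)%N -> raised f x dm t.+1 - S =
  Num.max 0 (raised f x dm t - S + (if (t <= n)%N then 0 else r) - dm t).
Proof.
move=> t0; rewrite [LHS]tbs_raised// positionS//; congr (Num.max 0 _).
case: leqP => tn.
  have -> : (t - n = 0)%N by lia.
  by have [-> _] := orders0 f x dm; ring.
by rewrite (tbs_orders (_ : 0 < t - n)%N).1 ?subn_gt0//; ring.
Qed.

Lemma tbs_admissible : 0 <= r -> admissible f.
Proof.
move=> r0 t _; split; last by move=> y /=; rewrite r0 le_max lexx.
apply: measurable_fun_pair => //=.
apply: (measurableT_comp (lip_measurable (lip_max 0))).
by apply: measurable_funB.
Qed.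

End TbsPath.

Section TbsCost.
Context {d} {Om : measurableType d} {R : realType} (P : probability Om R).
Context (D : {RV P >-> R}) (dem dem' : int -> {RV P >-> R}) (Ghat : {RV P >-> nat}).
Hypothesis D_ge0 : forall w, 0 <= D w.
Hypothesis dem_law : forall t, distribution P (dem t) = distribution P D.
Hypothesis dem'_law : forall t, distribution P (dem' t) = distribution P D.
Hypothesis Ghat_law : forall k : nat, (0 < k)%N -> P (Ghat @^-1` [set k]) = ((2 ^- k)%:E)%E.
Hypothesis indep : mutually_independent P (source_sigma dem dem' Ghat).
Local Notation L1 X := (P.-integrable [set: Om] (EFin \o X)).
Local Notation Ex X := (Rintegral P [set: Om] X).
Hypothesis iD : L1 D.
Local Notation adapted := (adapted dem dem' Ghat).
Local Notation x0 := (initial_inventory dem' Ghat).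
Variables (h b c : R) (L L0 : nat) (r S : R).
Hypothesis (h_gt0 : 0 < h) (b_gt0 : 0 < b) (c_gt0 : 0 < c).
Hypothesis L0L : (L0.+1 < L)%N.
Hypothesis r_ge0 : 0 <= r.
Local Notation mu := (Ex D).
Local Notation g := (gcost D h b L0).
Local Notation f := (tbs (L := L) (L0 := L0) r S).
Local Notation n := (L - L0.+1)%N.
Local Notation Z := (raisedP dem dem' Ghat f).
Local Notation rho := (rhoP dem dem' Ghat f).
Local Notation ord := (expP dem dem' Ghat f).
Local Notation Tn r j := (iter j (lindley P D r)).
Local Notation u r j := (Tn r j (fun y => y)).

Lemma Ex_le_ae X a : L1 X -> {ae P, forall w, X w <= a} -> Ex X <= a.
Proof.
move=> iX Xa; have iM : L1 (fun w => Num.min (X w) a) by exact: (L1_lip (lip_min a) iX).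
have -> : Ex X = Ex (fun w => Num.min (X w) a).
  rewrite /Rintegral; congr fine; apply: ae_eq_integral => //.
  - exact: measurable_int iX.
  - exact: measurable_int iM.
  by apply: filterS Xa => w Xw _; rewrite min_l.
rewrite -[leRHS](Ex_cst P); apply: Ex_le => //; first exact: L1_cst.
by move=> w; rewrite ge_min lexx orbT.
Qed.

Definition overshoot t w : R := Z t w - S.
Local Notation X := overshoot.

Let adm : admissible f. Proof. exact: tbs_admissible. Qed.

Let n_gt0 : (0 < n)%N. Proof. by rewrite subn_gt0. Qed.

Lemma overshoot1 : X 1 = fun w => Num.max 0 (x0 w - S).
Proof. by apply/funext => w; rewrite /X /raisedP tbs_overshoot1. Qed.

Lemma overshootS t w : (0 < t)%N ->
  X t.+1 w = Num.max 0 (X t w + (if (t <= n)%N then 0 else r) - dem t%:Z w).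
Proof. by move=> t0; rewrite /X /raisedP tbs_overshootS. Qed.

Lemma overshoot_first j : (j <= n)%N ->
  X j.+1 = reflected dem 1 (X 1) (fun=> 0) 0 j.
Proof.
elim: j => [//|j IH] jn; apply/funext => w /=.
by rewrite overshootS// jn (IH (ltnW jn)) add1n.
Qed.

Lemma overshoot_then j : X (n.+1 + j) = reflected dem n.+1 (X n.+1) (fun=> 0) r j.
Proof.
elim: j => [|j IH]; first by rewrite addn0.
apply/funext => w; rewrite addnS overshootS ?addSn// leqNgt ltnS leq_addr/=.
by rewrite -IH addSn.
Qed.

Lemma adapted_overshoot t : (0 < t)%N -> adapted t (X t).
Proof.
move=> t0; apply: adaptedB; last exact: adapted_cst.
exact: (raisedP_adapted L0L adm).
Qed.

Lemma overshoot_L1 t : (0 < t)%N -> L1 (X t).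
Proof.
elim: t => [//|[_ _|t IH _]].
  rewrite overshoot1; apply: (L1_lip (lip_max 0)); apply: L1B; last exact: L1_cst.
  exact: initial_inventory_L1 D_ge0 dem'_law Ghat_law indep iD.
rewrite (_ : X t.+2 = fun w => Num.max 0 (X t.+1 w + (if (t.+1 <= n)%N then 0 else r) - dem t.+1%:Z w)).
  apply: (L1_lip (lip_max 0)); apply: L1B; last exact: (L1_dem dem_law iD).
  by apply: L1D; [exact: IH|exact: L1_cst].
by apply/funext => w; rewrite overshootS.
Qed.

Lemma overshoot_ge0 t w : (0 < t)%N -> 0 <= X t w.
Proof.
case: t => [//|[_|t _]]; first by rewrite overshoot1 le_max lexx.
by rewrite overshootS// le_max lexx.
Qed.

Lemma lindley0_le H k j x : lip k H -> ndecr H -> 0 <= x -> Tn 0 j H x <= H x.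
Proof.
move=> kH nH; elim: j x => [//|j IH] x x0'.
apply: (@le_trans _ _ (lindley P D 0 H x)).
  by apply: (lindley_le 0 D_ge0 iD (iter_lindley_lip 0 iD j kH) kH).
rewrite -[leRHS](Ex_cst P); apply: Ex_le; [|exact: L1_cst|].
  exact: (L1_avg iD _ (lip_max_comp 0 kH)).
by move=> w; apply: nH; rewrite ge_max x0'/= addr0 gerBl.
Qed.

(** A deterministic bound for the first overshoot, valid almost surely as the initial inventory is
    at most 0. *)
Definition xbar : R := Num.max 0 (- S).

Lemma xbar_ge0 : 0 <= xbar. Proof. by rewrite le_max lexx. Qed.

(** At rate 0 the chain only moves down, so the first [n] periods cannot raise the mean of [u], and
    the bound is free of [L]. *)
Lemma Ex_u_overshoot j : Ex (fun w => u r j (X n.+1 w)) <= u r j xbar.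
Proof.
have ul := u_lip r iD j; have un := u_ndecr r iD j.
rewrite (overshoot_first (leqnn n)).
rewrite (Ex_chain dem_law indep iD 0 n (adapted_overshoot (ltn0Sn 0)) (overshoot_L1 (ltn0Sn 0)) ul).
apply: (@le_trans _ _ (Ex (fun w => u r j (X 1 w)))).
  apply: Ex_le.
  - exact: (L1_lip (iter_lindley_lip 0 iD n ul) (overshoot_L1 (ltn0Sn 0))).
  - exact: (L1_lip ul (overshoot_L1 (ltn0Sn 0))).
  - by move=> w; apply: (lindley0_le n ul un); exact: overshoot_ge0.
apply: Ex_le_ae; first exact: (L1_lip ul (overshoot_L1 (ltn0Sn 0))).
have := initial_inventory_le0 Ghat D_ge0 dem'_law; apply: filterS => w xw.
by apply: un; rewrite overshoot1 le_max2//; lra.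
Qed.

Lemma Ex_overshoot j (F : R -> R) k : lip k F ->
  Ex (fun w => F (X (n.+1 + j) w)) = Ex (fun w => Tn r j F (X n.+1 w)).
Proof.
move=> kF; rewrite overshoot_then.
exact: (Ex_chain dem_law indep iD r j (adapted_overshoot (ltn0Sn n)) (overshoot_L1 (ltn0Sn n)) kF).
Qed.

Lemma Ex_overshoot_coupling j (F : R -> R) k : lip k F ->
  `|Ex (fun w => F (X (n.+1 + j) w)) - Tn r j F 0| <= k * (u r j xbar - u r j 0).
Proof.
move=> kF; rewrite (Ex_overshoot j kF); have k0 := lip_ge0 kF.
have lF := iter_lindley_lip r iD j kF; have ul := u_lip r iD j.
have iX := overshoot_L1 (ltn0Sn n).
have iF := L1_lip lF iX; have iu := L1_lip ul iX.
rewrite -[X in _ - X](Ex_cst P) -ExB//; last exact: L1_cst.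
apply: (@le_trans _ _ (Ex (fun w => k * (u r j (X n.+1 w) - u r j 0)))).
  apply: le_trans (Ex_norm _) _; first by apply: L1B => //; exact: L1_cst.
  apply: Ex_le.
  - by apply: L1_norm; apply: L1B => //; exact: L1_cst.
  - by apply: L1Z; apply: L1B => //; exact: L1_cst.
  by move=> w; apply: (iter_lindley_coupling r iD j kF); exact: overshoot_ge0.
rewrite ExZ; last by apply: L1B => //; exact: L1_cst.
rewrite ExB ?Ex_cst//; last exact: L1_cst.
by rewrite ler_wpM2l// lerD2r Ex_u_overshoot.
Qed.

Lemma raised_L1 t : (0 < t)%N -> L1 (Z t).
Proof.
move=> t0; rewrite (_ : Z t = fun w => X t w + S); last first.
  by apply/funext => w; rewrite subrK.
by apply: L1D; [exact: overshoot_L1|exact: L1_cst].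
Qed.

Lemma tbs_rho t w : rho t w = if (0 < t)%N then r else 0.
Proof.
case: t => [|t]; first by rewrite rhoP0.
by rewrite /rhoP (tbs_orders L0L r S (x0 w) _ (ltn0Sn t)).1.
Qed.

Lemma ordSE t w : (0 < t)%N ->
  ord t.+1 w = Z t.+1 w - Z t w - rho (t - n)%N w + dem t%:Z w.
Proof. by move=> t0; rewrite raisedPS//; ring. Qed.

Lemma ord1E w : ord 1 w = Z 1 w - x0 w.
Proof. by rewrite /raisedP /Defs.express_order /raised position1// addrC addKr. Qed.

Lemma ord_L1 t : L1 (ord t).
Proof.
case: t => [|[|t]].
- by rewrite expP0; exact: L1_cst.
- rewrite (_ : ord 1 = fun w => Z 1 w - x0 w); last by apply/funext => w; exact: ord1E.
  apply: L1B; first exact: raised_L1.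
  exact: initial_inventory_L1 D_ge0 dem'_law Ghat_law indep iD.
rewrite (_ : ord t.+2 = fun w => Z t.+2 w - Z t.+1 w - (if (0 < t.+1 - n)%N then r else 0) + dem t.+1%:Z w).
  apply: L1D; last exact: (L1_dem dem_law iD).
  by apply: L1B; [apply: L1B; exact: raised_L1|exact: L1_cst].
by apply/funext => w; rewrite ordSE// tbs_rho.
Qed.

Definition tbs_total (T : nat) : R :=
  \sum_(1 <= s < T.+1) (c * Ex (ord s) + Ex (fun w => g (Z s w))).

Lemma tbs_cost_total : tbs_cost P dem dem' Ghat h b c L0 L r S =
  limn_esup (fun T : nat => (T%:R^-1)%:E * (tbs_total (T - L0)%N)%:E)%E.
Proof.
rewrite /tbs_cost /long_run_cost; congr limn_esup; apply/funext => T.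
congr (_ * _)%E; case: (leqP L0 T) => LT; last first.
  rewrite big_geq; last exact: leqW.
  by rewrite /tbs_total (_ : (T - L0 = 0)%N) ?big_geq//; apply/eqP; rewrite subn_eq0 ltnW.
rewrite -{1}(subnK LT).
rewrite -(sum_addn (fun t => expected_cost P dem dem' Ghat h b c f t)).
rewrite /tbs_total -sumEFin big_nat [RHS]big_nat; apply: eq_bigr => s /andP[s0 _].
rewrite (Ex_costP dem_law indep iD c h_gt0 b_gt0 L0L adm s0)//.
  exact: ord_L1.
exact: raised_L1.
Qed.

Lemma Ex_ordS t : (0 < t)%N ->
  Ex (ord t.+1) = Ex (Z t.+1) - Ex (Z t) - (if (n < t)%N then r else 0) + mu.
Proof.
move=> t0; have i1 := raised_L1 t0; have i2 := raised_L1 (ltn0Sn t).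
rewrite -(Ex_dem dem_law iD t%:Z) -[X in _ - X + _](Ex_cst P) -ExB// -ExB//; last 2 first.
- exact: L1B.
- exact: L1_cst.
rewrite -ExD; last 2 first.
- by apply: L1B; [exact: L1B|exact: L1_cst].
- exact: (L1_dem dem_law iD).
by apply: eq_Ex => w; rewrite ordSE// tbs_rho subn_gt0.
Qed.

Lemma tbs_total_split k : tbs_total (n + k)%N = tbs_total n +
  (c * \sum_(j < k) Ex (ord (n.+1 + j)%N) + \sum_(j < k) Ex (fun w => g (Z (n.+1 + j)%N w))).
Proof.
elim: k => [|k IH]; first by rewrite addn0 !big_ord0 mulr0 !addr0.
rewrite addnS {1}/tbs_total big_nat_recr//= -/(tbs_total _) IH !big_ord_recr/= addSn.
ring.
Qed.

Lemma sum_ord k : \sum_(j < k.+1) Ex (ord (n.+1 + j)%N) =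
  Ex (Z (n.+1 + k)%N) - Ex (Z n) + k.+1%:R * mu - k%:R * r.
Proof.
elim: k => [|k IH].
  rewrite big_ord1 addn0 Ex_ordS// ltnn; ring.
rewrite big_ord_recr/= IH addnS addSn Ex_ordS// ltnS leq_addr.
rewrite -[k.+2%:R]natr1 -[k.+1%:R in X in _ = X]natr1; ring.
Qed.

Lemma ZE j w : Z (n.+1 + j)%N w = S + X (n.+1 + j)%N w.
Proof. by rewrite addrC subrK. Qed.

Let gS_lip : lip (h + b) (fun x => g (S + x)).
Proof. exact: g_shift_lip (gcost_lip iD L0 h_gt0 b_gt0) S. Qed.

(** The express cost comes from the balance [sum_ord], whose end positions have bounded mean; the
    rest is an average along a chain that merges with the one from 0. The value is free of [L],
    which later transfers optimality from one lead time to all. *)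
Lemma tbs_cost_subcritical : r < mu ->
  tbs_cost P dem dem' Ghat h b c L0 L r S =
  (c * (mu - r) + limn (fun j => Tn r j (fun x => g (S + x)) 0))%:E.
Proof.
move=> rmu; rewrite tbs_cost_total; apply: (@limn_esup_cesaro _ n) => e e0.
pose l : R := limn (fun j => Tn r j (fun x => g (S + x)) 0).
have cpl j : `|Ex (fun w => g (Z (n.+1 + j)%N w)) - Tn r j (fun x => g (S + x)) 0| <=
    (h + b) * (u r j xbar - u r j 0).
  rewrite (eq_Ex P (Y := fun w => g (S + X (n.+1 + j)%N w))); last by move=> w; rewrite ZE.
  exact: (Ex_overshoot_coupling j gS_lip).
have [N HN] := cesaro_lindley D_ge0 iD r_ge0 rmu gS_lip xbar_ge0 cpl e0.
have [B [C [B0 C0 uB]]] := sum_u_le D_ge0 iD r_ge0 rmu.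
have u0B := u0_le D_ge0 iD uB.
have EX j : 0 <= Ex (X (n.+1 + j)%N) <= B + xbar.
  apply/andP; split; first by apply: Ex_ge0 => w; exact: overshoot_ge0.
  rewrite (Ex_overshoot j lip_id); apply: le_trans (Ex_u_overshoot j) _.
  apply: le_trans (u_le_id r iD j xbar_ge0) _; by rewrite lerD2r.
have EZ j : Ex (Z (n.+1 + j)%N) = S + Ex (X (n.+1 + j)%N).
  rewrite -{2}(Ex_cst P S) -ExD; [|exact: L1_cst|exact: overshoot_L1].
  by apply: eq_Ex => w; rewrite ZE.
exists (`|tbs_total n| + c * (`|S| + B + xbar + `|Ex (Z n)| + r)), N.+1.
case=> [//|k] Nk; have {}HN := HN k.+1 (ltnW Nk).
rewrite tbs_total_split sum_ord EZ.
have /andP[EX1 EX2] := EX k.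
have C1 := ler_norm (Ex (Z n)); have C2 := lerNnormlW (lexx `|Ex (Z n)|).
have C3 := ler_norm S; have C4 := lerNnormlW (lexx `|S|).
have C5 := ler_norm (tbs_total n); have C6 := lerNnormlW (lexx `|tbs_total n|).
have r0 := r_ge0; have xb := xbar_ge0.
set q := S + Ex (X (n.+1 + k)%N) - Ex (Z n) + r.
have q1 : q <= `|S| + B + xbar + `|Ex (Z n)| + r by rewrite /q; lra.
have q2 : - q <= `|S| + B + xbar + `|Ex (Z n)| + r by rewrite /q; lra.
have cq1 : c * q <= c * (`|S| + B + xbar + `|Ex (Z n)| + r) by rewrite ler_pM2l.
have cq2 : c * - q <= c * (`|S| + B + xbar + `|Ex (Z n)| + r) by rewrite ler_pM2l.
move: HN; rewrite -/l; set sg := \sum_(j < k.+1) _.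
have kr : k%:R = k.+1%:R - 1 :> R by rewrite -[k.+1%:R]natr1 addrK.
rewrite -/l (_ : tbs_total n + _ - _ = tbs_total n + c * q + (sg - k.+1%:R * l)); last first.
  by rewrite kr /q; ring.
rewrite !ler_norml => /andP[s1 s2]; apply/andP; split; lra.
Qed.

(** The mean overshoot tends to infinity by [u_unbounded], and the holding cost grows at least
    linearly in it. *)
Lemma tbs_cost_critical E eta : r = mu -> measurable E -> 0 < fine (P E) -> 0 < eta ->
  (forall w, E w -> r + eta <= D w) ->
  tbs_cost P dem dem' Ghat h b c L0 L r S = +oo%E.
Proof.
move=> rmu mE PE eta0 HE; rewrite tbs_cost_total.
apply: (@limn_esup_cesaro_pinfty _ n) => B.
have mur : mu <= r by rewrite rmu.
(* Once the mean overshoot reaches [W], the linear bound of [gcost_ge_hold] gives mean cost at least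
   the absolute value of [B]. *)
pose W := (`|B| + L0.+1%:R * (h * mu)) / h - S.
have [j0 Hj0] := u_unbounded D_ge0 iD mur mE PE eta0 HE W.
have gB j : (j0 <= j)%N -> `|B| <= Ex (fun w => g (Z (n.+1 + j)%N w)).
  move=> /Hj0 uW.
  have iX := overshoot_L1 (ltn0Sn (n + j)).
  have Xu : u r j 0 <= Ex (X (n.+1 + j)%N).
    rewrite (Ex_overshoot j lip_id) -[leLHS](Ex_cst P); apply: Ex_le; first exact: L1_cst.
      exact: L1_lip (u_lip r iD j) (overshoot_L1 (ltn0Sn n)).
    by move=> w; apply: (u_ndecr r iD j); exact: overshoot_ge0.
  apply: (@le_trans _ _ (Ex (fun w => h * Z (n.+1 + j)%N w - L0.+1%:R * (h * mu)))); last first.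
    apply: Ex_le.
    - apply: L1B; last exact: L1_cst.
      by apply: L1Z; exact: raised_L1.
    - exact: L1_lip (gcost_lip iD L0 h_gt0 b_gt0) (raised_L1 (ltn0Sn _)).
    - by move=> w; exact: (gcost_ge_hold D_ge0 iD L0 h_gt0 b_gt0).
  rewrite ExB; [|by apply: L1Z; exact: raised_L1|exact: L1_cst].
  rewrite ExZ; last exact: raised_L1.
  rewrite Ex_cst (eq_Ex P (Y := fun w => S + X (n.+1 + j)%N w)); last by move=> w; rewrite ZE.
  rewrite ExD ?Ex_cst//; last exact: L1_cst.
  have : h * W <= h * Ex (X (n.+1 + j)%N) by rewrite ler_pM2l//; exact: le_trans Xu.
  have -> : h * W = `|B| + L0.+1%:R * (h * mu) - h * S.
    by rewrite /W mulrBr mulrC divfK// gt_eqF.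
  lra.
have g0 j : 0 <= Ex (fun w => g (Z (n.+1 + j)%N w)).
  by apply: Ex_ge0 => w; exact: (gcost_ge0 D_ge0 iD L0 h_gt0 b_gt0).
have e0 j : 0 <= Ex (ord (n.+1 + j)%N).
  by apply: Ex_ge0 => w; exact: (expP_ge0 _ _ _ L0L adm).
exists (`|B| * j0%:R - tbs_total n), 0%N => k _.
rewrite tbs_total_split.
have se : 0 <= c * \sum_(j < k) Ex (ord (n.+1 + j)%N).
  by apply: mulr_ge0; [exact: ltW|exact: sumr_ge0].
have sg : `|B| * (k%:R - j0%:R) <= \sum_(j < k) Ex (fun w => g (Z (n.+1 + j)%N w)).
  have B0 : 0 <= `|B| by [].
  elim: k {se} => [|k IH].
    by rewrite big_ord0 sub0r mulrN oppr_le0 mulr_ge0.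
  rewrite big_ord_recr/= -natr1; case: (leqP j0 k) => jk.
    have := gB k jk; lra.
  apply: (@le_trans _ _ 0); last by rewrite addr_ge0// sumr_ge0.
  rewrite natr1; apply: mulr_ge0_le0 => //.
  by rewrite subr_le0 ler_nat.
have : B * k%:R <= `|B| * k%:R by apply: ler_wpM2r => //; exact: ler_norm.
lra.
Qed.

End TbsCost.

(** * Asymptotic optimality *)

Section Nondegenerate.
Context {d} {Om : measurableType d} {R : realType}.
Context (P : probability Om R) (D : {RV P >-> R}).
Hypothesis iD : P.-integrable [set: Om] (EFin \o D).
Local Notation L1 X := (P.-integrable [set: Om] (EFin \o X)).
Local Notation Ex X := (Rintegral P [set: Om] X).
Local Notation mu := (Ex D).

Lemma Ex_mean : 'E_P[D]%E = mu%:E.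
Proof. by rewrite unlock; exact: Ex_EFin. Qed.

Lemma ae_le_mean_eq : {ae P, forall w, D w <= mu} -> {ae P, forall w, D w = mu}.
Proof.
move=> Dmu; pose Y w := mu - D w.
have iY : L1 Y by apply: L1B => //; exact: L1_cst.
have mY : measurable_fun [set: Om] (EFin \o Y) by exact: measurable_int iY.
have Y0 : (\int[P]_(w in [set: Om]) `|(EFin \o Y) w|)%E = 0%E.
  rewrite (ae_eq_integral (EFin \o Y)) => //.
  - rewrite (Ex_EFin iY) /Y ExB//; last exact: L1_cst.
    by rewrite Ex_cst subrr.
  - exact: measurableT_comp.
  - by apply: filterS Dmu => w Dw _ /=; rewrite ger0_norm// subr_ge0.
move/(ae_eq_integral_abs P measurableT mY): Y0.
apply: filterS => w /(_ I)/= [] /eqP; rewrite subr_eq0 => /eqP; exact: esym.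
Qed.

(** If [D] exceeded its mean by no fixed amount with positive probability, it would be at most its
    mean almost surely, hence equal to it, with variance 0. *)
Lemma variance_gt0_exceeds_mean : (0 < 'V_P[D])%E ->
  exists E eta, [/\ measurable E, 0 < fine (P E), 0 < eta &
    forall w, E w -> mu + eta <= D w].
Proof.
move=> V0; apply: contrapT => noE.
pose E k := [set w | mu + k.+1%:R^-1 <= D w].
have mE k : measurable (E k).
  rewrite (_ : E k = D @^-1` `[mu + k.+1%:R^-1, +oo[); last by rewrite set_itvcy.
  exact: measurable_funPTI.
have PE k : P (E k) = 0%E.
  apply/eqP; rewrite -[_ == _]negbK; apply/negP => PE0.
  apply: noE; exists (E k), k.+1%:R^-1; split => //.
  by rewrite fine_gt0// lt0e PE0 measure_ge0/= (le_lt_trans (probability_le1 P (mE k)))// ltry.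
have : {ae P, forall w, D w = mu}.
  apply: ae_le_mean_eq.
  have : {ae P, forall w, forall k, ~ E k w}.
    apply: ae_foralln => k.
    have : P.-negligible (E k) by exact: (iffRL (negligibleP P (mE k)) (PE k)).
    by apply: negligibleS => w /= /contrapT.
  apply: filterS => w DE; apply/ler_addgt0Pr => e e0.
  have [k ke] := exists_natr e^-1.
  have /negP := DE k; rewrite -ltNge => /ltW/le_trans; apply.
  rewrite lerD2l invf_ple//; last by rewrite posrE.
  by apply: le_trans ke _; rewrite ler_nat.
move=> Dmu; move: V0; rewrite /variance unlock Ex_mean/= unlock.
rewrite (ae_eq_integral (cst 0%E)) => //.
- by rewrite integral0 ltxx.
- apply/measurable_EFinP.
  by apply: measurable_funM; apply: measurable_funB.
- by apply: filterS Dmu => w Dw _ /=; rewrite mulrfctE/= Dw subrr mulr0.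
Qed.

Lemma mean_gt0 E eta : (forall w, 0 <= D w) -> measurable E -> 0 < fine (P E) ->
  0 < eta -> (forall w, E w -> mu + eta <= D w) -> 0 < mu.
Proof.
move=> D_ge0 mE PE eta0 DE; have mu0 : 0 <= mu by exact: Ex_ge0.
have iE : L1 (\1_E : Om -> R) by exact: integrable_indic.
apply: (@lt_le_trans _ _ (eta * fine (P E))); first exact: mulr_gt0.
rewrite (_ : fine (P E) = Ex \1_E); last by rewrite /Rintegral integral_indic// setIT.
rewrite -ExZ//; apply: Ex_le => //; first exact: L1Z.
move=> w; rewrite indicE; case: (boolP (w \in E)) => [/set_mem/DE|_]; last by rewrite mulr0.
by rewrite mulr1; apply: le_trans; rewrite lerDr.
Qed.
End Nondegenerate.

Lemma cvg_div_squeeze {R : realType} (C : R) (x y : nat -> \bar R) : 0 < C ->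
  (\forall n \near \oo, x n = C%:E /\ (y n <= C%:E)%E) ->
  (forall e, 0 < e -> \forall n \near \oo, ((C - e)%:E <= y n)%E) ->
  (fun n => (x n / y n)%E) @ \oo --> 1%E.
Proof.
move=> C0 xC Cy.
have C20 : 0 < C / 2 by rewrite divr_gt0.
have near_fin (e : R) : 0 < e -> \forall n \near \oo, exists2 o : R,
    (x n / y n)%E = (C / o)%:E & C / 2 <= o /\ C - e <= o <= C.
  move=> e0; near=> n.
  have [xn yn] : x n = C%:E /\ (y n <= C%:E)%E by near: n.
  (* Staying above [C / 2] keeps the denominator away from 0, so that the quotient is one of real
     numbers. *)
  have : ((C - C / 2)%:E <= y n)%E by near: n; exact: Cy.
  have : ((C - e)%:E <= y n)%E by near: n; exact: Cy.
  move: yn; rewrite xn; case: (y n) => [q| |]//; rewrite !lee_fin => qC eq q2.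
  exists q; last by rewrite qC eq; split=> //; lra.
  by rewrite inver gt_eqF// -?EFinM//; lra.
apply/fine_cvgP; split.
  by near=> n; have [q -> _] : exists2 o : R, (x n / y n)%E = (C / o)%:E &
    C / 2 <= o /\ C - 1 <= o <= C by near: n; exact: near_fin.
apply/cvgrPdist_le => e e0.
have d0 : 0 < e * (C / 2) by rewrite mulr_gt0.
near=> n; have [q /= -> [q2 /andP[eq qC]]] : exists2 o : R, (x n / y n)%E = (C / o)%:E &
    C / 2 <= o /\ C - e * (C / 2) <= o <= C by near: n; exact: near_fin.
have q0 : 0 < q by lra.
rewrite /= distrC -{1}(divff (lt0r_neq0 q0)) -mulrBl normrM [X in _ * X]ger0_norm; last first.
  by rewrite invr_ge0 ltW.
rewrite ler_pdivrMr// ger0_norm ?subr_ge0//.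
have : e * (C / 2) <= e * q by rewrite ler_pM2l.
lra.
Unshelve. all: by end_near. Qed.

Theorem corollary1 (R : realType) (d : measure_display) (Om : measurableType d)
    (P : probability Om R) (D : {RV P >-> R}) (dem dem' : int -> {RV P >-> R})
    (Ghat : {RV P >-> nat}) (h b c : R) (L0 : nat)
    (D_ge0 : forall w, 0 <= D w)
    (D_mean : ('E_P[D] < +oo)%E)
    (D_var : (0 < 'V_P[D])%E)
    (dem_law : forall t, distribution P (dem t) = distribution P D)
    (dem'_law : forall t, distribution P (dem' t) = distribution P D)
    (Ghat_law : forall k : nat, (0 < k)%N ->
      P (Ghat @^-1` [set k]) = ((2 ^- k)%:E)%E)
    (indep : mutually_independent P (source_sigma dem dem' Ghat))
    (h_gt0 : 0 < h) (b_gt0 : 0 < b) (c_gt0 : 0 < c)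
    (L1 : nat) (L0L1 : (L0 + 1 < L1)%N) (r S : R)
    (rS_best : best_tbs P dem dem' Ghat h b c L0 L1 D r S) :
  (fun L : nat => (tbs_cost P dem dem' Ghat h b c L0 L r S
                   / opt_cost P dem dem' Ghat h b c L0 L)%E) @ \oo --> 1%E.
Proof.
have iD : P.-integrable [set: Om] (EFin \o D).
  apply/integrableP; split; first exact/measurable_EFinP.
  rewrite (_ : (\int[P]_w _)%E = 'E_P[D]%E)//.
  by rewrite unlock; apply: eq_integral => w _ /=; rewrite ger0_norm.
pose mu := Rintegral P [set: Om] D.
have meanE : 'E_P[D]%E = mu%:E by exact: Ex_mean.
have [E [eta [mE PE eta0 DE]]] := variance_gt0_exceeds_mean iD D_var.
have mu0 : 0 < mu by exact: (mean_gt0 iD D_ge0 mE PE eta0 DE).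
have {}L0L1 : (L0.+1 < L1)%N by rewrite -addn1.
pose V r' s := c * (mu - r') +
  limn (fun j => iter j (lindley P D r') (fun x => gcost D h b L0 (s + x)) 0).
have costE L r' s : (L0.+1 < L)%N -> 0 <= r' -> r' < mu ->
    tbs_cost P dem dem' Ghat h b c L0 L r' s = (V r' s)%:E.
  by move=> L0L r0 rmu; exact: (tbs_cost_subcritical D_ge0 dem_law dem'_law).
case: rS_best; rewrite meanE lee_fin => r0 r_le r_best S_best.
have value_le r' s : (tbs_value P dem dem' Ghat h b c L0 L1 r' <=
    tbs_cost P dem dem' Ghat h b c L0 L1 r' s)%E.
  by apply: ereal_inf_lbound; exists s.
(* At [r = mu] every TBS cost is infinite, whereas the rate 0 has a finite one because [mu > 0]. *)
have rmu : r < mu.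
  rewrite lt_neqAle r_le andbT; apply/eqP => rmu.
  have := le_trans (r_best 0 (lexx _) _) (value_le 0 0).
  rewrite lee_fin (ltW mu0) costE// => /(_ isT).
  rewrite leNgt => /negP; apply; apply: (@lt_le_trans _ _ +oo%E); first exact: ltry.
  apply/ereal_infP => _ [s _ <-].
  by rewrite (tbs_cost_critical D_ge0 dem_law dem'_law Ghat_law indep iD s
    h_gt0 b_gt0 c_gt0 L0L1 r0 rmu mE PE eta0)// rmu.
(* The hypothesis [C0_le] of the lower bound, with [C0 = V r S]: optimality at lead time [L1]
   becomes a statement about values free of [L]. *)
have V_min r' s : 0 <= r' -> r' < mu -> V r S <= V r' s.
  move=> r'0 r'mu; rewrite -lee_fin -!(costE L1)//.
  apply: le_trans (value_le r' s); apply: le_trans (r_best r' r'0 _); last first.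
    by rewrite lee_fin ltW.
  by apply/ereal_infP => _ [s' _ <-]; exact: S_best.
have V0 : 0 < V r S.
  apply: ltr_pwDl; first by rewrite mulr_gt0// subr_gt0.
  have gl := g_shift_lip (gcost_lip iD L0 h_gt0 b_gt0) S.
  apply: limr_ge; first exact: (iter_lindley0_cvg D_ge0 iD r0 rmu gl).
  apply: nearW => j; rewrite -[leLHS](congr1 (@^~ 0) (iter_lindley_cst P D r 0 j)).
  apply: (iter_lindley_le r D_ge0 iD j (lip_cst 0 (lexx 0)) gl) => // y _.
  exact: (gcost_ge0 D_ge0 iD L0 h_gt0 b_gt0).
apply: (cvg_div_squeeze V0).
  near=> L; have L0L : (L0.+1 < L)%N by near: L; exact: nbhs_infty_gt.
  rewrite costE//; split=> //; rewrite -(costE L)//.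
  by apply: ereal_inf_lbound; exists (tbs r S) => //; exact: tbs_admissible.
move=> e e0.
have [Lmin HL] := long_run_cost_ge D_ge0 dem_law indep iD h_gt0 b_gt0 c_gt0 mu0 V_min e0.
near=> L; have L0L : (L0.+1 < L)%N by near: L; exact: nbhs_infty_gt.
apply/ereal_infP => _ [f adm <-]; apply: HL => //.
by near: L; exact: nbhs_infty_ge.
Unshelve. all: by end_near. Qed.
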